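(* Assume $F^1,\dots,F^k$ and $a$ are real-analytic, and let $\beta>0$. Let $U:[0,+\infty)\to\mathcal{U}$ solve $\partial_tU_t=-\mathcal{G}^\beta[U_t]$, $U_0=u_0$, and let $u_\infty\in\mathcal{U}$ be any limiting point of $t\mapsto U_t$. Then $d_{u_\infty}\mathcal{F}^\beta=0$, and $u_\infty\in H^m([0,1],\mathbb{R}^k)$ for every integer $m\ge1$.
   Context: $F:\mathbb{R}^n\to\mathbb{R}^{n\times k}$ is globally Lipschitz with columns $F^1,\dots,F^k$; $x_0\in\mathbb{R}^n$ fixed; $\mathcal{U}=L^2([0,1],\mathbb{R}^k)$; $x_u$ solves $\dot x_u=F(x_u)u$, $x_u(0)=x_0$. $a:\mathbb{R}^n\to[0,\infty)$. $\mathcal{F}^\beta(u)=\frac12\|u\|_{L^2}^2+\beta a(x_u(1))$, $\mathcal{G}^\beta$ the Riesz representative of $d\mathcal{F}^\beta$. A limiting point is $u_\infty$ with $\|U_{t_j}-u_\infty\|_{L^2}\to0$ along some $t_j\to+\infty$. $H^m=W^{m,2}$. *)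

(* Defs.v *)
From HB Require Import structures.
From mathcomp Require Import all_boot all_order all_algebra.
From mathcomp Require Import all_classical all_reals all_analysis.
Set Implicit Arguments. Unset Strict Implicit. Unset Printing Implicit Defensive.
Import Order.TTheory GRing.Theory Num.Theory.
Import numFieldNormedType.Exports.
Local Open Scope classical_set_scope.
Local Open Scope ring_scope.

Section Defs.
Context {R : realType}.

Notation leb := (@lebesgue_measure R).

(* ---------- L^2([0,1], R^k): controls are functions R -> 'cV_k,
   only their values on [0,1] matter ---------- *)

Definition L2sq (k : nat) (u : R -> 'cV[R]_k) : \bar R :=
  (\int[leb]_(s in `[0%R, 1%R]) (\sum_(i < k) (u s i ord0) ^+ 2)%:E)%E.

Definition inL2 (k : nat) (u : R -> 'cV[R]_k) : Prop :=
  (forall i : 'I_k, measurable_fun (`[0%R, 1%R] : set R) (fun s => u s i ord0)) /\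
  (L2sq u < +oo)%E.

Definition L2norm (k : nat) (u : R -> 'cV[R]_k) : R := Num.sqrt (fine (L2sq u)).

Definition L2inner (k : nat) (u v : R -> 'cV[R]_k) : R :=
  fine (\int[leb]_(s in `[0%R, 1%R]) (\sum_(i < k) u s i ord0 * v s i ord0)%:E)%E.

Definition solves (n k : nat) (F : 'cV[R]_n -> 'M[R]_(n, k)) (x0 : 'cV[R]_n)
  (u : R -> 'cV[R]_k) (x : R -> 'cV[R]_n) : Prop :=
  forall i : 'I_n,
    leb.-integrable `[0%R, 1%R] (fun s => ((F (x s) *m u s) i ord0)%:E) /\
    forall s, 0 <= s <= 1 ->
      x s i ord0 = x0 i ord0 +
        fine (\int[leb]_(tau in `[0%R, s]) ((F (x tau) *m u tau) i ord0)%:E)%E.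

(* x_u : the (unique, F being globally Lipschitz) solution *)
Definition traj (n k : nat) (F : 'cV[R]_n -> 'M[R]_(n, k)) (x0 : 'cV[R]_n)
  (u : R -> 'cV[R]_k) : R -> 'cV[R]_n :=
  xget (fun _ => 0) (solves F x0 u).

Definition Fbeta (n k : nat) (F : 'cV[R]_n -> 'M[R]_(n, k)) (x0 : 'cV[R]_n)
  (a : 'cV[R]_n -> R) (beta : R) (u : R -> 'cV[R]_k) : R :=
  2^-1 * L2norm u ^+ 2 + beta * a (traj F x0 u 1).

Definition is_gradient (n k : nat) (F : 'cV[R]_n -> 'M[R]_(n, k)) (x0 : 'cV[R]_n)
  (a : 'cV[R]_n -> R) (beta : R) (u g : R -> 'cV[R]_k) : Prop :=
  inL2 g /\
  forall eps : R, 0 < eps -> exists2 delta : R, 0 < delta &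
    forall h : R -> 'cV[R]_k, inL2 h -> L2norm h < delta ->
      `| Fbeta F x0 a beta (u \+ h) - Fbeta F x0 a beta u - L2inner g h |
        <= eps * L2norm h.

(* U solves  d/dt U_t = - G^beta[U_t] on [0,+oo), strong derivative in L^2
   (one-sided at t = 0). *)
Definition gradient_flow (n k : nat) (F : 'cV[R]_n -> 'M[R]_(n, k)) (x0 : 'cV[R]_n)
  (a : 'cV[R]_n -> R) (beta : R) (U : R -> R -> 'cV[R]_k) : Prop :=
  (forall t, 0 <= t -> inL2 (U t)) /\
  exists G : R -> R -> 'cV[R]_k,
    forall t, 0 <= t ->
      is_gradient F x0 a beta (U t) (G t) /\
      forall eps : R, 0 < eps -> exists2 delta : R, 0 < delta &
        forall h : R, h != 0 -> `|h| < delta -> 0 <= t + h ->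
          L2norm (fun s => h^-1 *: (U (t + h) s - U t s) + G t s) <= eps.

Definition limiting_point (k : nat) (U : R -> R -> 'cV[R]_k) (uinf : R -> 'cV[R]_k)
  : Prop :=
  inL2 uinf /\
  exists tj : nat -> R,
    tj @ \oo --> +oo /\
    (fun j => L2norm (fun s => U (tj j) s - uinf s)) @ \oo --> 0.

Definition mindex (n d : nat) := {ffun 'I_n -> 'I_d.+1}.
Definition mdeg (n d : nat) (al : mindex n d) : nat := \sum_(i < n) (al i : nat).

Definition real_analytic (n : nat) (f : 'cV[R]_n -> R) : Prop :=
  forall p : 'cV[R]_n, exists2 r : R, 0 < r &
    exists c : (('I_n -> nat) -> R),
      (* absolute convergence on the closed polydisc of radius r *)
      cvg (series (fun d => \sum_(al : mindex n d | mdeg al == d)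
                              `|c (fun i => al i : nat)| * r ^+ d) @ \oo) /\
      forall x : 'cV[R]_n, (forall i, `|x i ord0 - p i ord0| < r) ->
        series (fun d => \sum_(al : mindex n d | mdeg al == d)
                   c (fun i => al i : nat) *
                   \prod_(i < n) (x i ord0 - p i ord0) ^+ (al i : nat))
          @ \oo --> f x.

Definition test_function (phi : R -> R) : Prop :=
  (forall (j : nat) (x : R), derivable (derive1n j phi) x 1) /\
  exists a b : R, [/\ 0 < a, a <= b, b < 1 &
                   forall x, x < a \/ b < x -> phi x = 0].

Definition inH (m k : nat) (u : R -> 'cV[R]_k) : Prop :=
  exists g : nat -> R -> 'cV[R]_k,
    [/\ g 0%N = u,
        forall j, (j <= m)%N -> inL2 (g j) &
        forall j, (j < m)%N -> forall phi, test_function phi -> forall i : 'I_k,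
          (\int[leb]_(s in `[0%R, 1%R]) (g j s i ord0 * derive1 phi s)%:E =
           - \int[leb]_(s in `[0%R, 1%R]) (g j.+1 s i ord0 * phi s)%:E)%E].

End Defs.

(* Main.v *)
Require Import Defs.
From HB Require Import structures.
From mathcomp Require Import all_boot all_order all_algebra.
From mathcomp Require Import all_classical all_reals all_analysis.
From mathcomp Require Import measurable_realfun ring lra.
Set Implicit Arguments. Unset Strict Implicit. Unset Printing Implicit Defensive.
Import Order.TTheory GRing.Theory Num.Theory.
Import numFieldNormedType.Exports.
Local Open Scope classical_set_scope.
Local Open Scope ring_scope.

(* Analyticity is only used through C^infinity regularity.  The cost is locally
   C^{1,1} with gradient [v + beta F(x_v)^T lam_v], where [lam_v] solves the
   backward adjoint equation: there are [rho], [C] such that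
   |cost w - cost v - <grad v, w - v>| <= C |w - v|^2 for all v, w in the ball
   of radius [rho] around [uinf].  Along the flow the energy is nonincreasing and
   bounded below, so on [tj, tj + 1] the flow moves little and, by the mean value
   theorem, its gradient is small at some time.  Inserting these almost critical
   points v -> uinf in the estimate gives |cost w - cost uinf| <= C |w - uinf|^2,
   so [uinf] is critical.  Then uinf = - beta F(x)^T lam almost everywhere, which
   turns the equations of (x, lam) into an autonomous analytic system, whose
   solutions are smooth. *)

(** * Power series in several variables *)

(** The flow is known to approach [uinf] only along [tj], and its gradient [G] is given abstractly,
    so the limit is taken in energies: with a remainder bound uniform in the base point v, the
    gradient at v enters only through its norm, and v can tend to [uinf]. The bound itself comes
    from pairing x_w - x_v with the adjoint. After integration by parts, what remains besides the
    gradient is a product of the increments of F(x) and of the control, and a Taylor remainder of F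
    of size |x_w - x_v|^2. Both are quadratic because trajectories depend on controls in a Lipschitz
    way. Controls are merely L^2, so x and lam solve integral equations whose Lipschitz rate is only
    square integrable in time. In the sup norm with exponential weight of exponent 2 A + 1, where A
    bounds the squared L^2 norm of that rate, the Volterra operator contracts by 1/2 on all of [0,1]
    at once. This one estimate gives existence, stability and bounds, forward from 0 for x and
    backward from 1 for lam. *)

Section Jets.
Context {R : realType}.

Lemma le_of_eq (x y : R) : x = y -> x <= y.
Proof. by move=> ->. Qed.

(* [Q] is the linear part of the increment [P' - P] of a monomial of degree [d].
   The factors [rho] and [rho ^+ 2] avoid the truncated exponents [d - 1], [d - 2]. *)
Definition jet (rho D : R) (d : nat) (P P' Q : R) : Prop :=
  [/\ `|P| <= rho ^+ d, `|P'| <= rho ^+ d,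
      rho * `|P' - P| <= d%:R * rho ^+ d * D &
      rho ^+ 2 * `|P' - P - Q| <= d%:R ^+ 2 * rho ^+ d * D ^+ 2].

(** The remainder of a product is R1 P2 + P1 R2 + (P1' - P1)(P2' - P2), with R1, R2 the remainders
    of the factors. The three terms cost d1^2, d2^2 and d1 d2, together at most (d1 + d2)^2, so the
    square of the degree is a growth stable under products. *)
Lemma jet_mul (rho D : R) d1 d2 P1 P1' Q1 P2 P2' Q2 : 0 <= rho -> 0 <= D ->
  jet rho D d1 P1 P1' Q1 -> jet rho D d2 P2 P2' Q2 ->
  jet rho D (d1 + d2) (P1 * P2) (P1' * P2') (Q1 * P2 + P1 * Q2).
Proof.
move=> r0 D0 [a1 b1 c1 e1] [a2 b2 c2 e2].
have r1 : 0 <= rho ^+ d1 by exact: exprn_ge0.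
have r2 : 0 <= rho ^+ d2 by exact: exprn_ge0.
split.
- by rewrite normrM exprD ler_pM.
- by rewrite normrM exprD ler_pM.
- have -> : P1' * P2' - P1 * P2 = (P1' - P1) * P2 + P1' * (P2' - P2) by ring.
  have h1 : rho * `|(P1' - P1) * P2| <= d1%:R * rho ^+ d1 * D * rho ^+ d2.
    by rewrite normrM mulrA ler_pM // mulr_ge0.
  have h2 : rho * `|P1' * (P2' - P2)| <= rho ^+ d1 * (d2%:R * rho ^+ d2 * D).
    by rewrite normrM mulrCA ler_pM // mulr_ge0.
  apply: le_trans (ler_wpM2l r0 (ler_normD _ _)) _.
  rewrite mulrDr; apply: le_trans (lerD h1 h2) _.
  by rewrite natrD exprD; apply: le_of_eq; ring.
- have -> : P1' * P2' - P1 * P2 - (Q1 * P2 + P1 * Q2) =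
    (P1' - P1 - Q1) * P2 + P1 * (P2' - P2 - Q2) + (P1' - P1) * (P2' - P2) by ring.
  have h1 : rho ^+ 2 * `|(P1' - P1 - Q1) * P2| <=
      d1%:R ^+ 2 * rho ^+ d1 * D ^+ 2 * rho ^+ d2.
    by rewrite normrM mulrA ler_pM // mulr_ge0 // exprn_ge0.
  have h2 : rho ^+ 2 * `|P1 * (P2' - P2 - Q2)| <=
      rho ^+ d1 * (d2%:R ^+ 2 * rho ^+ d2 * D ^+ 2).
    by rewrite normrM mulrCA ler_pM // mulr_ge0 // exprn_ge0.
  have h3 : rho ^+ 2 * `|(P1' - P1) * (P2' - P2)| <=
      (d1%:R * rho ^+ d1 * D) * (d2%:R * rho ^+ d2 * D).
    by rewrite normrM expr2 mulrACA ler_pM // mulr_ge0.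
  have h4 : 0 <= d1%:R * d2%:R * (rho ^+ d1 * rho ^+ d2) * D ^+ 2.
    by rewrite !mulr_ge0 // exprn_ge0.
  apply: le_trans (ler_wpM2l (exprn_ge0 _ r0) (ler_normD _ _)) _.
  rewrite mulrDr.
  apply: le_trans (lerD (ler_wpM2l (exprn_ge0 _ r0) (ler_normD _ _)) h3) _.
  rewrite mulrDr.
  apply: le_trans (lerD (lerD h1 h2) (lexx _)) _.
  rewrite natrD exprD -subr_ge0; apply: le_trans h4 _; apply: le_of_eq; ring.
Qed.

Lemma jet_one (rho D : R) : jet rho D 0 1 1 0.
Proof.
by split; rewrite ?subrr ?normr1 ?normr0 ?expr0 ?mulr0 ?subr0 ?normr0 ?mulr0 ?expr0n ?mul0r.
Qed.

Lemma jet_exp (rho D y y' : R) m : 0 <= rho -> 0 <= D ->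
  `|y| <= rho -> `|y'| <= rho -> `|y' - y| <= D ->
  jet rho D m (y ^+ m) (y' ^+ m) (m%:R * y ^+ m.-1 * (y' - y)).
Proof.
move=> r0 D0 hy hy' hd.
have j1 : jet rho D 1 y y' (y' - y).
  split; rewrite ?expr1 ?mul1r ?subrr ?normr0 ?mulr0 //; first by rewrite ler_wpM2l.
  by rewrite !mulr_ge0 // exprn_ge0.
elim: m => [|m IH].
  by rewrite !expr0 !mul0r; exact: jet_one.
have := jet_mul r0 D0 j1 IH; rewrite add1n -!exprS.
suff -> : (y' - y) * y ^+ m + y * (m%:R * y ^+ m.-1 * (y' - y)) =
  m.+1%:R * y ^+ m.+1.-1 * (y' - y) by [].
case: m {IH} => [|m] /=; first by rewrite !expr0; ring.
by rewrite !exprS -[in RHS]natr1; ring.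
Qed.

Definition mono n (al : 'I_n -> nat) (y : 'I_n -> R) : R := \prod_(i < n) y i ^+ al i.

(** The partial derivative of [mono al] in direction [l]. Truncation of the exponent at [al l = 0]
    is harmless, since the factor [(al l)%:R] then vanishes. *)
Definition dmono n (al : 'I_n -> nat) (l : 'I_n) (y : 'I_n -> R) : R :=
  (al l)%:R * \prod_(i < n) y i ^+ (al i - (i == l)).

Lemma jet_mono n (al : 'I_n -> nat) (y y' : 'I_n -> R) (rho D : R) :
  0 <= rho -> 0 <= D -> (forall i, `|y i| <= rho) -> (forall i, `|y' i| <= rho) ->
  (forall i, `|y' i - y i| <= D) ->
  jet rho D (\sum_(i < n) al i) (mono al y) (mono al y')
    (\sum_(l < n) dmono al l y * (y' l - y l)).
Proof.
move=> r0 D0; elim: n al y y' => [|n IH] al y y' hy hy' hd.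
  by rewrite /mono !big_ord0; exact: jet_one.
rewrite /mono !big_ord_recl.
have J0 := jet_exp (al ord0) r0 D0 (hy ord0) (hy' ord0) (hd ord0).
have J1 := IH (fun i => al (lift ord0 i)) _ _ (fun i => hy (lift ord0 i))
  (fun i => hy' (lift ord0 i)) (fun i => hd (lift ord0 i)).
have := jet_mul r0 D0 J0 J1.
suff -> : (al ord0)%:R * y ord0 ^+ (al ord0).-1 * (y' ord0 - y ord0) *
       mono (fun i => al (lift ord0 i)) (fun i => y (lift ord0 i)) +
     y ord0 ^+ al ord0 *
       (\sum_(l < n) dmono (fun i => al (lift ord0 i)) l (fun i => y (lift ord0 i)) *
          (y' (lift ord0 l) - y (lift ord0 l))) =
     dmono al ord0 y * (y' ord0 - y ord0) +
       \sum_(i < n) dmono al (lift ord0 i) y * (y' (lift ord0 i) - y (lift ord0 i)) by [].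
congr (_ + _).
  rewrite /dmono big_ord_recl /= subn1 /mono.
  rewrite [in RHS](eq_bigr (fun i => y (lift ord0 i) ^+ al (lift ord0 i))); last first.
    by move=> i _; rewrite subn0.
  ring.
rewrite mulr_sumr; apply: eq_bigr => l _.
rewrite /dmono [in RHS]big_ord_recl /= subn0.
rewrite [in RHS](eq_bigr (fun i => y (lift ord0 i) ^+ (al (lift ord0 i) - (i == l)))).
  ring.
by move=> i _; rewrite (inj_eq (@lift_inj _ ord0)).
Qed.

End Jets.

(** * Homogeneous parts of a power series and their termwise derivatives *)

Section PowerSeries.
Context {R : realType}.

Lemma sum_unit_mindex n (l : 'I_n) : (\sum_(i < n) (i == l))%N = 1%N.
Proof. by rewrite (bigD1 l) //= eqxx big1 ?addn0 // => i /negbTE ->. Qed.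

(** The type of multi-indices depends on the degree, so raising one exponent changes the type and
    goes through [inord]. The map [h] adds the unit index e_l; [h'] inverts it on the indices with a
    nonzero entry at [l]. *)
Lemma mindex_shift n d (l : 'I_n) (G : ('I_n -> nat) -> R) :
  \sum_(be : mindex n d | mdeg be == d) G (fun i => (be i + (i == l))%N) =
  \sum_(al : mindex n d.+1 | (mdeg al == d.+1) && (al l != 0%N :> nat)) G (fun i => al i : nat).
Proof.
pose h (be : mindex n d) : mindex n d.+1 := [ffun i => inord (be i + (i == l))].
pose h' (al : mindex n d.+1) : mindex n d := [ffun i => inord (al i - (i == l))].
have hE (be : mindex n d) i : h be i = (be i + (i == l))%N :> nat.
  rewrite ffunE inordK // ltnS; apply: (@leq_trans (d + 1)%N); last by rewrite addn1.
  by apply: leq_add; [rewrite -ltnS; exact: ltn_ord | case: eqP].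
rewrite (reindex_onto h h') => [|al /andP[/eqP dal al0]].
  apply: eq_big => [be|be _]; last by congr G; apply/funext => i; rewrite hE.
  have -> : mdeg (h be) = (mdeg be).+1.
    rewrite /mdeg; under eq_bigr => i _ do rewrite hE.
    by rewrite big_split /= sum_unit_mindex addn1.
  rewrite eqSS hE eqxx addn1 /= andbT.
  suff -> : h' (h be) == be by rewrite andbT.
  apply/eqP/ffunP => i; apply: val_inj; rewrite /= ffunE inordK hE addnK //.
apply/ffunP => i; apply: val_inj; rewrite /= hE ffunE.
(* An entry other than the one at [l] is at most d, because the entry at [l] already uses one unit
   of the degree d + 1. *)
have le_al : (al i - (i == l) < d.+1)%N.
  case: eqP => [->|/eqP il].
    by rewrite subn1 prednK ?lt0n // -ltnS; exact: ltn_ord.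
  have : (al i + al l <= mdeg al)%N.
    by rewrite /mdeg (bigD1 i) //= (bigD1 l) 1?eq_sym //= leq_add2l leq_addr.
  rewrite subn0 dal; apply: leq_trans; rewrite -[X in (X <= _)%N]addn1.
  by apply: leq_add => //; rewrite lt0n.
rewrite inordK // subnK //; case: eqP => [->|//]; by rewrite lt0n.
Qed.

Definition hterm n (c : ('I_n -> nat) -> R) d (y : 'I_n -> R) : R :=
  \sum_(al : mindex n d | mdeg al == d) c (fun i => al i : nat) * mono (fun i => al i : nat) y.

Definition habs n (c : ('I_n -> nat) -> R) d : R :=
  \sum_(al : mindex n d | mdeg al == d) `|c (fun i => al i : nat)|.

(** The coefficients of the formal partial derivative in direction [l] of the series with
    coefficients [c]. *)
Definition dcoef n (l : 'I_n) (c : ('I_n -> nat) -> R) (al : 'I_n -> nat) : R :=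
  (al l).+1%:R * c (fun i => (al i + (i == l))%N).

Lemma habs_ge0 n (c : ('I_n -> nat) -> R) d : 0 <= habs c d.
Proof. exact: sumr_ge0. Qed.

Lemma mindex_shift0 n d (l : 'I_n) (G : ('I_n -> nat) -> R) :
  (forall al, al l = 0%N -> G al = 0) ->
  \sum_(be : mindex n d | mdeg be == d) G (fun i => (be i + (i == l))%N) =
  \sum_(al : mindex n d.+1 | mdeg al == d.+1) G (fun i => al i : nat).
Proof.
move=> G0; rewrite mindex_shift big_mkcondr /=; apply: eq_bigr => al _.
by case: eqP => //= al0; rewrite G0.
Qed.

Lemma hterm_dcoef n (l : 'I_n) (c : ('I_n -> nat) -> R) d y :
  hterm (dcoef l c) d y =
  \sum_(al : mindex n d.+1 | mdeg al == d.+1)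
    c (fun i => al i : nat) * dmono (fun i => al i : nat) l y.
Proof.
rewrite -(@mindex_shift0 n d l (fun al => c al * dmono al l y)); last first.
  by move=> al al0; rewrite /dmono al0 mul0r mulr0.
apply: eq_bigr => be _; rewrite /dcoef /dmono eqxx addn1 /mono.
rewrite [in RHS](eq_bigr (fun i => y i ^+ be i)); first by ring.
by move=> i _; rewrite addnK.
Qed.

Lemma habs_dcoef n (l : 'I_n) (c : ('I_n -> nat) -> R) d :
  habs (dcoef l c) d <= d.+1%:R * habs c d.+1.
Proof.
have -> : habs (dcoef l c) d = \sum_(al : mindex n d.+1 | mdeg al == d.+1)
    (al l : nat)%:R * `|c (fun i => al i : nat)|.
  rewrite -(@mindex_shift0 n d l (fun al => (al l)%:R * `|c al|)); last first.
    by move=> al ->; rewrite mul0r.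
  by apply: eq_bigr => be _; rewrite /dcoef normrM normr_nat eqxx addn1.
rewrite /habs mulr_sumr; apply: ler_sum => al _; apply: ler_wpM2r => //.
by rewrite ler_nat -ltnS; exact: ltn_ord.
Qed.

Lemma mono_bound n (al : 'I_n -> nat) (y : 'I_n -> R) (rho : R) : 0 <= rho ->
  (forall i, `|y i| <= rho) -> `|mono al y| <= rho ^+ (\sum_(i < n) al i).
Proof.
move=> r0 hy; rewrite /mono normr_prod expr_sum.
by apply: ler_prod => i _; rewrite normr_ge0 normrX lerXn2r ?nnegrE.
Qed.

Lemma hterm_bound n (c : ('I_n -> nat) -> R) d (y : 'I_n -> R) (rho : R) : 0 <= rho ->
  (forall i, `|y i| <= rho) -> `|hterm c d y| <= habs c d * rho ^+ d.
Proof.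
move=> r0 hy; rewrite /hterm /habs mulr_suml.
apply: le_trans (ler_norm_sum _ _ _) _; apply: ler_sum => al /eqP dal.
by rewrite normrM ler_wpM2l // -[in leRHS]dal; exact: mono_bound.
Qed.

Lemma hterm_taylor n (c : ('I_n -> nat) -> R) d (y y' : 'I_n -> R) (rho D : R) :
  0 <= rho -> 0 <= D -> (forall i, `|y i| <= rho) -> (forall i, `|y' i| <= rho) ->
  (forall i, `|y' i - y i| <= D) ->
  rho ^+ 2 * `|hterm c d.+1 y' - hterm c d.+1 y -
     \sum_(l < n) hterm (dcoef l c) d y * (y' l - y l)| <=
  habs c d.+1 * (d.+1%:R ^+ 2 * rho ^+ d.+1 * D ^+ 2).
Proof.
move=> r0 D0 hy hy' hd.
have -> : hterm c d.+1 y' - hterm c d.+1 y -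
     \sum_(l < n) hterm (dcoef l c) d y * (y' l - y l) =
  \sum_(al : mindex n d.+1 | mdeg al == d.+1) c (fun i => al i : nat) *
    (mono (fun i => al i : nat) y' - mono (fun i => al i : nat) y -
     \sum_(l < n) dmono (fun i => al i : nat) l y * (y' l - y l)).
  under [in LHS]eq_bigr => l _ do rewrite hterm_dcoef mulr_suml.
  rewrite exchange_big /= /hterm -!sumrB; apply: eq_bigr => al _.
  rewrite !mulrBr mulr_sumr; congr (_ - _); apply: eq_bigr => l _.
  by rewrite -!mulrA.
rewrite /habs mulr_suml.
apply: le_trans (ler_wpM2l (exprn_ge0 _ r0) (ler_norm_sum _ _ _)) _.
rewrite mulr_sumr; apply: ler_sum => al /eqP dal.
rewrite normrM mulrCA ler_wpM2l //.
have [_ _ _] := jet_mono (fun i => al i : nat) r0 D0 hy hy' hd.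
by rewrite [(\sum_(i < n) al i)%N]dal.
Qed.

End PowerSeries.

(** * Differentiation of a convergent expansion on a smaller polydisc *)

Section AnalyticDerivative.
Context {R : realType}.

Definition vsub n (x p : 'cV[R]_n) : 'I_n -> R := fun i => x i ord0 - p i ord0.

Definition expansion n (f : 'cV[R]_n -> R) (p : 'cV[R]_n) (r : R)
    (c : ('I_n -> nat) -> R) : Prop :=
  cvgn (series (fun d => habs c d * r ^+ d)) /\
  forall x, (forall i, `|vsub x p i| < r) -> series (fun d => hterm c d (vsub x p)) @ \oo --> f x.

Lemma real_analyticP n (f : 'cV[R]_n -> R) :
  real_analytic f <-> forall p, exists2 r : R, 0 < r & exists c, expansion f p r c.
Proof.
have aux c r : (fun d => \sum_(al : mindex n d | mdeg al == d)
    `|c (fun i => al i : nat)| * r ^+ d) = (fun d => habs c d * r ^+ d) :> (nat -> R).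
  by apply/funext => d; rewrite /habs mulr_suml.
by split=> fa p; have [r r0 [c [h1 h2]]] := fa p; exists r => //; exists c; split;
  rewrite ?aux // -?aux.
Qed.

Lemma sqr_mul_geometric d : d.+1%:R ^+ 2 * (8%:R^-1) ^+ d <= (2%:R^-1) ^+ d :> R.
Proof.
have h : d.+1%:R <= 2%:R ^+ d :> R by rewrite -natrX ler_nat ltn_expl.
have -> : 8%:R^-1 = 2%:R^-1 ^+ 2 * 2%:R^-1 :> R by field.
rewrite exprMn mulrA -[leRHS]mul1r ler_wpM2r ?exprn_ge0 //.
rewrite exprAC -exprMn expr_le1 // ?mulr_ge0 ?exprn_ge0 //.
by rewrite exprVn ler_pdivrMr ?mul1r // exprn_gt0.
Qed.

(* The radius [r / 8] comes from (d + 1)^2 8^-d <= 2^-d. *)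
Lemma expansion_coef_bound n (f : 'cV[R]_n -> R) p r c : 0 < r -> expansion f p r c ->
  exists2 M, 0 < M & forall d,
    habs c d.+1 * (d.+1%:R ^+ 2 * (r / 8%:R) ^+ d) <= geometric M 2%:R^-1 d.
Proof.
move=> r0 [/cvg_series_bounded/pinfty_ex_gt0[M M0 hM] _].
exists (M / r) => [|d]; first exact: divr_gt0.
have {}hM : habs c d.+1 * r ^+ d <= M / r.
  rewrite ler_pdivlMr // -mulrA -exprSr; apply: le_trans (hM d.+1 I).
  exact: ler_norm.
rewrite expr_div_n -exprVn /geometric /= mulrACA mulrC.
apply: le_trans (_ : (habs c d.+1 * r ^+ d) * (d.+1%:R ^+ 2 * (8%:R^-1) ^+ d) <= _).
  by apply: le_of_eq; ring.
apply: ler_pM => //; last exact: sqr_mul_geometric.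
by rewrite mulr_ge0 ?habs_ge0 // exprn_ge0 // ltW.
Qed.

(** The second-order remainder is bounded degree by degree for polynomials, with summable constants,
    and then passes to the limit of the partial sums. Thus no derivative of an infinite sum has to
    be computed. *)
Lemma expansion_deriv n (f : 'cV[R]_n -> R) p r c : 0 < r -> expansion f p r c ->
  exists g : 'I_n -> 'cV[R]_n -> R,
  (forall l, expansion (g l) p (r / 8%:R) (dcoef l c)) /\
  exists C : R, forall x y (D : R), (forall i, `|vsub x p i| < r / 8%:R) ->
    (forall i, `|vsub y p i| < r / 8%:R) -> (forall i, `|vsub y x i| <= D) -> 0 <= D ->
    `|f y - f x - \sum_l g l x * vsub y x l| <= C * D ^+ 2.
Proof.
move=> r0 ex; have [M M0 hM] := expansion_coef_bound r0 ex.
have [_ hf] := ex; set rho := r / 8%:R in hM *.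
have rho0 : 0 < rho by rewrite divr_gt0.
have rho_r : rho < r by rewrite ltr_pdivrMr // ltr_pMr // ltr1n.
have h2 : `|2%:R^-1 : R| < 1 by rewrite ger0_norm // invf_lt1 // ltr1n.
have cg l : cvgn (series (fun d => habs (dcoef l c) d * rho ^+ d)).
  apply: (series_le_cvg _ _ _ (@is_cvg_geometric_series _ M _ h2)).
  - by move=> d; rewrite mulr_ge0 ?habs_ge0 // exprn_ge0 // ltW.
  - by move=> d; rewrite geometric_ge0 // ltW.
  - move=> d; have r1 := exprn_ge0 d (ltW rho0).
    apply: le_trans (hM d); rewrite mulrA ler_wpM2r //.
    apply: le_trans (habs_dcoef _ _ _) _; rewrite mulrC ler_wpM2l ?habs_ge0 //.
    by rewrite expr2 ler_pMl ?ltr0n // ler1n.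
pose g l x := limn (series (fun d => hterm (dcoef l c) d (vsub x p))).
have gE l x : (forall i, `|vsub x p i| < rho) ->
    series (fun d => hterm (dcoef l c) d (vsub x p)) @ \oo --> g l x.
  move=> hx; apply: normed_cvg; apply: (series_le_cvg _ _ _ (cg l)) => d.
  - exact: normr_ge0.
  - by apply: mulr_ge0; [exact: habs_ge0 | rewrite exprn_ge0 // ltW].
  by apply: hterm_bound; [exact: ltW | move=> i; exact: ltW].
exists g; split; first by move=> l; split => // x; exact: gE.
(* The sum of the geometric bounds M 2^-d. Each degree contributes rho D^2, while [hterm_taylor]
   carries rho^2 on the left, whence the quotient by rho. *)
exists (M * (1 - 2%:R^-1)^-1 / rho) => x y D hx hy hd D0.
(* The expansion of [f] is cut one degree later than those of its derivatives: the term of degree d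
   + 1 has derivatives of degree d, and the constant terms cancel. *)
pose E N := series (fun d => hterm c d (vsub y p)) N.+1 -
  series (fun d => hterm c d (vsub x p)) N.+1 -
  \sum_l series (fun d => hterm (dcoef l c) d (vsub x p)) N * vsub y x l.
have cE : E @ \oo --> f y - f x - \sum_l g l x * vsub y x l.
  apply: cvgB; first apply: cvgB.
  - by move: (hf y (fun i => lt_trans (hy i) rho_r)); rewrite -cvg_shiftS; exact.
  - by move: (hf x (fun i => lt_trans (hx i) rho_r)); rewrite -cvg_shiftS; exact.
  apply: cvg_big => [|l _]; first exact: add_continuous.
  by apply: cvgMr_tmp; exact: gE.
have EE N : E N = \sum_(d < N) (hterm c d.+1 (vsub y p) - hterm c d.+1 (vsub x p) -
     \sum_(l < n) hterm (dcoef l c) d (vsub x p) * (vsub y p l - vsub x p l)).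
  rewrite /E /series /= !big_mkord !big_ord_recl.
  have -> : hterm c 0 (vsub y p) = hterm c 0 (vsub x p).
    rewrite /hterm; apply: eq_bigr => al _; congr (_ * _); rewrite /mono.
    by apply: eq_bigr => i _; rewrite ord1 !expr0.
  rewrite opprD addrACA subrr add0r -sumrB.
  rewrite [RHS]sumrB exchange_big /=; congr (_ - _).
  apply: eq_bigr => l _; rewrite big_mkord mulr_suml; apply: eq_bigr => d _.
  by congr (_ * _); rewrite /vsub; ring.
apply: (cvgr_to_le (cvg_norm cE)); near=> N; rewrite EE.
rewrite -(ler_pM2l (exprn_gt0 2 rho0)).
apply: le_trans (ler_wpM2l (exprn_ge0 _ (ltW rho0)) (ler_norm_sum _ _ _)) _.
rewrite mulr_sumr.
apply: le_trans (_ : \sum_(d < N) geometric M 2%:R^-1 d * (rho * D ^+ 2) <= _).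
  apply: ler_sum => d _.
  apply: le_trans (@hterm_taylor _ _ c d _ _ _ D (ltW rho0) D0 _ _ _) _.
  - by move=> i; exact: ltW.
  - by move=> i; exact: ltW.
  - by move=> i; have := hd i; rewrite /vsub opprB addrA subrK.
  rewrite (_ : _ * rho ^+ d.+1 * _ = (d.+1%:R ^+ 2 * rho ^+ d) * (rho * D ^+ 2)); last first.
    by rewrite (exprS rho); ring.
  rewrite [habs _ _ * _]mulrA; apply: ler_wpM2r; last exact: hM.
  by rewrite mulr_ge0 ?exprn_ge0 // ltW.
rewrite -mulr_suml.
have -> : rho ^+ 2 * (M * (1 - 2^-1)^-1 / rho * D ^+ 2) =
    M * (1 - 2^-1)^-1 * (rho * D ^+ 2).
  by field; rewrite gt_eqF.
apply: ler_wpM2r; first by rewrite mulr_ge0 ?exprn_ge0 // ltW.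
have := @geometric_le_lim _ N M 2%:R^-1 (ltW M0) _ h2.
by rewrite /series /= big_mkord; apply; rewrite invr_gt0.
Unshelve. all: by end_near. Qed.

End AnalyticDerivative.

(** * Gradients of real-analytic functions *)

Section GlobalGradient.
Context {R : realType}.

Lemma entry_le_norm m n (x : 'M[R]_(m, n)) i j : `|x i j| <= `|x|.
Proof.
rewrite [leRHS]/Num.norm /= mx_normrE; apply/bigmax_geP; right => /=.
by exists (i, j).
Qed.

Lemma norm_le_entries m n (x : 'M[R]_(m, n)) (D : R) : 0 <= D ->
  (forall i j, `|x i j| <= D) -> `|x| <= D.
Proof.
move=> D0 h; rewrite [leLHS]/Num.norm /= mx_normrE; apply/bigmax_leP; split=> [//|[i j] _]; exact: h.
Qed.

Lemma linear_le_sqr_eq0 (a C t0 : R) : 0 < t0 ->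
  (forall t, 0 < t -> t < t0 -> `|a| * t <= C * t ^+ 2) -> a = 0.
Proof.
move=> t00 h; apply/eqP; rewrite -normr_le0 leNgt; apply/negP => a0.
have C1 : 0 < `|C| + 1 by rewrite ltr_wpDl.
pose t := Num.min (t0 / 2) (`|a| / (2 * (`|C| + 1))).
have t_gt0 : 0 < t by rewrite lt_min !divr_gt0 // mulr_gt0.
have tt0 : t < t0.
  by apply: (@le_lt_trans _ _ (t0 / 2)); [rewrite ge_min lexx | lra].
have ta : t * (2 * (`|C| + 1)) <= `|a|.
  by rewrite -ler_pdivlMr ?mulr_gt0 // ge_min lexx orbT.
have := h t t_gt0 tt0; rewrite expr2 mulrA ler_pM2r //.
have : C * t <= `|C| * t by rewrite ler_wpM2r ?ler_norm // ltW.
have : 0 <= `|C| * t by rewrite mulr_ge0 // ltW.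
lra.
Qed.

(** The partial derivatives are analytic again, so the result can be iterated; this is the source of
    derivatives of every order in the regularity argument. *)
Theorem real_analytic_gradient n (f : 'cV[R]_n -> R) : real_analytic f ->
  exists g : 'I_n -> 'cV[R]_n -> R,
    (forall l, real_analytic (g l)) /\
    forall p, exists2 r : R, 0 < r & exists C, forall x y,
      `|x - p| < r -> `|y - p| < r ->
      `|f y - f x - \sum_l g l x * (y l ord0 - x l ord0)| <= C * `|y - x| ^+ 2.
Proof.
move/real_analyticP => fa.
have loc p : exists rcgC : R * (('I_n -> nat) -> R) * ('I_n -> 'cV[R]_n -> R) * R,
    [/\ 0 < rcgC.1.1.1,
     forall l, expansion (rcgC.1.2 l) p rcgC.1.1.1 (dcoef l rcgC.1.1.2) &
     forall x y (D : R), (forall i, `|vsub x p i| < rcgC.1.1.1) ->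
      (forall i, `|vsub y p i| < rcgC.1.1.1) -> (forall i, `|vsub y x i| <= D) -> 0 <= D ->
      `|f y - f x - \sum_l rcgC.1.2 l x * vsub y x l| <= rcgC.2 * D ^+ 2].
  have [r r0 [c ex]] := fa p; have [g [hg [C hC]]] := expansion_deriv r0 ex.
  by exists (r / 8%:R, c, g, C); split => //=; rewrite divr_gt0.
have {loc}[H hH] := choice loc.
pose r p := (H p).1.1.1; pose c p := (H p).1.1.2; pose g p := (H p).1.2; pose C p := (H p).2.
pose G l x := g x l x.
(* The partial derivatives at x are read off the expansion centred at x; they agree
   with those of the expansion centred at p because first-order parts are unique. *)
have gG p x l : (forall i, `|vsub x p i| < r p) -> G l x = g p l x.
  move=> hx; apply/eqP; rewrite -subr_eq0; apply/eqP.
  have [rp0 _ hp] := hH p; have [rx0 _ hxx] := hH x.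
  (* A step of length below [s] along a coordinate axis from x stays in the polydisc around p and in
     the one around x. *)
  pose s := \big[Num.min/r x]_i (r p - `|vsub x p i|).
  have s0 : 0 < s.
    by apply: lt_bigmin => [|i _]; [exact: rx0 | rewrite subr_gt0; exact: hx].
  apply: (@linear_le_sqr_eq0 _ (C p + C x) s) => // t t0 ts.
  pose y : 'cV[R]_n := \col_i (x i ord0 + t * (i == l)%:R).
  have yx i : vsub y x i = t * (i == l)%:R by rewrite /vsub mxE addrAC subrr add0r.
  have yxt i : `|vsub y x i| <= t.
    by rewrite yx normrM normr_nat gtr0_norm // ler_piMr ?lern1 ?leq_b1 // ltW.
  have sx : s <= r x by exact: bigmin_le_id.
  have spi i : s <= r p - `|vsub x p i| by exact: (bigmin_le_cond _ (fun i => r p - `|vsub x p i|)).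
  have h1 : `|f y - f x - \sum_l g x l x * vsub y x l| <= C x * t ^+ 2.
    apply: hxx => //; last exact: ltW.
      by move=> i; rewrite /vsub subrr normr0.
    by move=> i; apply: le_lt_trans (yxt i) _; exact: lt_le_trans ts sx.
  have h2 : `|f y - f x - \sum_l g p l x * vsub y x l| <= C p * t ^+ 2.
    apply: hp => //; last exact: ltW.
    move=> i; have -> : vsub y p i = vsub y x i + vsub x p i by rewrite /vsub; ring.
    apply: le_lt_trans (ler_normD _ _) _; rewrite -ltrBrDr.
    by apply: le_lt_trans (yxt i) _; exact: lt_le_trans ts (spi i).
  have sumE (q : 'I_n -> R) : \sum_l q l * vsub y x l = q l * t.
    rewrite (bigD1 l) //= big1 ?addr0 => [|i /negbTE il]; first by rewrite yx eqxx mulr1.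
    by rewrite yx il !mulr0.
  rewrite !sumE in h1 h2.
  rewrite -[t in `|_| * t]gtr0_norm // -normrM /G.
  have -> : (g x l x - g p l x) * t =
    (f y - f x - g p l x * t) - (f y - f x - g x l x * t) by ring.
  by apply: le_trans (ler_normB _ _) _; rewrite [leRHS]mulrDl; exact: lerD.
exists G; split.
  move=> l; apply/real_analyticP => p; have [r0 hp _] := hH p.
  exists (r p) => //; exists (dcoef l (c p)); have [h1 h2] := hp l; split => // x hx.
  by rewrite (gG p) //; exact: h2.
move=> p; have [r0 _ hp] := hH p; exists (r p) => //; exists (C p) => x y hx hy.
have cx i : `|vsub x p i| < r p.
  by apply: le_lt_trans hx; rewrite /vsub; have := entry_le_norm (x - p) i ord0; rewrite !mxE.
have cy i : `|vsub y p i| < r p.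
  by apply: le_lt_trans hy; rewrite /vsub; have := entry_le_norm (y - p) i ord0; rewrite !mxE.
have := hp x y `|y - x| cx cy _ (normr_ge0 _); under eq_bigr => l _ do rewrite -/(g p l x) -(gG p x l cx).
apply => i; have := entry_le_norm (y - x) i ord0; by rewrite !mxE.
Qed.

End GlobalGradient.

(** * Integrals and square-integrable functions on the unit interval *)

Section UnitInterval.
Context {R : realType}.
Local Notation mu := (@lebesgue_measure R).
Local Notation I01 := (`[0%R, 1%R]%classic : set R).
Implicit Types (f g : R -> R) (D : set (measurableTypeR R)).

Definition intg f := mu.-integrable I01 (EFin \o f).

Lemma mI01 : measurable (I01 : set (measurableTypeR R)). Proof. exact: measurable_itv. Qed.

Lemma intg_meas f : intg f -> measurable_fun I01 f.
Proof. by move=> /integrableP[/measurable_EFinP]. Qed.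

Lemma intg_sub f D : measurable D -> D `<=` I01 -> intg f -> mu.-integrable D (EFin \o f).
Proof. by move=> mD DI; apply: integrableS => //; exact: mI01. Qed.

Lemma intg_dom f g : measurable_fun I01 f -> (forall x, I01 x -> `|f x| <= g x) ->
  intg g -> intg f.
Proof.
move=> mf fg; apply: (le_integrable mI01); first exact/measurable_EFinP.
by move=> x Ix /=; rewrite lee_fin; apply: le_trans (fg x Ix) _; exact: ler_norm.
Qed.

Lemma intg_ext f g : (forall x, I01 x -> f x = g x) -> intg f -> intg g.
Proof.
by move=> fg; apply: (eq_integrable mI01) => x /set_mem Ix /=; rewrite fg.
Qed.

Lemma intgD f g : intg f -> intg g -> intg (fun x => f x + g x).
Proof. move=> hf hg; exact: (integrableD mI01 hf hg). Qed.

Lemma intgZ (c : R) f : intg f -> intg (fun x => c * f x).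
Proof. move=> hf; exact: (integrableZl mI01 c hf). Qed.

Lemma intgN f : intg f -> intg (fun x => - f x).
Proof. by move=> /(intgZ (-1)); apply: intg_ext => x _; rewrite mulN1r. Qed.

Lemma intgB f g : intg f -> intg g -> intg (fun x => f x - g x).
Proof. by move=> hf /intgN; exact: intgD. Qed.

Lemma intg_abs f : intg f -> intg (fun x => `|f x|).
Proof. exact: integrable_abse. Qed.

Lemma lebesgue_I01 : mu (I01 : set R) = 1%:E.
Proof. by rewrite lebesgue_measure_itv /= lte_fin ltr01 oppr0 adde0. Qed.

Lemma intg_cst (c : R) : intg (fun=> c).
Proof.
apply: measurable_bounded_integrable; first exact: mI01.
- by change (mu (I01 : set R) < +oo)%E; rewrite lebesgue_I01 ltry.
- exact: measurable_cst.
- by exists `|c|; split=> [|M cM x _]; [exact: num_real | exact: ltW].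
Qed.

Lemma intg_sum (I : finType) (F : I -> R -> R) : (forall i, intg (F i)) ->
  intg (fun x => \sum_i F i x).
Proof.
move=> hF; apply: (intg_ext (f := fun x => \sum_(i <- index_enum I) F i x)) => //.
elim: (index_enum I) => [|i s IH].
  by apply: (intg_ext (f := fun=> 0)) (intg_cst 0) => x _; rewrite big_nil.
by apply: (intg_ext _ (intgD (hF i) IH)) => x _; rewrite big_cons.
Qed.

Lemma intg_cont f : {within I01, continuous f} -> intg f.
Proof. by move=> cf; apply: continuous_compact_integrable => //; exact: segment_compact. Qed.

Lemma Rint_sum (I : finType) (F : I -> R -> R) D : measurable D -> D `<=` I01 ->
  (forall i, intg (F i)) ->
  \int[mu]_(x in D) (\sum_i F i x) = \sum_i \int[mu]_(x in D) F i x.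
Proof.
move=> mD DI hF; elim: (index_enum I) => [|i s IH].
  under eq_Rintegral do rewrite big_nil.
  by rewrite big_nil Rintegral_cst // mul0r.
under eq_Rintegral do rewrite big_cons.
rewrite big_cons -IH RintegralD //; first exact: intg_sub.
apply: intg_sub => //; elim: (s) => [|j t IHt].
  by apply: (intg_ext (f := fun=> 0)) (intg_cst 0) => x _; rewrite big_nil.
by apply: (intg_ext _ (intgD (hF j) IHt)) => x _; rewrite big_cons.
Qed.

Lemma Rint_abs_le f g D : measurable D -> D `<=` I01 -> intg f -> intg g ->
  (forall x, I01 x -> `|f x| <= g x) -> `|\int[mu]_(x in D) f x| <= \int[mu]_(x in D) g x.
Proof.
move=> mD DI hf hg fg; apply: le_trans (le_normr_Rintegral mD (intg_sub mD DI hf)) _.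
apply: le_Rintegral => //; try exact: intg_sub => //.
- by apply: intg_sub => //; exact: intg_abs.
- by move=> x /DI; exact: fg.
Qed.

Lemma Rint_le_I01 f D : measurable D -> D `<=` I01 -> intg f ->
  (forall x, I01 x -> 0 <= f x) -> \int[mu]_(x in D) f x <= \int[mu]_(x in I01) f x.
Proof.
move=> mD DI hf f0; rewrite -[D in leLHS](setIidr DI) Rintegral_mkcondr.
have hr : intg (f \_ D).
  apply: (intg_dom (g := f)) => //.
    apply/(measurable_restrict f mD mI01).
    by apply: measurable_funS (intg_meas hf).
  by move=> x Ix; rewrite patchE; case: ifP => _; rewrite ?normr0 ?ger0_norm ?f0.
apply: le_Rintegral; [exact: mI01 | exact: hr | exact: hf |].
by move=> x Ix; rewrite patchE; case: ifP => _ //; exact: f0.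
Qed.

Lemma quad_disc (a b c : R) : 0 <= c -> (forall t, 0 <= a + 2 * b * t + c * t ^+ 2) ->
  b ^+ 2 <= a * c.
Proof.
move=> c0 h; have [c_eq0|cn0] := eqVneq c 0.
  have [->|bn0] := eqVneq b 0; first by rewrite c_eq0 mulr0 expr0n.
  (* With c = 0 the polynomial is affine in t, and this t gives it the value -1. *)
  have := h (- (a + 1) / (2 * b)); rewrite c_eq0 mul0r addr0 mulrC divfK; last first.
    by rewrite mulf_neq0 // pnatr_eq0.
  lra.
have cp : 0 < c by rewrite lt_neqAle eq_sym cn0.
have := h (- b / c); have -> : a + 2 * b * (- b / c) + c * (- b / c) ^+ 2 = (a * c - b ^+ 2) / c.
  by field.
by rewrite pmulr_lge0 ?invr_gt0 // subr_ge0.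
Qed.

Definition sqi f := measurable_fun I01 f /\ intg (fun x => f x ^+ 2).

Lemma sqi_mul f g : sqi f -> sqi g -> intg (fun x => f x * g x).
Proof.
move=> [mf hf] [mg hg]; apply: (intg_dom (g := fun x => f x ^+ 2 + g x ^+ 2)).
- exact: measurable_funM.
- move=> x _; rewrite normrM -[f x ^+ 2]real_normK ?num_real // -[g x ^+ 2]real_normK ?num_real //.
  have : 0 <= (`|f x| - `|g x|) ^+ 2 by exact: sqr_ge0.
  have : 0 <= `|f x| by []. have : 0 <= `|g x| by [].
  nra.
- exact: intgD.
Qed.

Lemma sqi_cst (c : R) : sqi (fun=> c).
Proof. by split; [exact: measurable_cst | exact: intg_cst]. Qed.

Lemma sqi_intg f : sqi f -> intg f.
Proof.
by move=> hf; apply: intg_ext (sqi_mul hf (sqi_cst 1)) => x _; rewrite mulr1.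
Qed.

Lemma sqiD f g : sqi f -> sqi g -> sqi (fun x => f x + g x).
Proof.
move=> hf hg; split; first by apply: measurable_funD; [exact: hf.1 | exact: hg.1].
apply: (intg_ext _ (intgD (intgD hf.2 hg.2) (intgZ 2 (sqi_mul hf hg)))) => x _ /=; ring.
Qed.

Lemma sqiZ (c : R) f : sqi f -> sqi (fun x => c * f x).
Proof.
move=> [mf hf]; split; first exact: measurable_funM.
by apply: (intg_ext _ (intgZ (c ^+ 2) hf)) => x _; rewrite exprMn.
Qed.

Lemma within_contM f g : {within I01, continuous f} -> {within I01, continuous g} ->
  {within I01, continuous (fun x => f x * g x)}.
Proof.
move=> /subspace_continuousP cf /subspace_continuousP cg.
by apply/subspace_continuousP => x Ix; apply: cvgM; [exact: cf | exact: cg].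
Qed.

Lemma within_contD f g : {within I01, continuous f} -> {within I01, continuous g} ->
  {within I01, continuous (fun x => f x + g x)}.
Proof.
move=> /subspace_continuousP cf /subspace_continuousP cg.
by apply/subspace_continuousP => x Ix; apply: cvgD; [exact: cf | exact: cg].
Qed.

Lemma within_cont_cst (c : R) : {within I01, continuous (fun=> c : R)}.
Proof. by apply/subspace_continuousP => x Ix; exact: cvg_cst. Qed.

Lemma sqi_cont f : {within I01, continuous f} -> sqi f.
Proof.
move=> cf; have mf := intg_meas (intg_cont cf); split=> //.
apply: (intg_ext (f := fun x => f x * f x)); first by move=> x _; rewrite expr2.
by apply: intg_cont; exact: within_contM.
Qed.

Lemma sqi_CS f g D : measurable D -> D `<=` I01 -> sqi f -> sqi g ->
  (\int[mu]_(x in D) (f x * g x)) ^+ 2 <=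
  \int[mu]_(x in D) (f x ^+ 2) * \int[mu]_(x in D) (g x ^+ 2).
Proof.
move=> mD DI hf hg; apply: quad_disc => [|t].
  by apply: Rintegral_ge0 => x _; exact: sqr_ge0.
have i1 := intg_sub mD DI hf.2; have i2 := intg_sub mD DI hg.2.
have i3 := intg_sub mD DI (sqi_mul hf hg).
have i4 := intg_sub mD DI (intgZ (2 * t) (sqi_mul hf hg)).
have i5 := intg_sub mD DI (intgZ (t ^+ 2) hg.2).
have i6 := intg_sub mD DI (intgD hf.2 (intgZ (2 * t) (sqi_mul hf hg))).
have -> : \int[mu]_(x in D) (f x ^+ 2) + 2 * \int[mu]_(x in D) (f x * g x) * t +
    \int[mu]_(x in D) (g x ^+ 2) * t ^+ 2 =
   \int[mu]_(x in D) (f x ^+ 2 + 2 * t * (f x * g x) + t ^+ 2 * (g x ^+ 2)).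
  have e1 := RintegralD mD i6 i5; have e2 := RintegralD mD i1 i4; rewrite /= in e1 e2.
  by rewrite e1 e2 !RintegralZl //; ring.
apply: Rintegral_ge0 => x _.
have -> : f x ^+ 2 + 2 * t * (f x * g x) + t ^+ 2 * g x ^+ 2 = (f x + t * g x) ^+ 2 by ring.
exact: sqr_ge0.
Qed.

End UnitInterval.

(** * Integral equations on the unit interval *)

Section Weights.
Context {R : realType}.
Local Notation mu := (@lebesgue_measure R).
Local Notation I01 := (`[0%R, 1%R]%classic : set R).

(* [b = false] integrates forward from [0], [b = true] backward from [1]. *)
Definition dir (b : bool) (s : R) : set (measurableTypeR R) :=
  if b then `[s, 1]%classic else `[0, s]%classic.

(** The weight equals 1 where the integration starts and grows along its direction. Dividing by it
    turns the sup norm into one for which a Volterra operator contracts on the whole interval. *)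
Definition wt (b : bool) (K s : R) : R := expR (K * (if b then 1 - s else s)).

Lemma mdir b s : measurable (dir b s).
Proof. by case: b; exact: measurable_itv. Qed.

Lemma dir_sub b s : I01 s -> dir b s `<=` I01.
Proof.
rewrite /= in_itv /= => /andP[s0 s1]; case: b => x /=; rewrite !in_itv /= => /andP[h1 h2].
  by rewrite h2 andbT (le_trans s0).
by rewrite h1 (le_trans h2).
Qed.

Lemma wt_ge1 b (K s : R) : 0 <= K -> I01 s -> 1 <= wt b K s.
Proof.
rewrite /= in_itv /= => K0 /andP[s0 s1]; rewrite /wt -[leLHS]expR0 ler_expR mulr_ge0 //.
by case: b; lra.
Qed.

Lemma wt_le b (K s : R) : 0 <= K -> I01 s -> wt b K s <= expR K.
Proof.
rewrite /= in_itv /= => K0 /andP[s0 s1]; rewrite /wt ler_expR ler_piMr //.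
by case: b; lra.
Qed.

Lemma wt_derive b (K s : R) : is_derive s 1 (wt b K : R -> R) ((if b then - K else K) * wt b K s).
Proof.
rewrite /wt; case: b.
- by apply: is_derive_eq; rewrite /GRing.scale /=; ring.
- by apply: is_derive_eq; rewrite /GRing.scale /=; ring.
Qed.

Lemma wt_continuous b K : continuous (wt b K : R -> R).
Proof.
move=> s; apply: differentiable_continuous; apply/derivable1_diffP.
by have [] := wt_derive b K s.
Qed.

Lemma wt_within b K : {within I01, continuous (wt b K : R -> R)}.
Proof. by apply: continuous_subspaceT; exact: wt_continuous. Qed.

Lemma Rint_wt b (K s : R) : 0 < K -> I01 s -> \int[mu]_(x in dir b s) wt b K x <= wt b K s / K.
Proof.
move=> K0 Is; have K0' := ltW K0.
have r0 : 0 <= wt b K s / K by rewrite divr_ge0 // expR_ge0.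
(* The sign makes [e * wt b K x / K] an antiderivative of the weight in both directions. *)
pose e : R := if b then -1 else 1.
have ftc (u v : R) : u < v -> \int[mu]_(x in `[u, v]) wt b K x = e * (wt b K v - wt b K u) / K.
  move=> uv; rewrite /Rintegral (@continuous_FTC2 _ _ (fun x => e * wt b K x / K)) //.
  - by rewrite /=; ring.
  - by apply: continuous_subspaceT; exact: wt_continuous.
  - have cc : continuous (fun x => e * wt b K x / K : R).
      by move=> x; apply: cvgMr_tmp; apply: cvgMl_tmp; exact: wt_continuous.
    split.
    + move=> x _; apply: derivableM => //; apply: derivableM => //.
      by have [] := wt_derive b K x.
    + by apply: cvg_at_right_filter; exact: cc.
    + by apply: cvg_at_left_filter; exact: cc.
  - move=> x _; rewrite derive1E.
    have h := wt_derive b K x.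
    have h2 : is_derive x 1 (fun x => e * wt b K x / K) (wt b K x).
      apply: is_derive_eq; rewrite /GRing.scale /= /e; case: (b); field; exact: lt0r_neq0.
    by have [_ ->] := h2.
move: Is; rewrite /= in_itv /= => /andP[s0 s1].
rewrite /dir; case: b @e r0 ftc => /= r0 ftc.
- have [->|sn1] := eqVneq s 1; first by rewrite set_itv1 Rintegral_set1 divr_ge0 // expR_ge0.
  rewrite ftc; last by rewrite lt_neqAle sn1.
  rewrite ler_wpM2r ?invr_ge0 // mulN1r opprB gerDl oppr_le0 expR_ge0 //.
- have [->|sn1] := eqVneq s 0; first by rewrite set_itv1 Rintegral_set1 divr_ge0 // expR_ge0.
  rewrite ftc; last by rewrite lt_neqAle eq_sym sn1.
  rewrite ler_wpM2r ?invr_ge0 // mul1r gerDl oppr_le0 expR_ge0 //.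
Qed.

(* The Volterra operator with kernel [nu] halves the sup norm weighted by [wt]. *)
Lemma Rint_mul_wt b (nu : R -> R) (A : R) s :
  sqi nu -> 0 <= A -> \int[mu]_(x in I01) (nu x ^+ 2) <= A -> I01 s ->
  \int[mu]_(x in dir b s) (nu x * wt b (2 * A + 1) x) <= wt b (2 * A + 1) s / 2.
Proof.
move=> hnu A0 hA Is; set K := 2 * A + 1.
have K0 : 0 < K by rewrite /K; lra.
have w0 : 0 < wt b K s by exact: expR_gt0.
(* Cauchy-Schwarz bounds the squared integral by A w^2 / (2 K), which is at most (w / 2)^2 because K
   >= 2 A. The added 1 keeps K positive when A = 0. *)
have cs := sqi_CS (mdir b s) (dir_sub (b := b) Is) hnu (sqi_cont (@wt_within b K)).
have wsq x : wt b K x ^+ 2 = wt b (2 * K) x by rewrite /wt -expRM_natl; congr expR; ring.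
have h2 : \int[mu]_(x in dir b s) (wt b K x ^+ 2) <= wt b K s ^+ 2 / (2 * K).
  under eq_Rintegral do rewrite wsq.
  by rewrite wsq; apply: Rint_wt; rewrite ?mulr_gt0.
have h1 : \int[mu]_(x in dir b s) (nu x ^+ 2) <= A.
  apply: le_trans hA; apply: Rint_le_I01 => //; first exact: mdir.
  - exact: dir_sub.
  - exact: hnu.2.
  - by move=> x _; exact: sqr_ge0.
set I := \int[mu]_(x in dir b s) _ in cs *.
have [I0|I0] := leP I 0; first by apply: le_trans I0 _; rewrite divr_ge0 // ltW.
have I0' := ltW I0; have w2 : 0 <= wt b K s / 2 by rewrite divr_ge0 // ltW.
rewrite -(@ler_sqr R) ?nnegrE //.
apply: le_trans cs _; apply: le_trans (ler_pM _ _ h1 h2) _.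
- by apply: Rintegral_ge0 => x _; exact: sqr_ge0.
- by apply: Rintegral_ge0 => x _; exact: sqr_ge0.
rewrite exprMn mulrCA ler_wpM2l ?sqr_ge0 // ler_pdivrMr ?mulr_gt0 // /K.
rewrite expr2; lra.
Qed.

(* The supremum S of D / w satisfies S <= B + S / 2. *)
Lemma gronwall b (K B M : R) (D : R -> R) : 0 <= K -> 0 <= B ->
  (forall s, I01 s -> 0 <= D s <= M) ->
  (forall S, 0 <= S -> (forall s, I01 s -> D s <= S * wt b K s) ->
     forall s, I01 s -> D s <= B + S * (wt b K s / 2)) ->
  forall s, I01 s -> D s <= 2 * B * expR K.
Proof.
move=> K0 B0 hD step.
have I0 : I01 0 by rewrite /= in_itv /= lexx ler01.
have wp s : 0 < wt b K s by exact: expR_gt0.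
pose A := [set D s / wt b K s | s in I01].
have supA : has_sup A.
  split; first by exists (D 0 / wt b K 0); exists 0.
  exists M => _ [s Is <-]; have /andP[d0 dM] := hD s Is.
  rewrite ler_pdivrMr //; apply: le_trans dM _; rewrite ler_peMr ?wt_ge1 //.
  by have /andP[h1 h2] := hD s Is; exact: le_trans h2.
set S := sup A.
have DS s : I01 s -> D s <= S * wt b K s.
  by move=> Is; rewrite -ler_pdivrMr //; apply: (ub_le_sup supA.2); exists s.
have S0 : 0 <= S.
  apply: (@le_trans _ _ (D 0 / wt b K 0)); last by apply: (ub_le_sup supA.2); exists 0.
  by apply: divr_ge0; [have /andP[] := hD 0 I0 | exact: ltW].
have S2 : S <= B + S / 2.
  apply: (ge_sup supA.1) => _ [s Is <-]; rewrite ler_pdivrMr //.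
  apply: le_trans (step S S0 DS s Is) _; rewrite mulrDl mulrA mulrAC lerD2r.
  by rewrite ler_peMr // wt_ge1.
move=> s Is; apply: le_trans (DS s Is) _; apply: ler_pM => //; first exact: ltW.
- by lra.
- exact: wt_le.
Qed.

End Weights.

(** * Picard iteration with a square-integrable Lipschitz rate *)

Section Picard.
Context {R : realType}.
Local Notation mu := (@lebesgue_measure R).
Local Notation I01 := (`[0%R, 1%R]%classic : set R).

Lemma within_contP (f : R -> R) : {within I01, continuous f} <->
  forall x, I01 x -> f t @[t --> within I01 (nbhs x)] --> f x.
Proof. exact: subspace_continuousP. Qed.

Lemma Rint_dir_split (f : R -> R) s : intg f -> I01 s ->
  \int[mu]_(x in dir true s) f x =
  \int[mu]_(x in I01) f x - \int[mu]_(x in dir false s) f x.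
Proof.
move=> hf /[dup] Is; rewrite /= in_itv /= => /andP[s0 s1]; rewrite /dir.
rewrite (Rintegral_itvB hf) ?bnd_simp // Rintegral_itv_obnd_cbnd //.
apply: integrableS hf => //; apply: subset_itvr; by rewrite bnd_simp.
Qed.

Lemma Rint_dir_cont b (f : R -> R) : intg f ->
  {within I01, continuous (fun s => \int[mu]_(x in dir b s) f x)}.
Proof.
move=> hf; have c0 : {within I01, continuous (fun s => \int[mu]_(x in dir false s) f x)}.
  exact: parameterized_integral_continuous ler01 hf.
case: b => //; move/within_contP : c0 => c0.
apply/within_contP => x Ix.
have -> : \int[mu]_(y in dir true x) f y =
  \int[mu]_(y in I01) f y - \int[mu]_(y in dir false x) f y by exact: Rint_dir_split.
apply: cvg_trans (cvgB (cvg_cst (\int[mu]_(x in I01) f x)) (c0 x Ix)).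
apply: near_eq_cvg; near=> t.
have It : I01 t by near: t; exact: withinT.
by rewrite Rint_dir_split.
Unshelve. all: by end_near. Qed.

Definition cont01 n (z : R -> 'cV[R]_n) : Prop :=
  forall i, {within I01, continuous (fun s => z s i ord0)}.

Lemma within_bounded (f : R -> R) : {within I01, continuous f} ->
  exists2 C, 0 <= C & forall s, I01 s -> `|f s| <= C.
Proof.
move=> cf.
have cpt : compact (f @` I01).
  by apply: continuous_compact => //; exact: segment_compact.
have [M [_ hM]] := compact_bounded cpt.
exists (`|M| + 1) => [|s Is]; first by rewrite addr_ge0.
apply: (hM (`|M| + 1)); last by exists s.
by apply: le_lt_trans (ler_norm M) _; rewrite ltrDl.
Qed.

Lemma cont01_bounded n (z : R -> 'cV[R]_n) : cont01 z ->
  exists2 C, 0 <= C & forall s, I01 s -> `|z s| <= C.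
Proof.
move=> cz; have h i : exists C, 0 <= C /\ forall s, I01 s -> `|z s i ord0| <= C.
  by have [C C0 hC] := within_bounded (cz i); exists C.
have [C hC] := choice h; exists (\sum_i C i).
  by apply: sumr_ge0 => i _; exact: (hC i).1.
move=> s Is; apply: norm_le_entries => [|i j].
  by apply: sumr_ge0 => i _; exact: (hC i).1.
rewrite ord1; apply: le_trans ((hC i).2 s Is) _.
rewrite (bigD1 i) //= lerDl; apply: sumr_ge0 => k _; exact: (hC k).1.
Qed.

Lemma geometric_small (C e : R) : 0 < e -> exists j, C * 2^-1 ^+ j <= e.
Proof.
move=> e0; have h2 : `|2^-1 : R| < 1 by rewrite ger0_norm // invf_lt1 // ltr1n.
have /cvgr_le/(_ e e0) h := cvg_geometric C h2.
by have [j hj] := filter_ex h; exists j.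
Qed.

Lemma norm_le_geometric_eq0 (a C : R) : (forall j, `|a| <= C * 2^-1 ^+ j) -> a = 0.
Proof.
move=> h; apply/eqP; rewrite -normr_le0; apply/ler_addgt0Pr => e e0; rewrite add0r.
by have [j hj] := geometric_small C e0; exact: le_trans (h j) hj.
Qed.

Section Iteration.
Context (b : bool) (n : nat) (Phi : R -> 'cV[R]_n -> 'cV[R]_n) (z0 : 'cV[R]_n) (nu : R -> R).
Context (hnu : sqi nu)
  (lipPhi : forall t z z' i, I01 t ->
    `|Phi t z i ord0 - Phi t z' i ord0| <= nu t * `|z - z'|)
  (bndPhi : forall t i, I01 t -> `|Phi t 0 i ord0| <= nu t)
  (measPhi : forall z, cont01 z -> forall i,
    measurable_fun I01 (fun t => Phi t (z t) i ord0)).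

Let A := \int[mu]_(x in I01) (nu x ^+ 2).
Let K := 2 * A + 1.
Let w := wt b K.

Let A0 : 0 <= A. Proof. by apply: Rintegral_ge0 => x _; exact: sqr_ge0. Qed.
Let K0 : 0 <= K. Proof. by have := A0; rewrite /K; lra. Qed.

Let step (z : R -> 'cV[R]_n) : R -> 'cV[R]_n := fun s =>
  \col_i (z0 i ord0 + \int[mu]_(t in dir b s) Phi t (z t) i ord0).

Lemma intg_Phi z i : cont01 z -> intg (fun t => Phi t (z t) i ord0).
Proof.
move=> cz; have [C C0 hC] := cont01_bounded cz.
apply: (intg_dom (g := fun t => (C + 1) * nu t)); first exact: measPhi.
  move=> t It; rewrite -[Phi t (z t) i ord0](subrK (Phi t 0 i ord0)).
  apply: le_trans (ler_normD _ _) _; rewrite mulrDl mul1r; apply: lerD; last exact: bndPhi.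
  apply: le_trans (lipPhi _ _ _ It) _; rewrite subr0 mulrC ler_wpM2r ?hC //.
  (* The nonnegativity of [nu t] is read off [bndPhi]. *)
  exact: le_trans (bndPhi i It).
by apply: intgZ; exact: sqi_intg.
Qed.

Lemma cont01_step z : cont01 z -> cont01 (step z).
Proof.
move=> cz i; have := within_contD (@within_cont_cst _ (z0 i ord0)) (@Rint_dir_cont b _ (intg_Phi i cz)).
suff -> : (fun s => step z s i ord0) =
  (fun s => z0 i ord0 + \int[mu]_(t in dir b s) Phi t (z t) i ord0) by [].
by apply/funext => s; rewrite mxE.
Qed.

Lemma step_contract z z' (S : R) : 0 <= S -> cont01 z -> cont01 z' ->
  (forall s, I01 s -> `|z s - z' s| <= S * w s) ->
  forall s, I01 s -> `|step z s - step z' s| <= S * (w s / 2).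
Proof.
move=> S0 cz cz' h s Is; apply: norm_le_entries => [|i j].
  by rewrite mulr_ge0 // divr_ge0 // expR_ge0.
rewrite ord1 !mxE opprD addrACA subrr add0r.
have i1 := intg_Phi i cz; have i2 := intg_Phi i cz'.
have isub f (hf : intg f) := intg_sub (mdir b s) (dir_sub (b := b) Is) hf.
have e1 := RintegralB (mdir b s) (isub _ i1) (isub _ i2); rewrite /= in e1.
rewrite -e1.
have i3 : intg (fun t => nu t * w t) by apply: sqi_mul => //; apply: sqi_cont; exact: wt_within.
apply: le_trans (Rint_abs_le (g := fun t => S * (nu t * w t)) _ _ _ _ _) _ => //.
- exact: mdir.
- exact: dir_sub.
- exact: intgB.
- exact: intgZ.
- move=> t It; apply: le_trans (lipPhi _ _ _ It) _; rewrite mulrCA ler_wpM2l ?h //.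
  exact: le_trans (bndPhi i It).
rewrite RintegralZl //; [|exact: mdir|exact: isub].
by rewrite ler_wpM2l // /w /K; apply: Rint_mul_wt.
Qed.

(** In the weighted norm each step halves the distance between consecutive iterates, so they
    converge geometrically at every time; the factor [W = expR K] converts back to the plain sup
    norm. The direction [b] lets one statement cover the state equation and the adjoint equation. *)
Theorem picard : exists z, cont01 z /\ forall i, intg (fun t => Phi t (z t) i ord0) /\
  forall s, I01 s -> z s i ord0 = z0 i ord0 + \int[mu]_(t in dir b s) Phi t (z t) i ord0.
Proof.
pose zz j := iter j step (fun=> z0).
have czz j : cont01 (zz j).
  elim: j => [|j IH]; last exact: cont01_step.
  by move=> i; exact: within_cont_cst.
have w1 s : I01 s -> 1 <= w s by exact: wt_ge1.
have [M0 M00 hM0] := cont01_bounded (czz 1%N).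
pose M := M0 + `|z0|.
have M_ge0 : 0 <= M by rewrite addr_ge0.
have d0 s : I01 s -> `|zz 1%N s - zz 0%N s| <= M * w s.
  move=> Is; apply: (@le_trans _ _ M); last by rewrite ler_peMr ?w1.
  by apply: le_trans (ler_normB _ _) _; rewrite lerD2r hM0.
have dj j s : I01 s -> `|zz j.+1 s - zz j s| <= M * 2^-1 ^+ j * w s.
  elim: j s => [|j IH] s Is; first by rewrite expr0 mulr1 d0.
  apply: le_trans (step_contract _ (czz j.+1) (czz j) IH Is) _.
    by rewrite mulr_ge0 // exprn_ge0.
  by rewrite exprS; apply: le_of_eq; ring.
pose W := expR K.
have dW j s i : I01 s -> `|zz j.+1 s i ord0 - zz j s i ord0| <= M * W * 2^-1 ^+ j.
  move=> Is; have := entry_le_norm (zz j.+1 s - zz j s) i ord0; rewrite !mxE.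
  move/le_trans; apply; apply: le_trans (dj j s Is) _.
  by rewrite mulrAC ler_wpM2r ?exprn_ge0 // ler_wpM2l // wt_le.
(* The factor 2 - 2 * 2^-m is the exact partial sum of the geometric series over m terms, which
   makes the induction on m close. *)
have tail j m s i : I01 s ->
    `|zz (j + m)%N s i ord0 - zz j s i ord0| <= M * W * 2^-1 ^+ j * (2 - 2 * 2^-1 ^+ m).
  move=> Is; elim: m => [|m IH].
    by rewrite addn0 subrr normr0 expr0 mulr1 subrr mulr0.
  rewrite addnS -[_ - zz j s i ord0](subrKA (zz (j + m)%N s i ord0)).
  apply: le_trans (ler_normD _ _) _; apply: le_trans (lerD (dW _ _ _ Is) IH) _.
  by rewrite exprD exprS; apply: le_of_eq; field.
pose z s : 'cV[R]_n := \col_i limn (fun j => zz j s i ord0).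
have h2 : `|2^-1 : R| < 1 by rewrite ger0_norm // invf_lt1 // ltr1n.
have cz s i : I01 s -> (fun j => zz j s i ord0) @ \oo --> z s i ord0.
  move=> Is; rewrite mxE.
  suff : cvgn (fun j => zz j s i ord0) by [].
  rewrite (_ : (fun j => _) = (fun j => zz 0%N s i ord0 +
      series (telescope (fun j => zz j s i ord0)) j)); last first.
    by apply/funext => j; exact: eq_sum_telescope.
  apply: is_cvgD; first exact: is_cvg_cst.
  apply: normed_cvg; apply: (series_le_cvg _ _ _ (@is_cvg_geometric_series _ (M * W) _ h2)) => j.
  - exact: normr_ge0.
  - by apply: mulr_ge0; rewrite ?exprn_ge0 // mulr_ge0 // expR_ge0.
  - exact: dW.
have zlim j s i : I01 s -> `|z s i ord0 - zz j s i ord0| <= 2 * M * W * 2^-1 ^+ j.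
  move=> Is; apply: (cvgr_to_le (cvg_norm (cvgB (cz s i Is) (cvg_cst (zz j s i ord0))))).
  near=> m; have jm : (j <= m)%N by near: m; exact: nbhs_infty_ge.
  have := tail j (m - j)%N s i Is; rewrite subnKC //.
  move/le_trans; apply; rewrite -subr_ge0.
  rewrite (_ : _ - _ = 2 * (M * W * 2^-1 ^+ j * 2^-1 ^+ (m - j))); last by ring.
  by rewrite !mulr_ge0 ?exprn_ge0 // expR_ge0.
have cont_z : cont01 z.
  move=> i; apply/within_contP => x Ix; apply/cvgrPdist_le => e e0.
  have e3 : 0 < e / 3 by rewrite divr_gt0.
  have [j hj] := geometric_small (2 * M * W) e3.
  have /within_contP/(_ x Ix)/cvgrPdist_le/(_ _ e3) hc := czz j i.
  near=> t; have It : I01 t by near: t; exact: withinT.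
  have h1 := le_trans (zlim j x i Ix) hj; have h3 := le_trans (zlim j t i It) hj.
  have h4 : `|zz j x i ord0 - zz j t i ord0| <= e / 3 by near: t.
  have -> : z x i ord0 - z t i ord0 = (z x i ord0 - zz j x i ord0) +
    (zz j x i ord0 - zz j t i ord0) - (z t i ord0 - zz j t i ord0) by ring.
  apply: le_trans (ler_normB _ _) _; apply: le_trans (lerD (ler_normD _ _) (lexx _)) _.
  lra.
exists z; split => // i; split; first exact: intg_Phi.
move=> s Is; apply/eqP; rewrite -subr_eq0; apply/eqP.
(* The defect z - step z is (z - zz_(j+1)) - (step z - step zz_j), and both differences are O(2^-j):
   the first by convergence, the second by contraction. *)
apply: (@norm_le_geometric_eq0 _ (2 * M * W + 2 * M * W * W)) => j.
have S0 : 0 <= 2 * M * W * 2^-1 ^+ j by rewrite !mulr_ge0 ?exprn_ge0 // expR_ge0.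
have h1 := zlim j.+1 s i Is.
have h3 : `|step z s i ord0 - zz j.+1 s i ord0| <= 2 * M * W * 2^-1 ^+ j * (w s / 2).
  have := entry_le_norm (step z s - zz j.+1 s) i ord0; rewrite 2!mxE [(- zz j.+1 s) i ord0]mxE.
  move/le_trans; apply; apply: step_contract => // t It.
  apply: norm_le_entries => [|k l].
    by rewrite mulr_ge0 // expR_ge0.
  rewrite ord1 !mxE; apply: (@le_trans _ _ (2 * M * W * 2^-1 ^+ j)).
    by have := zlim j t k It; rewrite mxE.
  by rewrite ler_peMr // w1.
have -> : z s i ord0 - (z0 i ord0 + \int[mu]_(t in dir b s) Phi t (z t) i ord0) =
  (z s i ord0 - zz j.+1 s i ord0) - (step z s i ord0 - zz j.+1 s i ord0).
  by rewrite [step z s i ord0]mxE; ring.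
apply: le_trans (ler_normB _ _) _; rewrite mulrDl; apply: lerD.
  apply: le_trans h1 _; rewrite ler_wpM2l //; first by rewrite !mulr_ge0 // expR_ge0.
  by rewrite exprS ler_piMl ?exprn_ge0 // invf_le1 // ler1n.
apply: le_trans h3 _; rewrite [leRHS]mulrAC; apply: ler_wpM2l => //.
have := wt_le b K0 Is; have := w1 s Is; rewrite /w /W; lra.
Unshelve. all: by end_near. Qed.

End Iteration.
End Picard.

(** * Integration by parts for absolutely continuous functions *)

Section TriangleFubini.
Context {R : realType}.
Local Notation mu := (@lebesgue_measure R).
Local Notation I01 := (`[0%R, 1%R]%classic : set R).
Implicit Types f g : R -> R.

Lemma EFin_Rint (D : set (measurableTypeR R)) f : mu.-integrable D (EFin \o f) ->
  measurable D -> (\int[mu]_(x in D) (f x)%:E)%E = (\int[mu]_(x in D) f x)%:E.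
Proof. by move=> hf mD; rewrite /Rintegral fineK //; exact: integrable_fin_num. Qed.

Lemma dir_false1 : dir false (1 : R) = I01. Proof. by []. Qed.

Let tri f g (z : measurableTypeR R * measurableTypeR R) : R :=
  if z.1 <= z.2 then (f \_ I01) z.1 * (g \_ I01) z.2 else 0.

Let mr f : intg f -> measurable_fun (setT : set (measurableTypeR R)) (f \_ I01).
Proof.
move=> hf; apply/(measurable_restrict f mI01 measurableT).
by rewrite setTI; exact: intg_meas.
Qed.

Let m_tri f g : intg f -> intg g -> measurable_fun setT (tri f g).
Proof.
move=> hf hg; apply: measurable_fun_ifT.
- by apply: measurable_fun_ler; [exact: measurable_fst | exact: measurable_snd].
- apply: measurable_funM.
  + by apply: measurableT_comp; [exact: mr | exact: measurable_fst].
  + by apply: measurableT_comp; [exact: mr | exact: measurable_snd].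
- exact: measurable_cst.
Qed.

Let abs_fin f : intg f -> exists C : R, (\int[mu]_x (`|(f \_ I01) x|%:E) = C%:E)%E.
Proof.
move=> hf; exists (\int[mu]_(x in I01) `|f x|).
rewrite -EFin_Rint; [|exact: (intg_abs hf)|exact: mI01].
rewrite [in RHS]integral_mkcond; apply: eq_integral => x _.
by rewrite !patchE; case: ifP => //; rewrite normr0.
Qed.

Let int_tri f g : intg f -> intg g -> (mu \x mu)%E.-integrable setT (EFin \o tri f g).
Proof.
move=> hf hg; apply/(integrable12ltyP mu mu).
  by apply/measurable_EFinP; exact: m_tri.
have [Cf hCf] := abs_fin hf; have [Cg hCg] := abs_fin hg.
apply: (@le_lt_trans _ _ (\int[mu]_x (`|(f \_ I01) x|%:E * Cg%:E))%E); last first.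
  rewrite ge0_integralZr //.
  - by rewrite hCf -EFinM ltry.
  - by apply/measurable_EFinP/measurableT_comp => //; exact: mr.
  - by rewrite -hCg; apply: integral_ge0.
have mgE : measurable_fun setT (fun y : measurableTypeR R => (`|(g \_ I01) y|)%:E).
  by apply/measurable_EFinP/measurableT_comp => //; exact: mr.
apply: ge0_le_integral => //.
- by move=> x _; exact: integral_ge0.
- apply: (measurable_fun_fubini_tonelli_F (m2 := mu) (abse \o (EFin \o tri f g))).
    by apply: measurableT_comp => //; apply/measurable_EFinP; exact: m_tri.
  by move=> ?; exact: abse_ge0.
- apply: emeasurable_funM; last exact: measurable_cst.
  by apply/measurable_EFinP/measurableT_comp => //; exact: mr.
move=> x _; rewrite -hCg -ge0_integralZl //.
apply: ge0_le_integral => //.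
- apply: measurableT_comp => //; apply/measurable_EFinP.
  exact: (measurableT_comp (m_tri hf hg) (measurable_pair1 x)).
- by apply: emeasurable_funM => //; exact: measurable_cst.
move=> y _; rewrite /= -EFinM lee_fin /tri /=.
by case: ifP => _; rewrite ?normrM // normr0 mulr_ge0.
Qed.

(** Both sides are the integral of f(x) g(y) over the triangle 0 <= x <= y <= 1, encoded on the
    whole plane by [tri]. *)
Theorem fubini_triangle f g : intg f -> intg g ->
  \int[mu]_(x in I01) (f x * \int[mu]_(y in dir true x) g y) =
  \int[mu]_(y in I01) (\int[mu]_(x in dir false y) f x * g y).
Proof.
move=> hf hg; have := Fubini (int_tri hf hg).
have -> : (\int[mu]_x \int[mu]_y (EFin \o tri f g) (x, y) =
  \int[mu]_(x in I01) (f x * \int[mu]_(y in dir true x) g y)%:E)%E.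
  rewrite [RHS]integral_mkcond; apply: eq_integral => x _; rewrite patchE.
  case: ifPn => [/set_mem Ix|xI]; last first.
    rewrite (_ : (fun y => _) = cst 0%E) ?integral0 //; apply/funext => y /=.
    by rewrite /tri /= patchE (negbTE xI) mul0r if_same.
  rewrite -RintegralZl; [|exact: mdir|exact: (intg_sub (mdir _ _) (dir_sub (b := true) Ix) hg)].
  rewrite -EFin_Rint; [|exact: (intg_sub (mdir _ _) (dir_sub (b := true) Ix) (intgZ (f x) hg))|exact: mdir].
  rewrite [RHS]integral_mkcond; apply: eq_integral => y _ /=; rewrite /tri /= !patchE.
  rewrite (mem_set Ix).
  case: ifPn => [xy|xy].
    have -> : (y \in dir true x) = (y \in I01).
      apply/idP/idP => /set_mem; rewrite /= !in_itv /=.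
        by move=> h; apply/mem_set; exact: (dir_sub (b := true) Ix).
      move=> /andP[y0 y1]; apply/mem_set; by rewrite /= in_itv /= xy.
    by case: ifP => // _; rewrite mulr0.
  by rewrite ifF //; apply/negbTE/negP => /set_mem; rewrite /= in_itv /= (negbTE xy).
have -> : (\int[mu]_y \int[mu]_x (EFin \o tri f g) (x, y) =
  \int[mu]_(y in I01) (\int[mu]_(x in dir false y) f x * g y)%:E)%E.
  rewrite [RHS]integral_mkcond; apply: eq_integral => y _; rewrite patchE.
  case: ifPn => [/set_mem Iy|yI]; last first.
    rewrite (_ : (fun x => _) = cst 0%E) ?integral0 //; apply/funext => x /=.
    by rewrite /tri /= [X in _ * X]patchE (negbTE yI) mulr0 if_same.
  rewrite mulrC -RintegralZl; [|exact: mdir|exact: (intg_sub (mdir _ _) (dir_sub (b := false) Iy) hf)].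
  rewrite -EFin_Rint; [|exact: (intg_sub (mdir _ _) (dir_sub (b := false) Iy) (intgZ (g y) hf))|exact: mdir].
  rewrite [RHS]integral_mkcond; apply: eq_integral => x _ /=; rewrite /tri /= !patchE.
  rewrite (mem_set Iy) mulrC.
  case: ifPn => [xy|xy].
    have -> : (x \in dir false y) = (x \in I01).
      apply/idP/idP => /set_mem; rewrite /= !in_itv /=.
        by move=> h; apply/mem_set; exact: (dir_sub (b := false) Iy).
      move=> /andP[x0 x1]; apply/mem_set; by rewrite /= in_itv /= x0.
    by case: ifP => // _; rewrite mulr0.
  by rewrite ifF //; apply/negbTE/negP => /set_mem; rewrite /= in_itv /= (negbTE xy) andbF.
by move=> /(congr1 fine).
Qed.

(** Here p vanishes at 0, q equals [q1] at 1, and their derivatives are f and -g in the integrated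
    sense only. This is the shape of a trajectory increment, which starts at 0, against an adjoint,
    which is prescribed at time 1. *)
Lemma integration_by_parts_dir f g (p q : R -> R) (q1 : R) : intg f -> intg g ->
  (forall s, I01 s -> p s = \int[mu]_(x in dir false s) f x) ->
  (forall s, I01 s -> q s = q1 + \int[mu]_(x in dir true s) g x) ->
  [/\ intg (fun s => f s * q s), intg (fun s => p s * g s) &
  q1 * p 1 = \int[mu]_(x in I01) (f x * q x - p x * g x)].
Proof.
move=> hf hg hp hq.
have bdd b h : intg h -> exists2 C : R, 0 <= C &
    forall s, I01 s -> `|\int[mu]_(x in dir b s) h x| <= C.
  by move=> hh; apply: within_bounded; exact: Rint_dir_cont.
have prod b h k : intg h -> intg k ->
    intg (fun s => h s * \int[mu]_(x in dir b s) k x).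
  move=> hh hk; have [C C0 hC] := bdd b k hk.
  apply: (intg_dom (g := fun s => C * `|h s|)).
  - apply: measurable_funM; first exact: intg_meas.
    by apply: intg_meas; apply: intg_cont; exact: Rint_dir_cont.
  - by move=> s Is; rewrite normrM mulrC ler_wpM2r ?hC.
  - by apply: intgZ; exact: intg_abs.
have i1 := prod true f g hf hg; have i2 := prod false g f hg hf.
have i3 : intg (fun s => q1 * f s) by exact: intgZ.
have e1 s : I01 s -> f s * q s = q1 * f s + f s * \int[mu]_(x in dir true s) g x.
  by move=> Is; rewrite hq //; ring.
have e2 s : I01 s -> p s * g s = g s * \int[mu]_(x in dir false s) f x.
  by move=> Is; rewrite hp // mulrC.
have i4 : intg (fun s => f s * q s).
  by apply: (intg_ext _ (intgD i3 i1)) => s Is; rewrite e1.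
have i5 : intg (fun s => p s * g s) by apply: (intg_ext _ i2) => s Is; rewrite e2.
split => //.
rewrite RintegralB //.
rewrite (@eq_Rintegral _ _ _ mu I01
  (fun s => q1 * f s + f s * \int[mu]_(x in dir true s) g x) (fun s => f s * q s)); last first.
  by move=> s /set_mem; exact: e1.
rewrite (@eq_Rintegral _ _ _ mu I01
  (fun s => g s * \int[mu]_(x in dir false s) f x) (fun s => p s * g s)); last first.
  by move=> s /set_mem; exact: e2.
rewrite RintegralD //.
rewrite RintegralZl //.
rewrite fubini_triangle // hp; last by rewrite /= in_itv /= ler01 lexx.
rewrite dir_false1; under [X in _ = _ - X]eq_Rintegral => s _ do rewrite mulrC.
by rewrite addrK.
Qed.

End TriangleFubini.

(** * The space of controls *)

Section L2Space.
Context {R : realType}.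
Local Notation mu := (@lebesgue_measure R).
Local Notation I01 := (`[0%R, 1%R]%classic : set R).
Context {k : nat}.
Implicit Types u v w : R -> 'cV[R]_k.

Definition sqn u (s : R) : R := \sum_(i < k) (u s i ord0) ^+ 2.

Lemma sqn_ge0 u s : 0 <= sqn u s.
Proof. by apply: sumr_ge0 => i _; exact: sqr_ge0. Qed.

Lemma measurable_sqn u : (forall i, measurable_fun I01 (fun s => u s i ord0)) ->
  measurable_fun I01 (sqn u).
Proof. by move=> h; apply: measurable_sum => i; exact: (measurable_funX 2 (h i)). Qed.

Lemma inL2P u : inL2 u <-> forall i, sqi (fun s => u s i ord0).
Proof.
split=> [[hm fin] i|h].
  have ms := measurable_sqn hm.
  split => //; apply: (intg_dom (g := sqn u)).
  - exact: (measurable_funX 2 (hm i)).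
  - move=> s _; rewrite ger0_norm ?sqr_ge0 // /sqn (bigD1 i) //= lerDl.
    by apply: sumr_ge0 => j _; exact: sqr_ge0.
  - apply/integrableP; split; first exact/measurable_EFinP.
    apply: le_lt_trans fin; rewrite /L2sq le_eqVlt; apply/orP; left; apply/eqP.
    by apply: eq_integral => s _ /=; rewrite ger0_norm // sqn_ge0.
have ms : measurable_fun I01 (sqn u) by apply: measurable_sqn => i; exact: (h i).1.
split=> [i|]; first exact: (h i).1.
have /integrableP[_] : intg (sqn u) by apply: intg_sum => i; exact: (h i).2.
apply: le_lt_trans; rewrite /L2sq le_eqVlt; apply/orP; left; apply/eqP.
by apply: eq_integral => s _ /=; rewrite ger0_norm // sqn_ge0.
Qed.

Lemma inL2_0 : inL2 (fun=> 0 : 'cV[R]_k).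
Proof. by apply/inL2P => i; under eq_fun do rewrite mxE; exact: sqi_cst. Qed.

Lemma inL2D u v : inL2 u -> inL2 v -> inL2 (fun s => u s + v s).
Proof.
move=> /inL2P hu /inL2P hv; apply/inL2P => i; under eq_fun do rewrite mxE; exact: sqiD.
Qed.

Lemma inL2Z (c : R) u : inL2 u -> inL2 (fun s => c *: u s).
Proof.
move=> /inL2P hu; apply/inL2P => i; under eq_fun do rewrite mxE; exact: sqiZ.
Qed.

Lemma inL2B u v : inL2 u -> inL2 v -> inL2 (fun s => u s - v s).
Proof.
move=> hu /(inL2Z (-1)) hv; have := inL2D hu hv.
by under eq_fun do rewrite scaleN1r.
Qed.

Lemma intg_inner u v : inL2 u -> inL2 v -> intg (fun s => \sum_(i < k) u s i ord0 * v s i ord0).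
Proof. by move=> /inL2P hu /inL2P hv; apply: intg_sum => i; exact: sqi_mul. Qed.

Lemma L2innerE u v :
  L2inner u v = \int[mu]_(s in I01) (\sum_(i < k) u s i ord0 * v s i ord0).
Proof. by []. Qed.

Lemma L2innerC u v : L2inner u v = L2inner v u.
Proof. by rewrite !L2innerE; apply: eq_Rintegral => s _; apply: eq_bigr => i _; rewrite mulrC. Qed.

Lemma L2innerDl u v w : inL2 u -> inL2 v -> inL2 w ->
  L2inner (fun s => u s + v s) w = L2inner u w + L2inner v w.
Proof.
move=> hu hv hw; rewrite !L2innerE -RintegralD //; try exact: intg_inner.
apply: eq_Rintegral => s _; rewrite -big_split; apply: eq_bigr => i _ /=.
by rewrite mxE mulrDl.
Qed.

Lemma L2innerZl (c : R) u w : inL2 u -> inL2 w ->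
  L2inner (fun s => c *: u s) w = c * L2inner u w.
Proof.
move=> hu hw; rewrite !L2innerE -RintegralZl //; try exact: intg_inner.
apply: eq_Rintegral => s _; rewrite mulr_sumr; apply: eq_bigr => i _ /=.
by rewrite mxE mulrA.
Qed.

Lemma L2innerBl u v w : inL2 u -> inL2 v -> inL2 w ->
  L2inner (fun s => u s - v s) w = L2inner u w - L2inner v w.
Proof.
move=> hu hv hw.
have -> : (fun s => u s - v s) = (fun s => u s + (-1) *: v s).
  by apply/funext => s; rewrite scaleN1r.
by rewrite L2innerDl ?L2innerZl ?mulN1r //; exact: inL2Z.
Qed.

Lemma L2innerDr u v w : inL2 u -> inL2 v -> inL2 w ->
  L2inner w (fun s => u s + v s) = L2inner w u + L2inner w v.
Proof. by move=> *; rewrite L2innerC L2innerDl // !(L2innerC w). Qed.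

Lemma L2innerZr (c : R) u w : inL2 u -> inL2 w ->
  L2inner w (fun s => c *: u s) = c * L2inner w u.
Proof. by move=> *; rewrite L2innerC L2innerZl // (L2innerC w). Qed.

Lemma L2norm_sqr u : L2norm u ^+ 2 = \int[mu]_(s in I01) sqn u s.
Proof. by rewrite sqr_sqrtr // fine_ge0 // integral_ge0 // => s _; rewrite lee_fin; exact: sqn_ge0. Qed.

Lemma L2norm_sqrE u : L2norm u ^+ 2 = L2inner u u.
Proof.
by rewrite L2norm_sqr L2innerE; apply: eq_Rintegral => s _; apply: eq_bigr => i _; rewrite expr2.
Qed.

Lemma L2norm_ge0 u : 0 <= L2norm u. Proof. exact: sqrtr_ge0. Qed.

Lemma L2normZ (c : R) u : inL2 u -> L2norm (fun s => c *: u s) = `|c| * L2norm u.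
Proof.
move=> hu; apply/eqP; rewrite -(@eqrXn2 _ 2) ?L2norm_ge0 ?mulr_ge0 ?L2norm_ge0 //.
rewrite exprMn !L2norm_sqrE L2innerZl ?L2innerZr ?real_normK ?num_real //; last exact: inL2Z.
by rewrite mulrA -expr2.
Qed.

Lemma L2normD_sqr u v : inL2 u -> inL2 v ->
  L2norm (fun s => u s + v s) ^+ 2 = L2norm u ^+ 2 + 2 * L2inner u v + L2norm v ^+ 2.
Proof.
move=> hu hv; have huv := inL2D hu hv.
by rewrite !L2norm_sqrE L2innerDl // !L2innerDr // (L2innerC v u); ring.
Qed.

Lemma L2_CS u v : inL2 u -> inL2 v -> `|L2inner u v| <= L2norm u * L2norm v.
Proof.
move=> hu hv.
have : L2inner u v ^+ 2 <= (L2norm u * L2norm v) ^+ 2.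
  rewrite exprMn; apply: quad_disc => [|t]; first exact: sqr_ge0.
  have := L2normD_sqr hu (inL2Z t hv); rewrite L2innerZr // L2normZ // exprMn real_normK ?num_real //.
  move=> h; have := sqr_ge0 (L2norm (fun s => u s + t *: v s)); rewrite h; lra.
by rewrite -[X in X <= _](real_normK (num_real _)) ler_sqr ?nnegrE // mulr_ge0 ?L2norm_ge0.
Qed.

Lemma L2normD u v : inL2 u -> inL2 v ->
  L2norm (fun s => u s + v s) <= L2norm u + L2norm v.
Proof.
move=> hu hv; rewrite -ler_sqr ?nnegrE ?addr_ge0 ?L2norm_ge0 // L2normD_sqr // sqrrD.
have := le_trans (ler_norm _) (L2_CS hu hv); lra.
Qed.

Lemma L2normB u v : inL2 u -> inL2 v ->
  L2norm (fun s => u s - v s) <= L2norm u + L2norm v.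
Proof.
move=> hu hv; have -> : (fun s => u s - v s) = (fun s => u s + (-1) *: v s).
  by apply/funext => s; rewrite scaleN1r.
by apply: le_trans (L2normD hu (inL2Z _ hv)) _; rewrite L2normZ // normrN1 mul1r.
Qed.

Lemma L2norm_distC u v : L2norm (fun s => u s - v s) = L2norm (fun s => v s - u s).
Proof.
rewrite /L2norm /L2sq; congr (Num.sqrt (fine _)); apply: eq_integral => s _.
by congr EFin; apply: eq_bigr => i _; rewrite !mxE -sqrrN opprB.
Qed.

(** Euclidean, unlike the sup norm of [u s] as a matrix, so that its square integrates exactly to
    [L2norm u ^+ 2]. *)
Definition pnorm u (s : R) : R := Num.sqrt (sqn u s).

Lemma pnorm_ge0 u s : 0 <= pnorm u s. Proof. exact: sqrtr_ge0. Qed.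

Lemma pnorm_sqr u s : pnorm u s ^+ 2 = sqn u s.
Proof. by rewrite sqr_sqrtr // sqn_ge0. Qed.

Lemma entry_le_pnorm u s i : `|u s i ord0| <= pnorm u s.
Proof.
rewrite -sqrtr_sqr ler_sqrt ?sqn_ge0 // /sqn (bigD1 i) //= lerDl.
by apply: sumr_ge0 => j _; exact: sqr_ge0.
Qed.

Lemma sqi_pnorm u : inL2 u -> sqi (pnorm u).
Proof.
move=> /inL2P hu; split; last first.
  by under eq_fun do rewrite pnorm_sqr; apply: intg_sum => i; exact: (hu i).2.
have ms : measurable_fun I01 (sqn u) by apply: measurable_sqn => i; exact: (hu i).1.
exact: (measurableT_comp (continuous_measurable_fun (@sqrt_continuous R)) ms).
Qed.

Lemma Rint_pnorm_sqr u : \int[mu]_(s in I01) (pnorm u s ^+ 2) = L2norm u ^+ 2.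
Proof. by rewrite L2norm_sqr; apply: eq_Rintegral => s _; exact: pnorm_sqr. Qed.

(** Cauchy-Schwarz against the constant 1 on an interval of length 1. *)
Lemma Rint_pnorm u (D : set (measurableTypeR R)) : measurable D -> D `<=` I01 -> inL2 u ->
  \int[mu]_(s in D) pnorm u s <= L2norm u.
Proof.
move=> mD DI hu.
apply: (@le_trans _ _ (\int[mu]_(s in I01) pnorm u s)).
  apply: Rint_le_I01 => //; first exact/sqi_intg/sqi_pnorm.
  by move=> s _; exact: pnorm_ge0.
have := sqi_CS mI01 (@subset_refl _ _) (sqi_pnorm hu) (sqi_cst 1).
rewrite Rint_pnorm_sqr; under eq_Rintegral do rewrite mulr1.
have -> : \int[mu]_(x in I01) (1 ^+ 2 : R) = 1.
  rewrite Rintegral_cst; last exact: mI01.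
  by rewrite expr1n mul1r; exact: (congr1 fine (@lebesgue_I01 R)).
rewrite mulr1 ler_sqr ?nnegrE ?L2norm_ge0 //.
by apply: Rintegral_ge0 => s _; exact: pnorm_ge0.
Qed.

Lemma L2norm_eq0_ae u : inL2 u -> L2norm u = 0 -> forall i,
  ae_eq mu I01 (fun s => (u s i ord0)%:E) (cst 0%E).
Proof.
move=> hu u0 i.
have hs : intg (sqn u) by apply: intg_sum => j; have /inL2P := hu; move=> /(_ j) [].
have : (\int[mu]_(s in I01) (`|(sqn u s)%:E|) = 0)%E.
  have -> : (\int[mu]_(s in I01) `|(sqn u s)%:E| = \int[mu]_(s in I01) (sqn u s)%:E)%E.
    by apply: eq_integral => s _; rewrite gee0_abs // lee_fin sqn_ge0.
  rewrite (EFin_Rint hs mI01); congr EFin.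
  by have := L2norm_sqr u; rewrite u0 expr0n /= => <-.
move=> h; have /(ae_eq_integral_abs mu mI01) : measurable_fun I01 (EFin \o sqn u).
  by apply/measurable_EFinP; exact: intg_meas.
move=> [/(_ h) ae0 _]; apply: filterS ae0 => s /= hz Is.
have sq0 : sqn u s = 0 by apply: EFin_inj; exact: hz.
congr EFin; apply/eqP.
by rewrite -normr_le0; apply: le_trans (entry_le_pnorm u s i) _; rewrite /pnorm sq0 sqrtr0.
Qed.

End L2Space.

(** * Trajectories *)

Section Trajectories.
Context {R : realType}.
Local Notation mu := (@lebesgue_measure R).
Local Notation I01 := (`[0%R, 1%R]%classic : set R).

Lemma cont01_cvg n (z : R -> 'cV[R]_n) x : cont01 z -> I01 x ->
  z t @[t --> within I01 (nbhs x)] --> z x.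
Proof.
move=> cz Ix; apply/cvgrPdist_le => e e0.
have h : \forall t \near within I01 (nbhs x), forall i, `|z x i ord0 - z t i ord0| <= e.
  apply: filter_forall => i.
  by have /within_contP/(_ x Ix)/cvgrPdist_le/(_ e e0) := cz i.
apply: filterS h => t ht; apply: norm_le_entries => [|i j]; first exact: ltW.
by rewrite ord1 !mxE.
Qed.

Lemma cont01_comp n (z : R -> 'cV[R]_n) (g : 'cV[R]_n -> R) : cont01 z -> continuous g ->
  {within I01, continuous (fun s => g (z s))}.
Proof.
move=> cz cg; apply/within_contP => x Ix.
exact: (cvg_comp _ _ (cont01_cvg cz Ix) (cg (z x))).
Qed.

Lemma normr_mulmx_entry n k (M : 'M[R]_(n, k)) (u : R -> 'cV[R]_k) s i (B : R) :
  (forall j, `|M i j| <= B) -> `|(M *m u s) i ord0| <= k%:R * B * pnorm u s.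
Proof.
move=> hM; rewrite mxE; apply: le_trans (ler_norm_sum _ _ _) _.
apply: (@le_trans _ _ (\sum_(j < k) B * pnorm u s)).
  by apply: ler_sum => j _; rewrite normrM ler_pM ?entry_le_pnorm.
by rewrite sumr_const card_ord -[leLHS]mulr_natl mulrA.
Qed.

Context {n k : nat} (F : 'cV[R]_n -> 'M[R]_(n, k)) (x0 : 'cV[R]_n) (L : R).
Context (L0 : 0 <= L) (lipF : forall x y, `|F x - F y| <= L * `|x - y|).

Lemma lipF_entry x y i j : `|F x i j - F y i j| <= L * `|x - y|.
Proof.
by apply: le_trans (lipF x y); have := entry_le_norm (F x - F y) i j; rewrite !mxE.
Qed.

Lemma F_entry_continuous i j : continuous (fun x => F x i j).
Proof.
move=> x; apply/(@cvgrPdist_le _ _ _ (nbhs x) (nbhs_filter x)) => e e0.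
have L1 : 0 < L + 1 by rewrite ltr_wpDl.
have eL : 0 < e / (L + 1) by rewrite divr_gt0.
have : \forall y \near x, `|x - y| < e / (L + 1).
  by apply/nbhs_normP; exists (e / (L + 1)).
apply: filterS => y /ltW h; apply: le_trans (lipF_entry x y i j) _.
apply: (@le_trans _ _ ((L + 1) * `|x - y|)).
  by rewrite ler_wpM2r // lerDl.
by rewrite mulrC -ler_pdivlMr.
Qed.

Lemma measurable_mulF (z : R -> 'cV[R]_n) (u : R -> 'cV[R]_k) i : cont01 z -> inL2 u ->
  measurable_fun I01 (fun s => (F (z s) *m u s) i ord0).
Proof.
move=> cz /inL2P hu.
have -> : (fun s => (F (z s) *m u s) i ord0) = (fun s => \sum_j F (z s) i j * u s j ord0).
  by apply/funext => s; rewrite mxE.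
apply: measurable_sum => j; apply: measurable_funM; last exact: (hu j).1.
exact: (intg_meas (intg_cont (cont01_comp cz (F_entry_continuous (i := i) (j := j))))).
Qed.

Lemma solves_exists (u : R -> 'cV[R]_k) : inL2 u -> exists x, solves F x0 u x.
Proof.
(* One rate serves both hypotheses of [picard]: the part with [L] for the Lipschitz bound, the part
   with [F 0] for the value at the zero state. *)
move=> hu; pose nu s := k%:R * (L + `|F 0|) * pnorm u s.
have [||||z [cz hz]] := @picard _ false n (fun t z => F z *m u t) x0 nu.
- exact/sqiZ/sqi_pnorm.
- move=> t z z' i It; have -> : (F z *m u t) i ord0 - (F z' *m u t) i ord0 =
    ((F z - F z') *m u t) i ord0 by rewrite mulmxBl !mxE.
  apply: le_trans (normr_mulmx_entry (B := L * `|z - z'|) _ _ _) _.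
    by move=> j; rewrite !mxE; exact: lipF_entry.
  rewrite (_ : _ * _ * pnorm u t = k%:R * L * pnorm u t * `|z - z'|); last by ring.
  by rewrite /nu !ler_wpM2r ?pnorm_ge0 // ler_wpM2l // lerDl.
- move=> t i It; apply: le_trans (normr_mulmx_entry (B := `|F 0|) _ _ _) _.
    by move=> j; exact: entry_le_norm.
  by rewrite /nu ler_wpM2r ?pnorm_ge0 // ler_wpM2l // lerDr.
- by move=> z cz i; exact: measurable_mulF.
by exists z => i; have [h1 h2] := hz i; split.
Qed.

Local Notation X := (traj F x0).

(** [traj] is chosen with the zero curve as default value; existence of a solution excludes the
    default. *)
Lemma traj_solves u : inL2 u -> solves F x0 u (X u).
Proof. by move=> hu; apply: xgetPex; exact: solves_exists. Qed.

Lemma intg_traj u i : inL2 u -> intg (fun s => (F (X u s) *m u s) i ord0).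
Proof. by move=> hu; have [] := traj_solves hu i. Qed.

Lemma trajE u i s : inL2 u -> I01 s ->
  X u s i ord0 = x0 i ord0 + \int[mu]_(t in dir false s) (F (X u t) *m u t) i ord0.
Proof. by move=> hu Is; have [_ ->] := traj_solves hu i. Qed.

Lemma cont01_traj u : inL2 u -> cont01 (X u).
Proof.
move=> hu i; apply/within_contP => s Is.
have /within_contP/(_ s Is) h := within_contD (@within_cont_cst _ (x0 i ord0))
  (@Rint_dir_cont _ false _ (intg_traj i hu)).
rewrite trajE //; apply: cvg_trans h; apply: near_eq_cvg; near=> t.
by rewrite trajE //; near: t; exact: withinT.
Unshelve. all: by end_near. Qed.

Lemma traj_diff u v i s : inL2 u -> inL2 v -> I01 s ->
  X v s i ord0 - X u s i ord0 = \int[mu]_(t in dir false s)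
    ((F (X v t) *m v t) i ord0 - (F (X u t) *m u t) i ord0).
Proof.
move=> hu hv Is; rewrite !trajE // RintegralB //; last 3 first.
- exact: mdir.
- exact: (intg_sub (mdir _ _) (dir_sub (b := false) Is) (intg_traj i hv)).
- exact: (intg_sub (mdir _ _) (dir_sub (b := false) Is) (intg_traj i hu)).
by rewrite opprD addrACA subrr add0r.
Qed.

(** The constant 2 B exp(K) of [gronwall] with the norm of v - u factored out of B: B = k M |v - u|
    and K = 2 A + 1, where A = (k L N)^2 bounds the squared L^2 norm of the rate
    [k%:R * L * pnorm v]. *)
Definition stab_const (M N : R) : R :=
  2 * (k%:R * M) * expR (2 * ((k%:R * L) ^+ 2 * N ^+ 2) + 1).

(** In F(X v) v - F(X u) u = F(X u)(v - u) + (F(X v) - F(X u)) v, the first term involves the size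
    of F along X u, the second the norm of v. The asymmetry permits a first application from a fixed
    centre u, before F is controlled along X v. *)
Lemma traj_stable u v (M N : R) : inL2 u -> inL2 v -> 0 <= M -> L2norm v <= N ->
  (forall s, I01 s -> `|F (X u s)| <= M) ->
  forall s, I01 s -> `|X v s - X u s| <= stab_const M N * L2norm (fun s => v s - u s).
Proof.
move=> hu hv M0 hN hM; pose h s := v s - u s.
have hh : inL2 h by exact: inL2B.
have N0 : 0 <= N := le_trans (L2norm_ge0 v) hN.
pose nu s := k%:R * L * pnorm v s.
have snu : sqi nu by apply: sqiZ; exact: sqi_pnorm.
pose A := (k%:R * L) ^+ 2 * N ^+ 2; pose K := 2 * A + 1.
have A0 : 0 <= A by rewrite mulr_ge0 // sqr_ge0.
have hA : \int[mu]_(x in I01) (nu x ^+ 2) <= A.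
  have -> : \int[mu]_(x in I01) (nu x ^+ 2) = (k%:R * L) ^+ 2 * L2norm v ^+ 2.
    under eq_Rintegral do rewrite exprMn.
    by rewrite RintegralZl ?Rint_pnorm_sqr //; exact: (sqi_pnorm hv).2.
  by rewrite ler_wpM2l ?sqr_ge0 // lerXn2r ?nnegrE // L2norm_ge0.
have K0 : 0 <= K by rewrite /K; lra.
have B0 : 0 <= k%:R * M * L2norm h by rewrite !mulr_ge0 // L2norm_ge0.
have [Cu Cu0 hCu] := cont01_bounded (cont01_traj hu).
have [Cv Cv0 hCv] := cont01_bounded (cont01_traj hv).
move=> s Is; rewrite /stab_const -/A -/K.
have -> : 2 * (k%:R * M) * expR K * L2norm (fun s => v s - u s) =
  2 * (k%:R * M * L2norm h) * expR K by rewrite /h; ring.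
apply: (@gronwall _ false K _ (Cv + Cu) (fun s => `|X v s - X u s|)) => // [t It|S S0 hS t It].
  apply/andP; split; first exact: normr_ge0.
  by apply: le_trans (ler_normB _ _) _; apply: lerD; [exact: hCv | exact: hCu].
have w0 := expR_ge0; apply: norm_le_entries => [|i j].
  by rewrite addr_ge0 // mulr_ge0 // divr_ge0 // expR_ge0.
rewrite ord1 !mxE traj_diff //.
have i1 : intg (fun t => S * (nu t * wt false K t)).
  by apply: intgZ; apply: sqi_mul => //; apply: sqi_cont; exact: wt_within.
have i2 : intg (fun t => k%:R * M * pnorm h t) by apply/intgZ/sqi_intg/sqi_pnorm.
apply: le_trans (Rint_abs_le (g := fun t => k%:R * M * pnorm h t + S * (nu t * wt false K t)) _ _ _ _ _) _.
- exact: mdir.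
- exact: dir_sub.
- by apply: intgB; exact: intg_traj.
- exact: intgD.
- move=> x Ix.
  have -> : (F (X v x) *m v x) i ord0 - (F (X u x) *m u x) i ord0 =
     (F (X u x) *m h x) i ord0 + ((F (X v x) - F (X u x)) *m v x) i ord0.
    by rewrite /h mulmxBr mulmxBl !mxE; ring.
  apply: le_trans (ler_normD _ _) _; apply: lerD.
    apply: normr_mulmx_entry => l; apply: le_trans (hM x Ix); exact: entry_le_norm.
  apply: le_trans (normr_mulmx_entry (B := L * (S * wt false K x)) _ _ _) _.
    move=> l; rewrite !mxE; apply: le_trans (lipF_entry _ _ _ _) _.
    by rewrite ler_wpM2l // hS.
  by rewrite /nu; apply: le_of_eq; ring.
have isub f (hf : intg f) := intg_sub (mdir false t) (dir_sub (b := false) It) hf.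
rewrite RintegralD //; [|exact: mdir|exact: isub|exact: isub]; apply: lerD.
  rewrite RintegralZl //; [|exact: mdir|by apply: isub; apply/sqi_intg/sqi_pnorm].
  by rewrite ler_wpM2l ?mulr_ge0 // Rint_pnorm //; [exact: mdir | exact: dir_sub].
rewrite RintegralZl //; [|exact: mdir|].
  by rewrite ler_wpM2l //; exact: Rint_mul_wt.
by apply: isub; apply: sqi_mul => //; apply: sqi_cont; exact: wt_within.
Qed.

End Trajectories.

(** * The adjoint equation and the gradient of the cost *)

Section Tube.
Context {R : realType}.
Local Notation mu := (@lebesgue_measure R).
Local Notation I01 := (`[0%R, 1%R]%classic : set R).

Definition taylor2 n (f : 'cV[R]_n -> R) (g : 'I_n -> 'cV[R]_n -> R) (x y : 'cV[R]_n) (C : R) : Prop :=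
  `|f y - f x - \sum_l g l x * (y l ord0 - x l ord0)| <= C * `|y - x| ^+ 2.

(** A gradient in the local C^{1,1} sense: the remainder constant is uniform when base point and end
    point both vary near p. *)
Definition is_gradient_fun n (f : 'cV[R]_n -> R) (g : 'I_n -> 'cV[R]_n -> R) : Prop :=
  forall p, exists2 r : R, 0 < r & exists C, forall x y,
    `|x - p| < r -> `|y - p| < r -> taylor2 f g x y C.

Lemma near_norm_lt n (p : 'cV[R]_n) (r : R) : 0 < r -> \forall y \near p, `|p - y| < r.
Proof. by move=> r0; apply/nbhs_normP; exists r. Qed.

Lemma taylor2_lip n (f : 'cV[R]_n -> R) g x y C (G : R) : taylor2 f g x y C ->
  (forall l, `|g l x| <= G) -> `|y - x| <= 1 ->
  `|f y - f x| <= (n%:R * G + `|C|) * `|y - x|.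
Proof.
move=> h hG d1.
rewrite -[f y - f x](subrK (\sum_l g l x * (y l ord0 - x l ord0))).
apply: le_trans (ler_normD _ _) _; rewrite addrC mulrDl; apply: lerD.
  apply: le_trans (ler_norm_sum _ _ _) _.
  apply: (@le_trans _ _ (\sum_(l < n) G * `|y - x|)).
    apply: ler_sum => l _; rewrite normrM ler_pM //.
    by have := entry_le_norm (y - x) l ord0; rewrite !mxE.
  by rewrite sumr_const card_ord -[leLHS]mulr_natl mulrA.
apply: le_trans h _; rewrite expr2 mulrA.
apply: le_trans (_ : `|C| * `|y - x| * `|y - x| <= _).
  by rewrite ler_wpM2r // ler_wpM2r // ler_norm.
by rewrite ler_piMr // mulr_ge0.
Qed.

Lemma gradient_fun_continuous n (f : 'cV[R]_n -> R) g : is_gradient_fun f g -> continuous f.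
Proof.
move=> fg p; apply/(@cvgrPdist_le _ _ _ (nbhs p) (nbhs_filter p)) => e e0.
have [r r0 [C hC]] := fg p.
pose G := \sum_l `|g l p|; pose B := n%:R * G + `|C| + 1.
have G0 : 0 <= G by apply: sumr_ge0.
have B0 : 0 < B by rewrite ltr_wpDl // addr_ge0 // mulr_ge0.
have rr : 0 < Num.min r (Num.min 1 (e / B)) by rewrite !lt_min r0 ltr01 divr_gt0.
apply: filterS (near_norm_lt p rr) => y; rewrite !lt_min => /and3P[h1 h2 h3].
rewrite distrC; apply: le_trans (taylor2_lip (G := G) (hC p y _ _) _ _) _.
- by rewrite subrr normr0.
- by rewrite distrC.
- by move=> l; rewrite /G (bigD1 l) //= lerDl sumr_ge0.
- by rewrite distrC ltW.
apply: (@le_trans _ _ (B * `|y - p|)); first by rewrite ler_wpM2r // /B lerDl.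
by rewrite mulrC -ler_pdivlMr // distrC ltW.
Qed.

(* Compactness of [0,1] makes a locally uniform property uniform along a curve. *)
Lemma tube n (z : R -> 'cV[R]_n) (Q : 'cV[R]_n -> 'cV[R]_n -> R -> Prop) : cont01 z ->
  (forall x y C C', C <= C' -> Q x y C -> Q x y C') ->
  (forall p, exists2 r : R, 0 < r & exists C, forall x y,
    `|x - p| < r -> `|y - p| < r -> Q x y C) ->
  \forall N \near \oo, forall s, I01 s -> forall x y,
    `|x - z s| < N.+1%:R^-1 -> `|y - z s| < N.+1%:R^-1 -> Q x y N%:R.
Proof.
move=> cz mono loc.
have /compact_near_coveringP cpt : compact (I01 : set R) by exact: segment_compact.
(* A single [N] encodes the radius 1/(N+1) and the constant. The property then holds for all large
   [N], and finitely many such properties can share one [N]. *)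
pose P (N : nat) (s : R) := I01 s -> forall x y,
  `|x - z s| < N.+1%:R^-1 -> `|y - z s| < N.+1%:R^-1 -> Q x y N%:R.
suff : \forall N \near \oo, I01 `<=` P N.
  by apply: filterS => N h s Is; exact: h.
apply: (cpt _ _ P) => s Is.
have [r r0 [C hC]] := loc (z s).
have r2 : 0 < r / 2 by rewrite divr_gt0.
have /cvgrPdist_lt/(_ _ r2) hz := cont01_cvg cz Is.
have hN : \forall N \near \oo, N.+1%:R^-1 <= r / 2 /\ C <= N%:R.
  near=> N; split.
    by apply: ltW; near: N; exact: near_infty_natSinv_lt (PosNum r2).
  near: N; exact: nbhs_infty_ger.
exists (fun t => I01 t -> `|z s - z t| < r / 2, fun N => N.+1%:R^-1 <= r / 2 /\ C <= N%:R) => //=.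
move=> [t N] /= [ht [hN1 hN2]] It x y hx hy.
have {}ht := ht It.
apply: mono hN2 _; apply: hC.
- rewrite -[x - z s](subrKA (z t)); apply: le_lt_trans (ler_normD _ _) _.
  rewrite (splitr r) ltrD ?(lt_le_trans hx) // distrC //.
- rewrite -[y - z s](subrKA (z t)); apply: le_lt_trans (ler_normD _ _) _.
  rewrite (splitr r) ltrD ?(lt_le_trans hy) // distrC //.
Unshelve. all: by end_near. Qed.

End Tube.

(** * The backward adjoint equation *)

Section Adjoint.
Context {R : realType}.
Local Notation mu := (@lebesgue_measure R).
Local Notation I01 := (`[0%R, 1%R]%classic : set R).
Context {n k : nat} (F : 'cV[R]_n -> 'M[R]_(n, k)) (x0 : 'cV[R]_n) (L : R).
Context (L0 : 0 <= L) (lipF : forall x y, `|F x - F y| <= L * `|x - y|).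
Context (da : 'I_n -> 'cV[R]_n -> R).
Context (dF : 'I_n -> 'I_k -> 'I_n -> 'cV[R]_n -> R).
Context (dF_cont : forall l j i, continuous (dF l j i)).
Local Notation X := (traj F x0).

(** Component [i] of the transposed linearised dynamics applied to [lam], [dF l j i] being the i-th
    partial derivative of the entry (l, j) of F. The minus sign of the adjoint equation is absorbed
    in [adjoint] by integrating from s to 1. *)
Definition adj_rhs (v : R -> 'cV[R]_k) (x lam : R -> 'cV[R]_n) i t : R :=
  \sum_l lam t l ord0 * \sum_j dF l j i (x t) * v t j ord0.

Definition adjoint (v : R -> 'cV[R]_k) (lam : R -> 'cV[R]_n) : Prop :=
  cont01 lam /\ forall i, intg (adj_rhs v (X v) lam i) /\
    forall s, I01 s -> lam s i ord0 = da i (X v 1) +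
      \int[mu]_(t in dir true s) adj_rhs v (X v) lam i t.

Lemma adj_rhs_bound v x lam i t (C : R) : (forall l j, `|dF l j i (x t)| <= C) ->
  `|adj_rhs v x lam i t| <= n%:R * k%:R * C * pnorm v t * `|lam t|.
Proof.
move=> hC; apply: le_trans (ler_norm_sum _ _ _) _.
apply: (@le_trans _ _ (\sum_(l < n) `|lam t| * (k%:R * (C * pnorm v t)))).
  apply: ler_sum => l _; rewrite normrM ler_pM ?entry_le_norm //.
  apply: le_trans (ler_norm_sum _ _ _) _.
  apply: (@le_trans _ _ (\sum_(j < k) C * pnorm v t)).
    by apply: ler_sum => j _; rewrite normrM ler_pM // entry_le_pnorm.
  by rewrite sumr_const card_ord -[leLHS]mulr_natl.
by rewrite sumr_const card_ord -[leLHS]mulr_natl; apply: le_of_eq; ring.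
Qed.

Lemma dF_traj_bounded v : inL2 v -> exists2 C : R, 0 <= C &
  forall l j i t, I01 t -> `|dF l j i (X v t)| <= C.
Proof.
move=> hv; have cx : cont01 (X v) := cont01_traj L0 lipF hv.
have h (q : 'I_n * 'I_k * 'I_n) : exists C : R, 0 <= C /\
    forall t, I01 t -> `|dF q.1.1 q.1.2 q.2 (X v t)| <= C.
  by have [C C0 hC] := within_bounded (cont01_comp cx (@dF_cont q.1.1 q.1.2 q.2)); exists C.
have [C hC] := choice h; exists (\sum_q C q) => [|l j i t It].
  by apply: sumr_ge0 => q _; exact: (hC q).1.
apply: le_trans ((hC (l, j, i)).2 t It) _; rewrite (bigD1 (l, j, i)) //= lerDl.
by apply: sumr_ge0 => q _; exact: (hC q).1.
Qed.

Lemma adjoint_exists v : inL2 v -> exists lam, adjoint v lam.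
Proof.
move=> hv; have [C C0 hC] := dF_traj_bounded hv.
have cx : cont01 (X v) := cont01_traj L0 lipF hv.
pose Phi t (z : 'cV[R]_n) : 'cV[R]_n := \col_i adj_rhs v (X v) (fun=> z) i t.
have PhiB t z z' i : Phi t z i ord0 - Phi t z' i ord0 = adj_rhs v (X v) (fun=> z - z') i t.
  by rewrite !mxE /adj_rhs -sumrB; apply: eq_bigr => l _; rewrite !mxE mulrBl.
have [||||lam [clam hlam]] := @picard _ true n Phi (\col_i da i (X v 1))
    (fun t => n%:R * k%:R * C * pnorm v t).
- exact/sqiZ/sqi_pnorm.
- by move=> t z z' i It; rewrite PhiB; apply: adj_rhs_bound => l j; exact: hC.
- move=> t i It; rewrite mxE; apply: le_trans (adj_rhs_bound (C := C) _ _ _) _.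
    by move=> l j; exact: hC.
  by rewrite normr0 mulr0 !mulr_ge0 // pnorm_ge0.
- move=> z cz i.
  have -> : (fun t => Phi t (z t) i ord0) =
      (fun t => \sum_l z t l ord0 * \sum_j dF l j i (X v t) * v t j ord0).
    by apply/funext => t; rewrite mxE.
  apply: measurable_sum => l; apply: measurable_funM; first exact: (intg_meas (intg_cont (cz l))).
  apply: measurable_sum => j; apply: measurable_funM.
    exact: (intg_meas (intg_cont (cont01_comp cx (@dF_cont l j i)))).
  by move/inL2P : hv => /(_ j) [].
exists lam; split => // i; have [h1 h2] := hlam i.
have e : (fun t => Phi t (lam t) i ord0) = adj_rhs v (X v) lam i.
  by apply/funext => t; rewrite mxE.
rewrite e in h1; split => // s Is.
rewrite h2 // mxE; congr (_ + _); apply: eq_Rintegral => t _.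
by rewrite mxE.
Qed.

(** Again the constant of [gronwall], with terminal datum bounded by [Ca] and rate
    [n%:R * k%:R * Cd * pnorm v]. *)
Definition adj_const (Ca Cd N : R) : R :=
  2 * Ca * expR (2 * ((n%:R * k%:R * Cd) ^+ 2 * N ^+ 2) + 1).

Lemma adjoint_bounded v lam (Ca Cd N : R) : inL2 v -> adjoint v lam -> 0 <= Ca -> 0 <= Cd ->
  (forall l j i t, I01 t -> `|dF l j i (X v t)| <= Cd) ->
  (forall i, `|da i (X v 1)| <= Ca) -> L2norm v <= N ->
  forall s, I01 s -> `|lam s| <= adj_const Ca Cd N.
Proof.
move=> hv [clam hlam] Ca0 Cd0 hCd hCa hN.
pose nu t := n%:R * k%:R * Cd * pnorm v t.
have snu : sqi nu by apply: sqiZ; exact: sqi_pnorm.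
pose A := (n%:R * k%:R * Cd) ^+ 2 * N ^+ 2; pose K := 2 * A + 1.
have A0 : 0 <= A by rewrite mulr_ge0 // sqr_ge0.
have hA : \int[mu]_(x in I01) (nu x ^+ 2) <= A.
  have -> : \int[mu]_(x in I01) (nu x ^+ 2) = (n%:R * k%:R * Cd) ^+ 2 * L2norm v ^+ 2.
    under eq_Rintegral do rewrite exprMn.
    by rewrite RintegralZl ?Rint_pnorm_sqr //; exact: (sqi_pnorm hv).2.
  rewrite ler_wpM2l ?sqr_ge0 // lerXn2r ?nnegrE // ?L2norm_ge0 //.
  exact: le_trans (L2norm_ge0 v) hN.
have K0 : 0 <= K by rewrite /K; lra.
have [M M0 hM] := cont01_bounded clam.
move=> s Is; rewrite /adj_const -/A -/K.
apply: (@gronwall _ true K _ M (fun s => `|lam s|)) => // [t It|S S0 hS t It].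
  by rewrite normr_ge0 hM.
apply: norm_le_entries => [|i j].
  by rewrite addr_ge0 // mulr_ge0 // divr_ge0 // expR_ge0.
have [h1 h2] := hlam i; rewrite ord1 h2 //; apply: le_trans (ler_normD _ _) _.
apply: lerD; first exact: hCa.
have i1 : intg (fun t => nu t * wt true K t).
  by apply: sqi_mul => //; apply: sqi_cont; exact: wt_within.
apply: le_trans (Rint_abs_le (g := fun t => S * (nu t * wt true K t)) _ _ _ _ _) _ => //.
- exact: mdir.
- exact: dir_sub.
- exact: intgZ.
- move=> x Ix; apply: le_trans (adj_rhs_bound (C := Cd) _ _ _) _.
    by move=> l m; exact: hCd.
  rewrite -/(nu x) mulrCA; apply: ler_wpM2l; last exact: hS.
  by rewrite /nu !mulr_ge0 ?pnorm_ge0.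
rewrite RintegralZl //; [|exact: mdir|].
  by rewrite ler_wpM2l //; exact: Rint_mul_wt.
exact: (intg_sub (mdir _ _) (dir_sub (b := true) It) i1).
Qed.

End Adjoint.

(** * Pairing the adjoint with trajectory increments *)

Section QuadraticEstimate.
Context {R : realType}.
Local Notation mu := (@lebesgue_measure R).
Local Notation I01 := (`[0%R, 1%R]%classic : set R).

(** The integrand of the integration by parts between lam and d = x_w - x_v. The adjoint equation
    removes the term linear in d; the part linear in h pairs with Fv^T lam, and the rest consists of
    a product of increments and a Taylor remainder of F. *)
Lemma adjoint_identity n k (Fw Fv : 'M[R]_(n, k)) (lam d : 'cV[R]_n) (v h : 'cV[R]_k)
    (A : 'I_n -> 'I_k -> 'I_n -> R) :
  \sum_i (((Fw *m (v + h)) i ord0 - (Fv *m v) i ord0) * lam i ord0 -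
    d i ord0 * \sum_l lam l ord0 * \sum_j A l j i * v j ord0) =
  \sum_j (Fv^T *m lam) j ord0 * h j ord0 +
  \sum_l lam l ord0 * \sum_j ((Fw l j - Fv l j) * h j ord0 +
    (Fw l j - Fv l j - \sum_i A l j i * d i ord0) * v j ord0).
Proof.
have -> : \sum_j (Fv^T *m lam) j ord0 * h j ord0 =
    \sum_l lam l ord0 * \sum_j Fv l j * h j ord0.
  under eq_bigr => j _ do rewrite mxE mulr_suml.
  rewrite exchange_big /=; apply: eq_bigr => l _; rewrite mulr_sumr.
  by apply: eq_bigr => j _; rewrite mxE; ring.
rewrite sumrB.
have -> : \sum_i d i ord0 * (\sum_l lam l ord0 * \sum_j A l j i * v j ord0) =
    \sum_l lam l ord0 * \sum_j (\sum_i A l j i * d i ord0) * v j ord0.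
  under eq_bigr => i _ do rewrite mulr_sumr.
  rewrite exchange_big /=; apply: eq_bigr => l _; rewrite mulr_sumr.
  under eq_bigr => i _ do rewrite mulr_sumr mulr_sumr.
  rewrite exchange_big /=; apply: eq_bigr => j _; rewrite mulr_suml mulr_sumr.
  by apply: eq_bigr => i _; ring.
rewrite -sumrB -big_split; apply: eq_bigr => l _ /=.
rewrite !mxE mulrC -!mulrBr -mulrDr; congr (_ * _).
rewrite -!sumrB -big_split; apply: eq_bigr => j _ /=; rewrite !mxE; ring.
Qed.

Context {n k : nat} (F : 'cV[R]_n -> 'M[R]_(n, k)) (x0 : 'cV[R]_n) (L : R).
Context (L0 : 0 <= L) (lipF : forall x y, `|F x - F y| <= L * `|x - y|).
Context (da : 'I_n -> 'cV[R]_n -> R) (dF : 'I_n -> 'I_k -> 'I_n -> 'cV[R]_n -> R).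
Context (beta : R).
Local Notation X := (traj F x0).
Local Notation adjoint := (adjoint F x0 da dF).

Definition grad (v : R -> 'cV[R]_k) (lam : R -> 'cV[R]_n) (s : R) : 'cV[R]_k :=
  v s + beta *: ((F (X v s))^T *m lam s).

Lemma Ftlam_cont v lam j : inL2 v -> cont01 lam ->
  {within I01, continuous (fun s => ((F (X v s))^T *m lam s) j ord0)}.
Proof.
move=> hv cl; have cx : cont01 (X v) := cont01_traj L0 lipF hv.
have -> : (fun s => ((F (X v s))^T *m lam s) j ord0) =
    (fun s => \sum_l F (X v s) l j * lam s l ord0).
  by apply/funext => s; rewrite mxE; apply: eq_bigr => l _; rewrite mxE.
elim: (index_enum 'I_n) => [|l s IH].
  by under [X in continuous X]eq_fun do rewrite big_nil; exact: within_cont_cst.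
under [X in continuous X]eq_fun do rewrite big_cons.
apply: within_contD => //; apply: within_contM => //.
exact: (cont01_comp cx (F_entry_continuous L0 lipF (i := l) (j := j))).
Qed.

Lemma inL2_Ftlam v lam : inL2 v -> cont01 lam -> inL2 (fun s => (F (X v s))^T *m lam s).
Proof. by move=> hv cl; apply/inL2P => j; apply: sqi_cont; exact: Ftlam_cont. Qed.

Lemma inL2_grad v lam : inL2 v -> cont01 lam -> inL2 (grad v lam).
Proof. by move=> hv cl; apply: inL2D => //; apply: inL2Z; exact: inL2_Ftlam. Qed.

(** Integration by parts in each coordinate moves the derivative of the terminal cost, which sees
    the control only through x(1), to an inner product with w - v. This identifies F(x_v)^T lam as
    the gradient of the terminal cost, up to [err]. *)
Lemma adjoint_pairing v w lam : inL2 v -> inL2 w -> adjoint v lam ->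
  let err s := \sum_l lam s l ord0 * \sum_j
    ((F (X w s) l j - F (X v s) l j) * (w s j ord0 - v s j ord0) +
     (F (X w s) l j - F (X v s) l j -
        \sum_i dF l j i (X v s) * (X w s i ord0 - X v s i ord0)) * v s j ord0) in
  intg err /\
  \sum_i da i (X v 1) * (X w 1 i ord0 - X v 1 i ord0) =
  L2inner (fun s => (F (X v s))^T *m lam s) (fun s => w s - v s) +
  \int[mu]_(s in I01) err s.
Proof.
move=> hv hw [cl hl] err.
pose f i s := (F (X w s) *m w s) i ord0 - (F (X v s) *m v s) i ord0.
pose p i s := X w s i ord0 - X v s i ord0.
pose g i := adj_rhs dF v (X v) lam i.
have fi i : intg (f i).
  by apply: intgB; [exact: (intg_traj x0 L0 lipF i hw) | exact: (intg_traj x0 L0 lipF i hv)].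
have bp i := integration_by_parts_dir (p := p i) (q := fun s => lam s i ord0) (fi i) (hl i).1
   (fun s Is => traj_diff x0 L0 lipF i hv hw Is) (hl i).2.
have e1 : \sum_i da i (X v 1) * (X w 1 i ord0 - X v 1 i ord0) =
    \int[mu]_(s in I01) (\sum_i (f i s * lam s i ord0 - p i s * g i s)).
  rewrite (Rint_sum mI01 (@subset_refl _ _)); last first.
    by move=> i; have [h1 h2 _] := bp i; exact: intgB.
  by apply: eq_bigr => i _; have [_ _ ->] := bp i.
have i1 : intg (fun s => \sum_i (f i s * lam s i ord0 - p i s * g i s)).
  by apply: intg_sum => i; have [h1 h2 _] := bp i; exact: intgB.
have i2 : intg (fun s => \sum_j ((F (X v s))^T *m lam s) j ord0 * (w s - v s) j ord0).
  by apply: intg_inner; [exact: inL2_Ftlam | exact: inL2B].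
have pt s : \sum_i (f i s * lam s i ord0 - p i s * g i s) =
   \sum_j ((F (X v s))^T *m lam s) j ord0 * (w s - v s) j ord0 + err s.
  have := adjoint_identity (F (X w s)) (F (X v s)) (lam s) (X w s - X v s) (v s) (w s - v s)
    (fun l j i => dF l j i (X v s)).
  rewrite [v s + _]addrC subrK.
  have -> : \sum_i (f i s * lam s i ord0 - p i s * g i s) = \sum_i
    (((F (X w s) *m w s) i ord0 - (F (X v s) *m v s) i ord0) * lam s i ord0 -
     (X w s - X v s) i ord0 * \sum_l lam s l ord0 * \sum_j dF l j i (X v s) * v s j ord0).
    by apply: eq_bigr => i _; rewrite /f /p /g /adj_rhs !mxE.
  move=> ->; congr (_ + _); rewrite /err; apply: eq_bigr => l _; congr (_ * _).
  apply: eq_bigr => j _; rewrite !mxE; congr (_ + (_ - _) * _).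
  by apply: eq_bigr => i _; rewrite !mxE.
have i3 : intg err.
  by apply: (intg_ext _ (intgB i1 i2)) => s _ /=; rewrite pt addrAC subrr add0r.
split=> //; rewrite e1 L2innerE -RintegralD //.
by apply: eq_Rintegral => s _; rewrite pt.
Qed.

End QuadraticEstimate.

(** * The quadratic estimate, uniform near a control *)

Section UniformEstimate.
Context {R : realType}.
Local Notation mu := (@lebesgue_measure R).
Local Notation I01 := (`[0%R, 1%R]%classic : set R).

Lemma continuous_locally_bounded n (g : 'cV[R]_n -> R) : continuous g ->
  forall p, exists2 r : R, 0 < r & exists C, forall x, `|x - p| < r -> `|g x| <= C.
Proof.
move=> cg p; have := cg p.
move/(@cvgrPdist_lt _ _ _ (nbhs p) (nbhs_filter p))/(_ 1 ltr01)/nbhs_normP => [r r0 hr].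
exists r => //; exists (`|g p| + 1) => x hx.
rewrite -[g x](subrK (g p)) addrC; apply: le_trans (ler_normD _ _) _.
by rewrite lerD2l distrC ltW //; apply: hr; rewrite /= distrC.
Qed.

Lemma tube_bounded n (z : R -> 'cV[R]_n) (g : 'cV[R]_n -> R) : cont01 z -> continuous g ->
  \forall N \near \oo, forall s, I01 s -> forall x,
    `|x - z s| < N.+1%:R^-1 -> `|g x| <= N%:R.
Proof.
move=> cz cg; have := tube (Q := fun x _ C => `|g x| <= C) cz.
case.
- by move=> x _ C C' CC' /le_trans; apply.
- move=> p; have [r r0 [C hC]] := continuous_locally_bounded cg p.
  by exists r => //; exists C => x y hx _; exact: hC.
by move=> M _ hM; exists M => // N MN s Is x hx; exact: (hM N MN s Is x x).
Qed.

Lemma tube_taylor2 n (z : R -> 'cV[R]_n) (f : 'cV[R]_n -> R) g : cont01 z ->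
  is_gradient_fun f g ->
  \forall N \near \oo, forall s, I01 s -> forall x y,
    `|x - z s| < N.+1%:R^-1 -> `|y - z s| < N.+1%:R^-1 -> taylor2 f g x y N%:R.
Proof.
move=> cz fg; apply: tube => // x y C C' CC' /le_trans; apply.
by rewrite ler_wpM2r // exprn_ge0.
Qed.

Context {n k : nat} (F : 'cV[R]_n -> 'M[R]_(n, k)) (x0 : 'cV[R]_n) (L : R).
Context (L0 : 0 <= L) (lipF : forall x y, `|F x - F y| <= L * `|x - y|).
Context (a : 'cV[R]_n -> R) (da : 'I_n -> 'cV[R]_n -> R).
Context (dF : 'I_n -> 'I_k -> 'I_n -> 'cV[R]_n -> R).
Context (dF_cont : forall l j i, continuous (dF l j i)) (da_cont : forall i, continuous (da i)).
Context (dFP : forall l j, is_gradient_fun (fun x => F x l j) (dF l j)).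
Context (daP : is_gradient_fun a da) (beta : R).
Local Notation X := (traj F x0).
Local Notation adjoint := (adjoint F x0 da dF).
Local Notation Fb := (Fbeta F x0 a beta).
Local Notation grad := (grad F x0 beta).

(** Stability is used twice: from the centre u, to keep all trajectories in a tube around X u where
    the local Taylor bounds are uniform, and then between arbitrary v and w of the ball, to make
    [err] quadratic. *)
Theorem Fbeta_quadratic u : inL2 u -> exists2 rho : R, 0 < rho & exists C : R,
  forall v w lam, inL2 v -> inL2 w -> adjoint v lam ->
    L2norm (fun s => v s - u s) < rho -> L2norm (fun s => w s - u s) < rho ->
    `|Fb w - Fb v - L2inner (grad v lam) (fun s => w s - v s)|
      <= C * L2norm (fun s => w s - v s) ^+ 2.
Proof.
move=> hu; have cu : cont01 (X u) := cont01_traj L0 lipF hu.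
have I1 : I01 1 by rewrite /= in_itv /= ler01 lexx.
have [Cx Cx0 hCx] := cont01_bounded cu.
pose M0 := L * Cx + `|F 0|.
have M00 : 0 <= M0 by rewrite addr_ge0 // mulr_ge0.
have hM0 s : I01 s -> `|F (X u s)| <= M0.
  move=> Is; rewrite -[F (X u s)](subrK (F 0)); apply: le_trans (ler_normD _ _) _.
  rewrite lerD2r; apply: le_trans (lipF _ _) _.
  by rewrite subr0 ler_wpM2l // hCx.
pose N1 := L2norm u + 1.
have N10 : 0 <= N1 by rewrite addr_ge0 // L2norm_ge0.
have near1 : \forall N \near \oo, forall l j s, I01 s -> forall x y,
    `|x - X u s| < N.+1%:R^-1 -> `|y - X u s| < N.+1%:R^-1 ->
    taylor2 (fun x => F x l j) (dF l j) x y N%:R.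
  by apply: filter_forall => l; apply: filter_forall => j; exact: tube_taylor2.
have near2 : \forall N \near \oo, forall l j i s, I01 s -> forall x,
    `|x - X u s| < N.+1%:R^-1 -> `|dF l j i x| <= N%:R.
  apply: filter_forall => l; apply: filter_forall => j; apply: filter_forall => i.
  exact: tube_bounded.
have near3 := tube_taylor2 cu daP.
have near4 : \forall N \near \oo, forall i s, I01 s -> forall x,
    `|x - X u s| < N.+1%:R^-1 -> `|da i x| <= N%:R.
  by apply: filter_forall => i; exact: tube_bounded.
have [N [[h1 h2] [h3 h4]]] := filter_ex (filterI (filterI near1 near2) (filterI near3 near4)).
pose r : R := N.+1%:R^-1; have r0 : 0 < r by rewrite invr_gt0.
pose Nr : R := N%:R; have Nr0 : 0 <= Nr by [].
have stab0 M : 0 <= M -> 0 <= stab_const (k := k) L M N1.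
  by move=> M_ge0; rewrite !mulr_ge0 // expR_ge0.
pose S0 := stab_const (k := k) L M0 N1; have S00 : 0 <= S0 by exact: stab0.
(* The bound 1 keeps the controls in the ball of radius [N1]; the bound [r / (S0 + 1)] keeps the
   trajectories in the tube of radius r. *)
pose rho := Num.min 1 (r / (S0 + 1)).
have S01 : 0 < S0 + 1 by rewrite ltr_wpDl.
exists rho; first by rewrite lt_min ltr01 divr_gt0.
have ball_norm v : inL2 v -> L2norm (fun s => v s - u s) < rho -> L2norm v <= N1.
  move=> hv; rewrite lt_min => /andP[/ltW hv1 _].
  have := L2normD hu (inL2B hv hu); under eq_fun do rewrite addrC subrK.
  by move/le_trans; apply; rewrite lerD2l.
have in_tube v s : inL2 v -> L2norm (fun s => v s - u s) < rho -> I01 s -> `|X v s - X u s| < r.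
  move=> hv hvr Is.
  apply: le_lt_trans (traj_stable L0 lipF hu hv M00 (ball_norm v hv hvr) hM0 Is) _.
  move: hvr; rewrite lt_min => /andP[_]; rewrite ltr_pdivlMr // => hvr.
  apply: le_lt_trans hvr; rewrite mulrC ler_wpM2l ?L2norm_ge0 // lerDl //.
pose M1 := M0 + L * r; have M10 : 0 <= M1 by rewrite addr_ge0 // mulr_ge0 // ltW.
have hM1 v s : inL2 v -> L2norm (fun s => v s - u s) < rho -> I01 s -> `|F (X v s)| <= M1.
  move=> hv hvr Is; rewrite -[F (X v s)](subrK (F (X u s))) /M1 addrC.
  apply: le_trans (ler_normD _ _) _; rewrite lerD ?hM0 //.
  by apply: le_trans (lipF _ _) _; rewrite ler_wpM2l // ltW // in_tube.
(* The second stability constant, based at any v of the ball, since [M1] bounds F along all their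
   trajectories. *)
pose S1 := stab_const (k := k) L M1 N1; have S10 : 0 <= S1 by exact: stab0.
pose Lam := adj_const (n := n) (k := k) Nr Nr N1.
have Lam0 : 0 <= Lam by rewrite !mulr_ge0 // expR_ge0.
(* [c1] belongs to the product of the increments of F and of the control, [c2] to the Taylor
   remainder of F, which multiplies v and so brings in the factor [N1] after integration. *)
pose c1 := n%:R * Lam * k%:R * L * S1; pose c2 := n%:R * Lam * k%:R * Nr * S1 ^+ 2.
have c10 : 0 <= c1 by rewrite !mulr_ge0.
have c20 : 0 <= c2 by rewrite !mulr_ge0 // exprn_ge0.
(* The summands come from half the squared norm of w - v, from the Taylor remainder of [a] at time
   1, and from the integral of [err]. *)
exists (2^-1 + `|beta| * (Nr * S1 ^+ 2 + (c1 + c2 * N1))) => v w lam hv hw hadj hvr hwr.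
pose h s := w s - v s; have hh : inL2 h by exact: inL2B.
pose H := L2norm h; have H0 : 0 <= H by exact: L2norm_ge0.
have dX s : I01 s -> `|X w s - X v s| <= S1 * H.
  by apply: (traj_stable L0 lipF hv hw M10 (ball_norm w hw hwr)) => t It; exact: hM1.
have lamB s : I01 s -> `|lam s| <= Lam.
  apply: (adjoint_bounded hv hadj) => //; last exact: ball_norm.
    by move=> l j i t It; apply: (h2 l j i t It); exact: in_tube.
  by move=> i; apply: (h4 i 1 I1); exact: in_tube.
have [ierr] := adjoint_pairing L0 lipF hv hw hadj.
set err := (X in intg X) in ierr *; move=> pairE.
have i1 : intg (pnorm h) by apply/sqi_intg/sqi_pnorm.
have i2 : intg (pnorm v) by apply/sqi_intg/sqi_pnorm.
have errB s : I01 s -> `|err s| <= c1 * H * pnorm h s + c2 * H ^+ 2 * pnorm v s.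
  move=> Is; apply: le_trans (ler_norm_sum _ _ _) _.
  pose B := L * (S1 * H) * pnorm h s + Nr * (S1 * H) ^+ 2 * pnorm v s.
  apply: (@le_trans _ _ (\sum_(l < n) Lam * (k%:R * B))); last first.
    by rewrite sumr_const card_ord -[leLHS]mulr_natl /B /c1 /c2; apply: le_of_eq; ring.
  apply: ler_sum => l _; rewrite normrM ler_pM //.
    by apply: le_trans (lamB s Is); exact: entry_le_norm.
  apply: le_trans (ler_norm_sum _ _ _) _.
  apply: (@le_trans _ _ (\sum_(j < k) B)); last first.
    by rewrite sumr_const card_ord -[leLHS]mulr_natl.
  apply: ler_sum => j _; apply: le_trans (ler_normD _ _) _; rewrite !normrM /B; apply: lerD.
    apply: ler_pM => //.
      by apply: le_trans (lipF_entry lipF _ _ _ _) _; rewrite ler_wpM2l // dX.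
    by have := entry_le_pnorm h s j; rewrite /h !mxE.
  apply: ler_pM => //; last exact: entry_le_pnorm.
  apply: le_trans (h1 l j s Is (X v s) (X w s) _ _) _; [exact: in_tube | exact: in_tube |].
  by rewrite ler_wpM2l // lerXn2r ?nnegrE ?dX // mulr_ge0.
have errI : `|\int[mu]_(s in I01) err s| <= (c1 + c2 * N1) * H ^+ 2.
  apply: le_trans (Rint_abs_le (g := fun s => c1 * H * pnorm h s + c2 * H ^+ 2 * pnorm v s)
    mI01 (@subset_refl _ _) ierr _ errB) _.
    by apply: intgD; exact: intgZ.
  rewrite RintegralD //; [|exact: (intgZ _ i1)|exact: (intgZ _ i2)].
  rewrite !RintegralZl //.
  rewrite mulrDl; apply: lerD.
    rewrite expr2 mulrA ler_wpM2l ?mulr_ge0 // /H; apply: Rint_pnorm => //; exact: mI01.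
  rewrite [leRHS]mulrAC ler_wpM2l ?mulr_ge0 ?exprn_ge0 //.
  apply: le_trans (Rint_pnorm mI01 (@subset_refl _ _) hv) _; exact: ball_norm.
have aB : `|a (X w 1) - a (X v 1) - \sum_i da i (X v 1) * (X w 1 i ord0 - X v 1 i ord0)|
    <= Nr * S1 ^+ 2 * H ^+ 2.
  apply: le_trans (h3 1 I1 (X v 1) (X w 1) _ _) _; [exact: in_tube | exact: in_tube |].
  by rewrite -mulrA -exprMn ler_wpM2l // lerXn2r ?nnegrE ?dX // mulr_ge0.
have normE : L2norm w ^+ 2 = L2norm v ^+ 2 + 2 * L2inner v h + H ^+ 2.
  rewrite -(L2normD_sqr hv hh); congr (L2norm _ ^+ 2); apply/funext => s.
  by rewrite /h addrC subrK.
have cl : cont01 lam by case: hadj.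
have gradE : L2inner (grad v lam) h = L2inner v h +
    beta * L2inner (fun s => (F (X v s))^T *m lam s) h.
  have hf : inL2 (fun s => (F (X v s))^T *m lam s) by exact: (inL2_Ftlam x0 L0 lipF).
  by rewrite L2innerDl ?L2innerZl //; exact: inL2Z.
rewrite -/h gradE /Fbeta normE -/H.
have -> : 2^-1 * (L2norm v ^+ 2 + 2 * L2inner v h + H ^+ 2) + beta * a (X w 1) -
   (2^-1 * L2norm v ^+ 2 + beta * a (X v 1)) -
   (L2inner v h + beta * L2inner (fun s => (F (X v s))^T *m lam s) h) =
  2^-1 * H ^+ 2 + beta * ((a (X w 1) - a (X v 1) -
    \sum_i da i (X v 1) * (X w 1 i ord0 - X v 1 i ord0)) + \int[mu]_(s in I01) err s).
  by rewrite pairE; field.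
apply: le_trans (ler_normD _ _) _; rewrite [leRHS]mulrDl; apply: lerD.
  by rewrite ger0_norm // mulr_ge0 // exprn_ge0.
rewrite normrM -mulrA ler_wpM2l // mulrDl.
by apply: le_trans (ler_normD _ _) _; exact: lerD.
Qed.

Lemma quadratic_is_gradient u g rho C : inL2 u -> inL2 g -> 0 < rho ->
  (forall w, inL2 w -> L2norm (fun s => w s - u s) < rho ->
    `|Fb w - Fb u - L2inner g (fun s => w s - u s)| <= C * L2norm (fun s => w s - u s) ^+ 2) ->
  is_gradient F x0 a beta u g.
Proof.
move=> hu hg r0 hq; split => // e e0.
have C1 : 0 < `|C| + 1 by rewrite ltr_wpDl.
exists (Num.min rho (e / (`|C| + 1))); first by rewrite lt_min r0 divr_gt0.
move=> h hh; rewrite lt_min => /andP[hr he].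
have E : (fun s => (u \+ h) s - u s) = h.
  by apply/funext => s /=; rewrite addrC addKr.
have := hq (u \+ h) (inL2D hu hh); rewrite E => /(_ hr) /le_trans; apply.
rewrite expr2 mulrA ler_wpM2r ?L2norm_ge0 //.
apply: (@le_trans _ _ ((`|C| + 1) * L2norm h)).
  by rewrite ler_wpM2r ?L2norm_ge0 // (le_trans (ler_norm _)) // lerDl.
by rewrite mulrC -ler_pdivlMr // ltW.
Qed.

End UniformEstimate.

(** * The gradient flow *)

Section Flow.
Context {R : realType}.
Local Notation mu := (@lebesgue_measure R).

Lemma is_derive_nearP (f : R -> R) (t l : R) : is_derive t 1 f l <->
  forall e : R, 0 < e -> \forall h \near 0^', `|h^-1 * (f (t + h) - f t) - l| <= e.
Proof.
have E : (fun h : R => h^-1 *: ((f \o shift t) (h *: (1 : R)) - f t)) =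
    (fun h => h^-1 * (f (t + h) - f t)).
  apply/funext => h; rewrite /= /GRing.scale /= mulr1.
  by rewrite [t + h]addrC.
split=> [[df fl] e e0|H].
  have : (fun h => h^-1 * (f (t + h) - f t)) @ 0^' --> l by rewrite -E -fl.
  by move/cvgrPdist_le/(_ e e0); apply: filterS => h hh; rewrite distrC; exact: hh.
have hc : (fun h : R => h^-1 *: ((f \o shift t) (h *: (1 : R)) - f t)) @ 0^' --> l.
  rewrite E; apply/cvgrPdist_le => e e0.
  by apply: filterS (H e e0) => h hh; rewrite distrC; exact: hh.
by split; [exact: cvgP hc | exact: cvg_lim hc].
Qed.

Lemma is_derive_eps (f : R -> R) (t l : R) :
  (forall e, 0 < e -> exists2 d, 0 < d & forall h, h != 0 -> `|h| < d ->
     `|h^-1 * (f (t + h) - f t) - l| <= e) -> is_derive t 1 f l.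
Proof.
move=> H; apply/is_derive_nearP => e e0; have [d d0 hd] := H e e0.
near=> h; apply: hd; first by near: h; exact: nbhs_dnbhs_neq.
by near: h; exact: dnbhs0_lt.
Unshelve. all: by end_near. Qed.

(** At time 0 the flow has only a one-sided derivative, so the calculus along it takes place at
    positive times. *)
Lemma MVT_pos (f f' : R -> R) (s T : R) : (forall t : R, 0 < t -> is_derive t 1 f (f' t)) ->
  0 < s -> s < T -> exists2 c, s < c < T & f T - f s = f' c * (T - s).
Proof.
move=> hf s0 sT; have [||c] := @MVT _ f f' s T sT.
- by move=> c; rewrite in_itv /= => /andP[sc _]; apply: hf; exact: lt_trans sc.
- apply: derivable_within_continuous => c; rewrite in_itv /= => /andP[sc _].
  by have [] := hf c (lt_le_trans s0 sc).
by rewrite in_itv /= => hc ->; exists c.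
Qed.

Context {n k : nat} (F : 'cV[R]_n -> 'M[R]_(n, k)) (x0 : 'cV[R]_n) (a : 'cV[R]_n -> R) (beta : R).
Local Notation Fb := (Fbeta F x0 a beta).
Implicit Types (u g : R -> 'cV[R]_k).

(** Testing both expansions on a small multiple of d = g - g' bounds |d|^2 by |d|^2 / 2. Controls
    are functions, not classes, so the conclusion is a vanishing norm; [t] is scaled to make h half
    the admissible radius. *)
Lemma is_gradient_unique u g g' : is_gradient F x0 a beta u g -> is_gradient F x0 a beta u g' ->
  L2norm (fun s => g s - g' s) = 0.
Proof.
move=> [hg H] [hg' H']; set d := fun s => g s - g' s.
have hd : inL2 d by exact: inL2B.
apply/eqP; rewrite eq_le L2norm_ge0 andbT leNgt; apply/negP => N0.
set N := L2norm d in N0.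
have N4 : 0 < N / 4 by rewrite divr_gt0.
have [e1 e10 h1] := H _ N4; have [e2 e20 h2] := H' _ N4.
pose t := Num.min e1 e2 / (2 * N).
have e0 : 0 < Num.min e1 e2 by rewrite lt_min e10.
have t0 : 0 < t by rewrite divr_gt0 // mulr_gt0.
pose h s := t *: d s; have hh : inL2 h by exact: inL2Z.
have hn : L2norm h = Num.min e1 e2 / 2.
  by rewrite L2normZ // gtr0_norm // -/N /t; field; exact: lt0r_neq0.
have lt_h : L2norm h < Num.min e1 e2 by rewrite hn; lra.
move: (lt_h); rewrite lt_min => /andP[l1 l2].
have := h1 h hh l1; have := h2 h hh l2.
set P := _ - Fb u => b2 b1.
have : `|L2inner d h| <= N / 2 * L2norm h.
  rewrite L2innerBl //.
  have -> : L2inner g h - L2inner g' h = (P - L2inner g' h) - (P - L2inner g h) by ring.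
  by apply: le_trans (ler_normB _ _) _; apply: le_trans (lerD b2 b1) _; apply: le_of_eq; field.
rewrite L2innerZr // -L2norm_sqrE L2normZ // -/N normrM gtr0_norm // ger0_norm ?sqr_ge0 //.
have tN : 0 < t * N by exact: mulr_gt0.
rewrite mulrCA (ler_pM2r tN) => hN; move: N0; lra.
Qed.

Context (U G : R -> R -> 'cV[R]_k).
Context (hU : forall t : R, 0 <= t -> inL2 (U t)).
Context (hG : forall t : R, 0 <= t -> is_gradient F x0 a beta (U t) (G t)).
Context (flow : forall t : R, 0 <= t -> forall eps : R, 0 < eps -> exists2 delta : R, 0 < delta &
  forall h : R, h != 0 -> `|h| < delta -> 0 <= t + h ->
    L2norm (fun s => h^-1 *: (U (t + h) s - U t s) + G t s) <= eps).

Lemma inL2_G (t : R) : 0 <= t -> inL2 (G t). Proof. by move=> /hG []. Qed.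

Lemma flow_pos (t : R) : 0 < t -> forall eps : R, 0 < eps -> exists2 delta : R, 0 < delta &
  forall h : R, h != 0 -> `|h| < delta -> 0 <= t + h /\
    L2norm (fun s => h^-1 *: (U (t + h) s - U t s) + G t s) <= eps.
Proof.
move=> t0 e e0; have [d d0 hd] := flow (ltW t0) e0.
exists (Num.min d t); first by rewrite lt_min d0.
move=> h hn0; rewrite lt_min => /andP[h1 h2].
have th : 0 <= t + h by move: h2; rewrite ltr_norml => /andP[]; lra.
by split => //; exact: hd.
Qed.

Lemma inner_derive (e : R -> 'cV[R]_k) (t : R) : inL2 e -> 0 < t ->
  is_derive t 1 (fun t => L2inner (U t) e) (- L2inner (G t) e).
Proof.
move=> he t0; have t0' := ltW t0; apply: is_derive_eps => eps eps0.
have N0 : 0 < L2norm e + 1 by rewrite ltr_wpDl // L2norm_ge0.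
have [d d0 hd] := flow_pos t0 (divr_gt0 eps0 N0).
exists d => // h hn0 hl; have [th hb] := hd h hn0 hl.
have h1 := hU th; have h2 := hU t0'; have h3 := inL2_G t0'.
have h4 := inL2Z h^-1 (inL2B h1 h2).
have -> : h^-1 * (L2inner (U (t + h)) e - L2inner (U t) e) - - L2inner (G t) e =
   L2inner (fun s => h^-1 *: (U (t + h) s - U t s) + G t s) e.
  by rewrite L2innerDl // L2innerZl ?L2innerBl ?opprK //; exact: inL2B.
apply: le_trans (L2_CS (inL2D h4 h3) he) _.
apply: (@le_trans _ _ (eps / (L2norm e + 1) * (L2norm e + 1))); last by rewrite divfK // lt0r_neq0.
by apply: ler_pM; rewrite ?L2norm_ge0 // lerDl.
Qed.

Lemma energy_derive (t : R) : 0 < t ->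
  is_derive t 1 (fun t => Fb (U t)) (- L2norm (G t) ^+ 2).
Proof.
move=> t0; have t0' := ltW t0; apply: is_derive_eps => e e0.
set N := L2norm (G t); have N0 : 0 <= N by exact: L2norm_ge0.
(* The cap 1 bounds the difference quotient q by N + 1. The errors of the expansion of [Fb] and of
   the flow are ep (N + 1) and N ep, together below ep (2 N + 2) <= e. *)
pose ep := Num.min 1 (e / (2 * N + 2)).
have ep0 : 0 < ep by rewrite lt_min ltr01 divr_gt0 // ltr_wpDl // mulr_ge0.
have [hGt grd] := hG t0'.
have [d1 d10 h1] := grd _ ep0.
have [d2 d20 h2] := flow_pos t0 ep0.
have N1 : 0 < N + 1 by rewrite ltr_wpDl.
exists (Num.min d2 (d1 / (N + 1))); first by rewrite lt_min d20 divr_gt0.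
move=> h hn0; rewrite lt_min => /andP[l2 l1].
have [th hb] := h2 h hn0 l2.
have i1 := hU th; have i2 := hU t0'; have i3 := inL2B i1 i2.
pose D s := U (t + h) s - U t s; pose q s := h^-1 *: D s.
have iq : inL2 q by exact: inL2Z.
have ep1 : ep <= 1 by rewrite ge_min lexx.
have qN : L2norm q <= N + ep.
  have := L2normB (inL2D iq hGt) hGt.
  under eq_fun do rewrite addrK.
  by move/le_trans; apply; rewrite addrC lerD2l.
have DN : L2norm D = `|h| * L2norm q.
  by rewrite /q L2normZ // normfV mulVKf // normr_eq0.
have Dd : L2norm D < d1.
  rewrite DN; apply: le_lt_trans (_ : `|h| * (N + 1) < d1); last by rewrite -ltr_pdivlMr.
  by rewrite ler_wpM2l // (le_trans qN) // lerD2l.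
have := h1 D i3 Dd.
have -> : U t \+ D = U (t + h) by apply/funext => s /=; rewrite /D addrC subrK.
move=> hh.
have e1 : L2inner (G t) D = h * L2inner (G t) q by rewrite L2innerZr // mulVKf.
have e2 : L2inner (G t) q + N ^+ 2 = L2inner (G t) (fun s => q s + G t s).
  by rewrite L2innerDr // L2norm_sqrE.
have e3 : `|L2inner (G t) q + N ^+ 2| <= N * ep.
  by rewrite e2; apply: le_trans (L2_CS hGt (inL2D iq hGt)) _; rewrite ler_wpM2l.
have -> : h^-1 * (Fb (U (t + h)) - Fb (U t)) - - N ^+ 2 =
   h^-1 * (Fb (U (t + h)) - Fb (U t) - L2inner (G t) D) + (L2inner (G t) q + N ^+ 2).
  by rewrite e1; move: (Fb _) (Fb _) (L2inner _ _) => p1 p2 p3; field.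
apply: le_trans (ler_normD _ _) _.
have e4 : `|h^-1 * (Fb (U (t + h)) - Fb (U t) - L2inner (G t) D)| <= ep * (N + 1).
  rewrite normrM normfV mulrC ler_pdivrMr ?normr_gt0 //; apply: le_trans hh _.
  rewrite DN mulrCA [leRHS]mulrC ler_wpM2l //.
  by rewrite ler_wpM2l ?(ltW ep0) // (le_trans qN) // lerD2l.
apply: le_trans (lerD e4 e3) _.
have -> : ep * (N + 1) + N * ep = ep * (2 * N + 1) by ring.
have ep2 : ep * (2 * N + 2) <= e.
  by rewrite -ler_pdivlMr ?ge_min ?lexx ?orbT // ltr_wpDl // mulr_ge0.
by apply: le_trans ep2; rewrite ler_wpM2l ?(ltW ep0) // lerD2l ler1n.
Qed.

(** With D = U T - U s and d its norm, the mean value theorem is applied to the scalar function <U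
    t, D> + c Fb(U t). Its derivative is at most |G| d - c |G|^2, and Young's inequality |G| <=
    |G|^2 / (2 eta) + eta / 2 makes this at most d eta / 2 for c = d / (2 eta). Displacement is thus
    bounded by dissipated energy without integrating an L^2-valued curve. *)
Lemma flow_distance (s T eta : R) : 0 < s -> s < T -> 0 < eta ->
  L2norm (fun x => U T x - U s x) <= (Fb (U s) - Fb (U T)) / (2 * eta) + eta / 2 * (T - s).
Proof.
move=> s0 sT eta0; have T0 := lt_trans s0 sT.
pose D x := U T x - U s x.
have iT := hU (ltW T0); have is_ := hU (ltW s0).
have iD : inL2 D by exact: inL2B.
set d := L2norm D; have d0 : 0 <= d by exact: L2norm_ge0.
pose c := d / (2 * eta).
have c0 : 0 <= c by rewrite divr_ge0 // mulr_ge0 // ltW.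
have der (t : R) : 0 < t -> is_derive t 1 (fun t => L2inner (U t) D + c * Fb (U t))
    (- L2inner (G t) D + c * (- L2norm (G t) ^+ 2)).
  move=> t0; apply: is_deriveD; first exact: inner_derive.
  by apply: is_deriveZ; exact: energy_derive.
have [x /andP[sx xT] hx] := MVT_pos der s0 sT.
have iG : inL2 (G x) by apply: inL2_G; exact: ltW (lt_trans s0 sx).
have b1 : - L2inner (G x) D <= L2norm (G x) * d.
  by apply: le_trans (L2_CS iG iD); rewrite -normrN ler_norm.
have b2 : - L2inner (G x) D + c * (- L2norm (G x) ^+ 2) <= d * (eta / 2).
  have : 0 <= c * (L2norm (G x) - eta) ^+ 2 by rewrite mulr_ge0 // sqr_ge0.
  have -> : c * (L2norm (G x) - eta) ^+ 2 =
    c * L2norm (G x) ^+ 2 - L2norm (G x) * d + d * (eta / 2).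
    by rewrite /c; field; exact: lt0r_neq0.
  move: b1; move: (L2inner _ _) (L2norm _) => p1 p2; lra.
have b3 : d ^+ 2 <= c * (Fb (U s) - Fb (U T)) + d * (eta / 2) * (T - s).
  have e1 : d ^+ 2 = L2inner (U T) D - L2inner (U s) D.
    by rewrite L2norm_sqrE L2innerBl.
  rewrite e1 -lerBlDl.
  have -> : L2inner (U T) D - L2inner (U s) D - c * (Fb (U s) - Fb (U T)) =
    L2inner (U T) D + c * Fb (U T) - (L2inner (U s) D + c * Fb (U s)).
    by move: (Fb _) (Fb _) (L2inner _ _) (L2inner _ _) => p1 p2 p3 p4; ring.
  by rewrite hx ler_wpM2r // subr_ge0 ltW.
(* The estimate is divided by d. If d = 0, the claim reduces to a nonnegative right-hand side, that
   is, to the decrease of the energy. *)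
move: d0; rewrite le_eqVlt => /predU1P[d_eq0|dp].
  have [y /andP[sy _] hy] := MVT_pos energy_derive s0 sT.
  have h1 : 0 <= Fb (U s) - Fb (U T).
    rewrite subr_ge0 -subr_le0 hy mulNr oppr_le0 mulr_ge0 ?sqr_ge0 //.
    by rewrite subr_ge0 ltW.
  have e0 := ltW eta0; have sT0 : 0 <= T - s by rewrite subr_ge0 ltW.
  rewrite -/d -d_eq0; apply: addr_ge0; first by rewrite divr_ge0 // mulr_ge0.
  by rewrite mulr_ge0 // divr_ge0.
rewrite -(ler_pM2l dp) -expr2 -/d; apply: le_trans b3 _.
by move: (Fb _ - Fb _) => p; rewrite /c; apply: le_of_eq; field; exact: lt0r_neq0.
Qed.

Context (Fb_ge0 : forall u, 0 <= Fb u).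

Lemma energy_nonincreasing (s T : R) : 0 < s -> s <= T -> Fb (U T) <= Fb (U s).
Proof.
move=> s0; rewrite le_eqVlt => /predU1P[->//|sT].
have [y /andP[sy _] hy] := MVT_pos energy_derive s0 sT.
by rewrite -subr_le0 hy mulNr oppr_le0 mulr_ge0 ?sqr_ge0 // subr_ge0 ltW.
Qed.

Lemma energy_stabilizes (kappa : R) : 0 < kappa -> exists2 T0 : R, 0 < T0 &
  forall s T : R, T0 <= s -> s <= T -> Fb (U s) - Fb (U T) <= kappa.
Proof.
move=> kp; pose A := [set Fb (U t) | t in [set t : R | 0 < t]].
have infA : has_inf A.
  split; first by exists (Fb (U 1)); exists 1 => //=.
  by exists 0 => _ [t _ <-].
have [_ [t t0 <-] ht] := inf_adherent kp infA.
exists t => // s T ts sT.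
have s0 := lt_le_trans t0 ts; have T0 := lt_le_trans s0 sT.
have h1 := energy_nonincreasing t0 ts.
have h2 : inf A <= Fb (U T) by apply: (inf_lbound infA.2); exists T.
move: h1 h2 ht; move: (Fb _) (Fb _) (Fb _) (inf A) => p1 p2 p3 p4; lra.
Qed.

Lemma approximate_critical (uinf : R -> 'cV[R]_k) (tj : nat -> R) (e : R) :
  inL2 uinf -> tj @ \oo --> +oo ->
  (fun j => L2norm (fun s => U (tj j) s - uinf s)) @ \oo --> 0 -> 0 < e ->
  exists v g, [/\ inL2 v, is_gradient F x0 a beta v g,
    L2norm (fun s => v s - uinf s) <= e & L2norm g <= e].
Proof.
move=> hu tjoo cvj e0.
(* With eta = e / 2, an energy drop of at most e^2 / 4 on a window of length 1 moves the flow by at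
   most e / 4 + e / 4, and [tj j] is within e / 2 of [uinf]. The unit length also makes the squared
   norm of [G x] equal to that drop at the mean value time x. *)
have k0 : 0 < e ^+ 2 / 4 by rewrite divr_gt0 // exprn_gt0.
have [T0 T00 hT0] := energy_stabilizes k0.
have e2 : 0 < e / 2 by rewrite divr_gt0.
have near1 : \forall j \near \oo, T0 <= tj j by exact: (cvgryPge _).1 tjoo T0.
have near2 : \forall j \near \oo, L2norm (fun s => U (tj j) s - uinf s) <= e / 2.
  exact: (cvgr_le _ cvj).
have [j [h1 h2]] := filter_ex (filterI near1 near2).
have t0 : 0 < tj j by exact: lt_le_trans h1.
have t1 : tj j < tj j + 1 by rewrite ltrDl.
have [x /andP[jx x1] hx] := MVT_pos energy_derive t0 t1.
have xp : 0 < x by exact: lt_trans jx.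
exists (U x), (G x); split.
- by apply: hU; exact: ltW.
- by apply: hG; exact: ltW.
- have i1 := hU (ltW xp); have i2 := hU (ltW t0).
  have := L2normD (inL2B i1 i2) (inL2B i2 hu).
  under eq_fun do rewrite subrKA.
  move/le_trans; apply.
  have := flow_distance t0 jx e2.
  have h3 := hT0 _ _ h1 (ltW jx).
  have h4 : (Fb (U (tj j)) - Fb (U x)) / (2 * (e / 2)) <= e / 4.
    rewrite ler_pdivrMr ?mulr_gt0 //; by apply: le_trans h3 _; apply: le_of_eq; field.
  have h5 : e / 2 / 2 * (x - tj j) <= e / 4.
    have : e * (x - tj j) <= e * 1 by rewrite ler_wpM2l ?(ltW e0) // lerBlDl ltW.
    lra.
  move: h2 h4 h5; move: ((_ - _) / (2 * (e / 2))) (e / 2 / 2 * _) (L2norm _) (L2norm _).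
  move=> p1 p2 p3 p4; lra.
- have h3 := hT0 _ _ h1 (ltW t1).
  have : L2norm (G x) ^+ 2 <= e ^+ 2.
    have : L2norm (G x) ^+ 2 = Fb (U (tj j)) - Fb (U (tj j + 1)).
      have e1 : tj j + 1 - tj j = 1 by ring.
      by move: hx; rewrite e1 mulr1 => /(congr1 -%R); rewrite opprK opprB => <-.
    by move=> ->; apply: le_trans h3 _; rewrite ler_pdivrMr // ler_peMr ?sqr_ge0 ?ler1n.
  by rewrite ler_sqr ?nnegrE ?L2norm_ge0 // ltW.
Qed.

End Flow.

(** * From almost critical points to a critical limit *)

Section Critical.
Context {R : realType}.
Context {n k : nat} (F : 'cV[R]_n -> 'M[R]_(n, k)) (x0 : 'cV[R]_n) (L : R).
Context (L0 : 0 <= L) (lipF : forall x y, `|F x - F y| <= L * `|x - y|).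
Context (a : 'cV[R]_n -> R) (da : 'I_n -> 'cV[R]_n -> R).
Context (dF : 'I_n -> 'I_k -> 'I_n -> 'cV[R]_n -> R).
Context (dF_cont : forall l j i, continuous (dF l j i)) (da_cont : forall i, continuous (da i)).
Context (dFP : forall l j, is_gradient_fun (fun x => F x l j) (dF l j)).
Context (daP : is_gradient_fun a da) (beta : R).
Local Notation adjoint := (adjoint F x0 da dF).
Local Notation Fb := (Fbeta F x0 a beta).
Local Notation grad := (grad F x0 beta).

(** For fixed w, the values Fb w and Fb u are both compared with Fb v, and v tends to u. The
    abstract gradient at v is first identified with [grad v lam] by uniqueness; the same argument at
    u makes [grad u lam] vanish. *)
Lemma critical_of_approximate (u : R -> 'cV[R]_k) : inL2 u ->
  (forall e : R, 0 < e -> exists v g, [/\ inL2 v, is_gradient F x0 a beta v g,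
    L2norm (fun s => v s - u s) <= e & L2norm g <= e]) ->
  is_gradient F x0 a beta u (fun=> 0) /\
  forall lam, adjoint u lam -> L2norm (grad u lam) = 0.
Proof.
move=> hu happ.
have [rho r0 [C hC]] := Fbeta_quadratic x0 L0 lipF dF_cont da_cont dFP daP beta hu.
have u_u : L2norm (fun s => u s - u s) < rho.
  have -> : (fun s => u s - u s) = (fun s => 0 *: u s).
    by apply/funext => s; rewrite subrr scale0r.
  by rewrite L2normZ // normr0 mul0r.
have flat w : inL2 w -> L2norm (fun s => w s - u s) < rho ->
    `|Fb w - Fb u| <= `|C| * L2norm (fun s => w s - u s) ^+ 2.
  move=> hw hwr; set H := L2norm _ in hwr *.
  have H0 : 0 <= H by exact: L2norm_ge0.
  (* Since e <= 1, every term of the error other than |C| H^2 is at most a multiple of e; [K] adds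
     up these multiples. *)
  pose K := H + 1 + `|C| * (2 * H + 1) + 1 + `|C|.
  have K0 : 0 < K.
    have : 0 <= `|C| * (2 * H + 1) by rewrite mulr_ge0 // addr_ge0 // mulr_ge0.
    have : 0 <= `|C| by []. rewrite /K; lra.
  apply/ler_addgt0Pr => d d0.
  pose e := Num.min 1 (Num.min (rho / 2) (d / K)).
  have e0 : 0 < e by rewrite !lt_min ltr01 !divr_gt0.
  have e1 : e <= 1 by rewrite ge_min lexx.
  have e2 : e < rho.
    by apply: (@le_lt_trans _ _ (rho / 2)); [rewrite /e !ge_min lexx orbT | lra].
  have e3 : e * K <= d by rewrite -ler_pdivlMr // /e !ge_min lexx !orbT.
  have [v [g [hv [hg gv] vu gn]]] := happ e e0.
  have vr : L2norm (fun s => v s - u s) < rho by exact: le_lt_trans e2.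
  have [lam hlam] := adjoint_exists x0 L0 lipF da dF_cont hv.
  have ig : inL2 (grad v lam) by apply: (inL2_grad x0 L0 lipF) => //; case: hlam.
  have gv' : is_gradient F x0 a beta v (grad v lam).
    (* The estimate holds in a ball around u; a ball of this radius around v stays inside it. *)
    have r1 : 0 < rho - L2norm (fun s => v s - u s) by rewrite subr_gt0.
    apply: (quadratic_is_gradient (C := C) hv ig r1) => z hz; rewrite ltrBrDr => zr.
    apply: hC => //; apply: le_lt_trans zr.
    have := L2normD (inL2B hz hv) (inL2B hv hu).
    by under eq_fun do rewrite subrKA.
  have gg : L2norm (fun s => grad v lam s - g s) = 0 by exact: (is_gradient_unique gv').
  have Gn : L2norm (grad v lam) <= e.
    have := L2normD (inL2B ig hg) hg; under eq_fun do rewrite subrK.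
    by rewrite gg add0r => /le_trans; apply.
  have est z b : inL2 z -> L2norm (fun s => z s - u s) < rho ->
      L2norm (fun s => z s - v s) <= b -> `|Fb z - Fb v| <= e * b + `|C| * b ^+ 2.
    move=> hz hzr zb; have b0 := le_trans (L2norm_ge0 _) zb.
    rewrite -[Fb z - Fb v](subrK (L2inner (grad v lam) (fun s => z s - v s))).
    apply: le_trans (ler_normD _ _) _; rewrite addrC; apply: lerD.
      apply: le_trans (L2_CS ig (inL2B hz hv)) _.
      by apply: ler_pM; [exact: L2norm_ge0 | exact: L2norm_ge0 | exact: Gn | exact: zb].
    apply: le_trans (hC v z lam hv hz hlam vr hzr) _.
    apply: (@le_trans _ _ (`|C| * L2norm (fun s => z s - v s) ^+ 2)).
      by rewrite ler_wpM2r ?sqr_ge0 // ler_norm.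
    by rewrite ler_wpM2l // lerXn2r ?nnegrE // L2norm_ge0.
  have b1 : `|Fb w - Fb v| <= e * (H + e) + `|C| * (H + e) ^+ 2.
    apply: est => //.
    have := L2normB (inL2B hw hu) (inL2B hv hu).
    under eq_fun do rewrite opprB subrKA.
    by move/le_trans; apply; rewrite lerD2l.
  have b2 : `|Fb u - Fb v| <= e * e + `|C| * e ^+ 2.
    by apply: (est u e hu u_u); rewrite L2norm_distC.
  have -> : Fb w - Fb u = (Fb w - Fb v) - (Fb u - Fb v) by rewrite opprB subrKA.
  apply: le_trans (ler_normB _ _) _; apply: le_trans (lerD b1 b2) _.
  have e5 : e ^+ 2 <= e by rewrite expr2 ler_piMl // ltW.
  have e6 : `|C| * e ^+ 2 <= `|C| * e by rewrite ler_wpM2l.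
  apply: le_trans (_ : `|C| * H ^+ 2 + e * K <= _); last by rewrite lerD2l.
  rewrite -subr_ge0; have -> : `|C| * H ^+ 2 + e * K -
    (e * (H + e) + `|C| * (H + e) ^+ 2 + (e * e + `|C| * e ^+ 2)) =
    2 * (e - e ^+ 2) + 2 * (`|C| * e - `|C| * e ^+ 2) by rewrite /K; ring.
  by rewrite addr_ge0 // mulr_ge0 // subr_ge0.
have g0 : is_gradient F x0 a beta u (fun=> 0).
  apply: (quadratic_is_gradient (C := `|C|) hu (@inL2_0 _ _) r0) => w hw hwr.
  have -> : L2inner (fun=> 0) (fun s => w s - u s) = 0.
    have -> : (fun=> 0) = (fun s => 0 *: u s) by apply/funext => s; rewrite scale0r.
    by rewrite L2innerZl ?mul0r //; exact: inL2B.
  by rewrite subr0; exact: flat.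
split=> // lam hlam.
have ig : inL2 (grad u lam) by apply: (inL2_grad x0 L0 lipF) => //; case: hlam.
have g1 : is_gradient F x0 a beta u (grad u lam).
  apply: (quadratic_is_gradient (C := C) hu ig r0) => w hw hwr; exact: hC.
have := is_gradient_unique g1 g0.
by under eq_fun do rewrite subr0.
Qed.

End Critical.

(** * Regularity of critical points *)

Section Smooth.
Context {R : realType}.
Local Notation mu := (@lebesgue_measure R).
Local Notation I01 := (`[0%R, 1%R]%classic : set R).

Lemma is_derive_comp n (f : 'cV[R]_n -> R) (g : 'I_n -> 'cV[R]_n -> R)
    (x : R -> 'cV[R]_n) (x' : 'I_n -> R) (t : R) : is_gradient_fun f g ->
  (forall l, is_derive t 1 (fun s => x s l ord0) (x' l)) ->
  is_derive t 1 (fun s => f (x s)) (\sum_l g l (x t) * x' l).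
Proof.
move=> fg hx; have [r r0 [C hC]] := fg (x t).
(* [K] bounds the difference quotients of x, the added 1 absorbing the error e1 <= 1. *)
pose B := \sum_l `|g l (x t)|; pose K := \sum_l `|x' l| + 1.
have B0 : 0 <= B by apply: sumr_ge0.
have S0 : 0 <= \sum_l `|x' l| by apply: sumr_ge0.
have K0 : 0 < K by rewrite ltr_wpDl.
have C0 : 0 < `|C| * K ^+ 2 + 1 by rewrite ltr_wpDl // mulr_ge0 // sqr_ge0.
apply/is_derive_nearP => e e0.
pose e1 := Num.min 1 (e / (2 * (B + 1))).
have e10 : 0 < e1 by rewrite lt_min ltr01 divr_gt0 // mulr_gt0 // ltr_wpDl.
have nq : \forall h \near 0^', forall l,
    `|h^-1 * (x (t + h) l ord0 - x t l ord0) - x' l| <= e1.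
  by apply: filter_forall => l; exact: (is_derive_nearP _ _ _).1 (hx l) e1 e10.
have rK : 0 < r / K by rewrite divr_gt0.
have eC : 0 < e / (2 * (`|C| * K ^+ 2 + 1)) by rewrite divr_gt0 // mulr_gt0.
near=> h.
have hn0 : h != 0 by near: h; exact: nbhs_dnbhs_neq.
have h1 : `|h| < r / K by near: h; exact: dnbhs0_lt.
have h2 : `|h| < e / (2 * (`|C| * K ^+ 2 + 1)) by near: h; exact: dnbhs0_lt.
have hq : forall l, `|h^-1 * (x (t + h) l ord0 - x t l ord0) - x' l| <= e1 by near: h.
have hp : 0 < `|h| by rewrite normr_gt0.
have dx : `|x (t + h) - x t| <= K * `|h|.
  apply: norm_le_entries => [|l j]; first by rewrite mulr_ge0 // ltW.
  rewrite ord1 !mxE -ler_pdivrMr // -normfV mulrC -normrM.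
  rewrite -[_ * _](subrK (x' l)); apply: le_trans (ler_normD _ _) _.
  rewrite /K [leLHS]addrC; apply: lerD; first by rewrite (bigD1 l) //= lerDl sumr_ge0.
  by apply: le_trans (hq l) _; rewrite ge_min lexx.
have dr : `|x (t + h) - x t| < r.
  by apply: le_lt_trans dx _; rewrite mulrC -ltr_pdivlMr.
have := hC (x t) (x (t + h)) _ dr; rewrite subrr normr0 => /(_ r0).
rewrite /taylor2; set P := _ - \sum_l _ => hP.
have -> : h^-1 * (f (x (t + h)) - f (x t)) - \sum_l g l (x t) * x' l =
  h^-1 * P + \sum_l g l (x t) * (h^-1 * (x (t + h) l ord0 - x t l ord0) - x' l).
  under [in RHS]eq_bigr => l _ do rewrite mulrBr mulrCA.
  rewrite sumrB -mulr_sumr /P; ring.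
apply: le_trans (ler_normD _ _) _; rewrite [leRHS](splitr e); apply: lerD.
  rewrite normrM normfV mulrC ler_pdivrMr //; apply: le_trans hP _.
  apply: (@le_trans _ _ (`|C| * (K * `|h|) ^+ 2)).
    apply: le_trans (ler_wpM2r (sqr_ge0 _) (ler_norm C)) _.
    by rewrite ler_wpM2l // lerXn2r ?nnegrE // mulr_ge0 // ltW.
  rewrite (_ : `|C| * _ = `|C| * K ^+ 2 * `|h| * `|h|); last by ring.
  rewrite ler_wpM2r //.
  move: h2; rewrite ltr_pdivlMr ?mulr_gt0 // => h2.
  have : 0 <= `|h| by []. have : 0 <= `|C| * K ^+ 2 by rewrite mulr_ge0 // sqr_ge0.
  move: (`|C| * K ^+ 2) h2 => c h2 c0 hh; lra.
apply: le_trans (ler_norm_sum _ _ _) _.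
apply: (@le_trans _ _ (\sum_l `|g l (x t)| * e1)).
  by apply: ler_sum => l _; rewrite normrM ler_wpM2l.
rewrite -mulr_suml -/B.
have B1 : 0 < 2 * (B + 1) by rewrite mulr_gt0 // ltr_wpDl.
have : e1 * (2 * (B + 1)) <= e by rewrite -ler_pdivlMr // ge_min lexx orbT.
lra.
Unshelve. all: by end_near. Qed.

(** The algebra generated by the analytic functions of x and the coordinates of lam. It is closed
    under differentiation as soon as it contains the derivatives of x and lam, so induction on its
    syntax replaces regularity theory for the system. *)
Inductive smooth n (x lam : R -> 'cV[R]_n) : (R -> R) -> Prop :=
| smooth_cst c : smooth x lam (fun=> c)
| smooth_fun f : real_analytic f -> smooth x lam (fun s => f (x s))
| smooth_lam i : smooth x lam (fun s => lam s i ord0)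
| smooth_add f g : smooth x lam f -> smooth x lam g -> smooth x lam (fun s => f s + g s)
| smooth_mul f g : smooth x lam f -> smooth x lam g -> smooth x lam (fun s => f s * g s).

Lemma smooth_sum n (x lam : R -> 'cV[R]_n) (I : finType) (f : I -> R -> R) :
  (forall i, smooth x lam (f i)) -> smooth x lam (fun s => \sum_i f i s).
Proof.
move=> hf; elim: (index_enum I) => [|i s IH].
  by under eq_fun do rewrite big_nil; exact: smooth_cst.
by under eq_fun do rewrite big_cons; exact: smooth_add.
Qed.

Lemma real_analytic_continuous n (f : 'cV[R]_n -> R) : real_analytic f -> continuous f.
Proof. by move=> /real_analytic_gradient[g [_ fg]]; exact: (gradient_fun_continuous (g := g)). Qed.

Lemma smooth_continuous n (x lam : R -> 'cV[R]_n) f : cont01 x -> cont01 lam ->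
  smooth x lam f -> {within I01, continuous f}.
Proof.
move=> cx cl; elim=> {f} [c|f fa|i|f g _ IHf _ IHg|f g _ IHf _ IHg].
- exact: within_cont_cst.
- by apply: cont01_comp => //; exact: real_analytic_continuous.
- exact: cl.
- exact: within_contD.
- exact: within_contM.
Qed.

Lemma smooth_deriv n (x lam : R -> 'cV[R]_n) (x' lam' : 'I_n -> R -> R) :
  (forall i, smooth x lam (x' i)) -> (forall i, smooth x lam (lam' i)) ->
  (forall i (s : R), 0 < s < 1 -> is_derive s 1 (fun s => x s i ord0) (x' i s)) ->
  (forall i (s : R), 0 < s < 1 -> is_derive s 1 (fun s => lam s i ord0) (lam' i s)) ->
  forall f, smooth x lam f -> exists2 g, smooth x lam g &
    forall s : R, 0 < s < 1 -> is_derive s 1 f (g s).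
Proof.
move=> sx sl dx dl f; elim=> {f} [c|f fa|i|f g sf [f' sf' df] sg [g' sg' dg]|
    f g sf [f' sf' df] sg [g' sg' dg]].
- by exists (fun=> 0); [exact: smooth_cst | move=> s _; exact: is_derive_cst].
- have [g [ga fg]] := real_analytic_gradient fa.
  exists (fun s => \sum_l g l (x s) * x' l s).
    by apply: smooth_sum => l; apply: smooth_mul => //; exact: smooth_fun.
  by move=> s s01; apply: is_derive_comp => // l; exact: dx.
- by exists (lam' i) => // s s01; exact: dl.
- exists (fun s => f' s + g' s); first exact: smooth_add.
  by move=> s s01; apply: is_deriveD; [exact: df | exact: dg].
- exists (fun s => f s * g' s + g s * f' s).
    by apply: smooth_add; exact: smooth_mul.
  by move=> s s01; have d1 := df s s01; have d2 := dg s s01; exact: is_deriveM.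
Qed.

Lemma Rint_dir_derive (f : R -> R) (s : R) : {within I01, continuous f} -> 0 < s < 1 ->
  is_derive s 1 (fun t => \int[mu]_(x in dir false t) f x) (f s).
Proof.
move=> cf /andP[s0 s1]; have fi := intg_cont cf.
have cs : {for s, continuous f}.
  have [h _ _] := (continuous_within_itvP _ (@ltr01 R)).1 cf.
  by apply: h; rewrite in_itv /= s0.
have [d e] := continuous_FTC1_closed s1 fi s0 cs.
by split => //; rewrite -derive1E.
Qed.

Lemma near_I01 (s : R) : 0 < s < 1 -> \forall t \near s, I01 t.
Proof.
move=> s01; have : s \in `]0, 1[%R by rewrite in_itv.
move/near_in_itvoo; apply: filterS => t; rewrite /= !in_itv /= => /andP[t0 t1].
by rewrite !ltW.
Qed.

Lemma weak_derivative (f f' : R -> R) (phi : R -> R) :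
  {within I01, continuous f} -> {within I01, continuous f'} ->
  (forall s : R, 0 < s < 1 -> is_derive s 1 f (f' s)) -> test_function phi ->
  (\int[mu]_(s in `[0%R, 1%R]) (f s * derive1 phi s)%:E =
   - \int[mu]_(s in `[0%R, 1%R]) (f' s * phi s)%:E)%E.
Proof.
move=> cf cf' df [dphi [b [c [b0 bc c1 phi0]]]].
have cphi j : continuous (derive1n j phi).
  by move=> x; apply: differentiable_continuous; apply/derivable1_diffP; exact: dphi.
have p0 : phi 0 = 0 by apply: phi0; left.
have p1 : phi 1 = 0 by apply: phi0; right.
have [cfo cf0 cf1] := (continuous_within_itvP _ (@ltr01 R)).1 cf.
rewrite (@integration_by_parts _ f phi f' (derive1 phi)) //.
- by rewrite p0 p1 !mulr0 subrr add0e.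
- split => //= x; rewrite in_itv /= => x01; by have [] := df x x01.
- by move=> x; rewrite in_itv /= => x01; rewrite derive1E; have [_ ->] := df x x01.
- by apply: continuous_subspaceT; exact: (cphi 1%N).
- split => [x _||]; first exact: (dphi 0%N).
  + by apply: cvg_at_right_filter; exact: (cphi 0%N).
  + by apply: cvg_at_left_filter; exact: (cphi 0%N).
Qed.

End Smooth.

(** * Sobolev regularity of critical points *)

Section Regularity.
Context {R : realType}.
Local Notation mu := (@lebesgue_measure R).
Local Notation I01 := (`[0%R, 1%R]%classic : set R).

Lemma Rint_ae (f g : R -> R) (D : set (measurableTypeR R)) : measurable D -> D `<=` I01 ->
  measurable_fun I01 f -> measurable_fun I01 g ->
  {ae mu, forall s, I01 s -> f s = g s} ->
  (\int[mu]_(s in D) (f s)%:E = \int[mu]_(s in D) (g s)%:E)%E.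
Proof.
move=> mD DI mf mg fg; apply: ae_eq_integral => //.
- by apply/measurable_EFinP; exact: measurable_funS mf.
- by apply/measurable_EFinP; exact: measurable_funS mg.
- apply: (@filterS _ _ (ae_filter_ringOfSetsType mu) _ _ _ fg) => s h Ds.
  by congr EFin; exact: h (DI s Ds).
Qed.

Context {n k : nat} (F : 'cV[R]_n -> 'M[R]_(n, k)) (x0 : 'cV[R]_n) (L : R).
Context (L0 : 0 <= L) (lipF : forall x y, `|F x - F y| <= L * `|x - y|).
Context (da : 'I_n -> 'cV[R]_n -> R).
Context (dF : 'I_n -> 'I_k -> 'I_n -> 'cV[R]_n -> R) (beta : R).
Context (F_analytic : forall i j, real_analytic (fun x => F x i j))
  (dF_analytic : forall l j i, real_analytic (dF l j i)).
Local Notation X := (traj F x0).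

(** The integral equations for x and lam do not see null sets, so u can be replaced in them by the
    continuous function [ut]. Their integrands are then continuous, and the equations become
    classical differential equations with right-hand sides in the algebra [S]. *)
Theorem critical_inH (u : R -> 'cV[R]_k) lam : inL2 u -> adjoint F x0 da dF u lam ->
  L2norm (grad F x0 beta u lam) = 0 -> forall m, inH m u.
Proof.
move=> hu [cl hl] gr0 m.
have cx : cont01 (X u) := cont01_traj L0 lipF hu.
have ig : inL2 (grad F x0 beta u lam) by exact: (inL2_grad x0 L0 lipF).
pose S := smooth (X u) lam.
have Scont f : S f -> {within I01, continuous f} by exact: smooth_continuous.
have Smeas f : S f -> measurable_fun I01 f by move=> /Scont/intg_cont/intg_meas.
(* The representative of u obtained by solving the vanishing of [grad u lam] for u. *)
pose ut i s := - beta * \sum_l F (X u s) l i * lam s l ord0.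
have Sut i : S (ut i).
  apply: smooth_mul; first exact: smooth_cst.
  apply: smooth_sum => l; apply: smooth_mul; last exact: smooth_lam.
  exact: (smooth_fun _ _ (F_analytic l i)).
have hae : {ae mu, forall s, I01 s -> forall i, u s i ord0 = ut i s}.
  have h : {ae mu, forall s, forall i, I01 s -> (grad F x0 beta u lam s i ord0)%:E = 0%E}.
    apply: (filter_forall (F := almost_everywhere mu) (ae_filter_ringOfSetsType mu)).
    by move=> i; exact: (L2norm_eq0_ae ig gr0 i).
  apply: (@filterS _ _ (ae_filter_ringOfSetsType mu) _ _ _ h) => s {}h Is i.
  have : grad F x0 beta u lam s i ord0 = 0 by apply: EFin_inj; exact: h i Is.
  rewrite /grad !mxE => /eqP; rewrite addr_eq0 => /eqP ->; rewrite /ut mulNr; congr (- (_ * _)).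
  by apply: eq_bigr => l _; rewrite mxE.
have mu_ i : measurable_fun I01 (fun s => u s i ord0) by exact: hu.1.
pose x' i s := \sum_j F (X u s) i j * ut j s.
have Sx' i : S (x' i).
  by apply: smooth_sum => j; apply: smooth_mul; [exact: (smooth_fun _ _ (F_analytic i j)) | exact: Sut].
pose adj' i s := \sum_l lam s l ord0 * \sum_j dF l j i (X u s) * ut j s.
have Sadj' i : S (adj' i).
  apply: smooth_sum => l; apply: smooth_mul; first exact: smooth_lam.
  apply: smooth_sum => j; by apply: smooth_mul; [exact: (smooth_fun _ _ (dF_analytic l j i)) | exact: Sut].
have xE i s : I01 s -> X u s i ord0 = x0 i ord0 + \int[mu]_(t in dir false s) x' i t.
  move=> Is; rewrite (trajE x0 L0 lipF) //; congr (_ + fine _).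
  apply: Rint_ae; [exact: mdir | exact: dir_sub | | exact: Smeas |].
    by apply: intg_meas; exact: (intg_traj x0 L0 lipF).
  apply: (@filterS _ _ (ae_filter_ringOfSetsType mu) _ _ _ hae) => t ht It; rewrite mxE; apply: eq_bigr => j _; by rewrite ht.
have lamE i s : I01 s -> lam s i ord0 = da i (X u 1) + \int[mu]_(t in dir true s) adj' i t.
  move=> Is; have [h1 ->] := hl i => //; congr (_ + fine _).
  apply: Rint_ae; [exact: mdir | exact: dir_sub | exact: intg_meas | exact: Smeas |].
  apply: (@filterS _ _ (ae_filter_ringOfSetsType mu) _ _ _ hae) => t ht It; apply: eq_bigr => l _; congr (_ * _).
  by apply: eq_bigr => j _; rewrite ht.
have dx i (s : R) : 0 < s < 1 -> is_derive s 1 (fun s => X u s i ord0) (x' i s).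
  move=> s01; have d := is_deriveD (is_derive_cst (x0 i ord0) s 1) (Rint_dir_derive (Scont _ (Sx' i)) s01).
  rewrite add0r in d; apply: near_eq_is_derive d.
  by apply: filterS (near_I01 s01) => t It; rewrite xE.
(* The integral from s to 1 is the total integral minus the forward primitive, hence the sign.
   Writing it as a product with the constant -1 keeps the derivative visibly in [S]. *)
have dl i (s : R) : 0 < s < 1 -> is_derive s 1 (fun s => lam s i ord0) (-1 * adj' i s).
  move=> s01; have ia := intg_cont (Scont _ (Sadj' i)).
  have d := is_deriveB (is_derive_cst (da i (X u 1) + \int[mu]_(t in I01) adj' i t) s 1)
    (Rint_dir_derive (Scont _ (Sadj' i)) s01).
  rewrite sub0r in d; rewrite mulN1r; apply: near_eq_is_derive d.
  apply: filterS (near_I01 s01) => t It.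
  rewrite lamE // Rint_dir_split // addrA //.
(* The statement is made total, with an arbitrary value outside [S], so that choice yields an
   operator [D] that can be iterated. *)
have hD f : exists g, S f -> S g /\ forall s : R, 0 < s < 1 -> is_derive s 1 f (g s).
  have [sf|nsf] := pselect (S f); last by exists f.
  have Sl i : S (fun s => -1 * adj' i s) by apply: smooth_mul; [exact: smooth_cst | exact: Sadj'].
  have [g sg dg] := smooth_deriv Sx' Sl dx dl sf.
  by exists g.
have [D HD] := choice hD.
pose w j i := iter j D (ut i).
have Sw j i : S (w j i) by elim: j => [|j IH] //; exact: (HD _ IH).1.
(* [inH] demands u itself at order 0, not its representative. Only the first weak derivative
   therefore passes through the almost everywhere equality; the higher ones are classical. *)
exists (fun j => if j is j'.+1 then fun s => \col_i w j'.+1 i s else u); split => //.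
- move=> [|j] _ //; apply/inL2P => i.
  have -> : (fun s => (\col_i w j.+1 i s) i ord0) = w j.+1 i by apply/funext => s; rewrite mxE.
  by apply: sqi_cont; exact: Scont.
- move=> j _ phi tphi i.
  have weak := weak_derivative (Scont _ (Sw j i)) (Scont _ (Sw j.+1 i)) (HD _ (Sw j i)).2 tphi.
  have -> : (\int[mu]_(s in `[0%R, 1%R]) ((\col_i w j.+1 i s) i ord0 * phi s)%:E =
    \int[mu]_(s in `[0%R, 1%R]) (w j.+1 i s * phi s)%:E)%E.
    by apply: eq_integral => s _; rewrite mxE.
  rewrite -weak; case: j weak => [|j] _; last by apply: eq_integral => s _; rewrite mxE.
  have mphi : measurable_fun I01 (derive1 phi).
    have cphi : continuous (derive1 phi).
      by move=> y; apply: differentiable_continuous; apply/derivable1_diffP; exact: (tphi.1 1%N).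
    by apply: subspace_continuous_measurable_fun; [exact: mI01 | exact: continuous_subspaceT].
  apply: Rint_ae; [exact: mI01 | exact: subset_refl | exact: measurable_funM | |].
    by apply: measurable_funM => //; exact: Smeas.
  by apply: (@filterS _ _ (ae_filter_ringOfSetsType mu) _ _ _ hae) => s hs Is; rewrite hs.
Qed.

End Regularity.

(** * Criticality and regularity of limiting points of the flow *)

Theorem mainTheorem17 (R : realType) (n k : nat)
  (F : 'cV[R]_n -> 'M[R]_(n, k)) (x0 : 'cV[R]_n) (a : 'cV[R]_n -> R)
  (beta : R) (u0 : R -> 'cV[R]_k) (U : R -> R -> 'cV[R]_k) (uinf : R -> 'cV[R]_k) :
  (exists L : R, forall x y, `|F x - F y| <= L * `|x - y|) ->
  (forall x, 0 <= a x) ->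
  (forall (i : 'I_n) (j : 'I_k), real_analytic (fun x => F x i j)) ->
  real_analytic a ->
  0 < beta ->
  inL2 u0 ->
  U 0 = u0 ->
  gradient_flow F x0 a beta U ->
  limiting_point U uinf ->
  is_gradient F x0 a beta uinf (fun _ => 0) /\
  (forall m : nat, (1 <= m)%N -> inH m uinf).
Proof.
move=> [L' lipL'] a0 F_an a_an beta0 _ _ [hU [G hG]] [hinf [tj [tjoo cvj]]].
(* The given Lipschitz constant carries no sign, while the estimates use a nonnegative one. *)
pose L := `|L'|.
have lipF x y : `|F x - F y| <= L * `|x - y|.
  by apply: le_trans (lipL' x y) _; rewrite ler_wpM2r // ler_norm.
have [dF hdF] := choice (fun q : 'I_n * 'I_k => real_analytic_gradient (F_an q.1 q.2)).
have [da [da_an daP]] := real_analytic_gradient a_an.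
pose dF' l j := dF (l, j).
have dF_an l j i : real_analytic (dF' l j i) by exact: (hdF (l, j)).1.
have dFP l j : is_gradient_fun (fun x => F x l j) (dF' l j) by exact: (hdF (l, j)).2.
have dF_cont l j i : continuous (dF' l j i) by exact: real_analytic_continuous.
have da_cont i : continuous (da i) by exact: real_analytic_continuous.
have Fb0 u : 0 <= Fbeta F x0 a beta u.
  by rewrite addr_ge0 // mulr_ge0 // ?sqr_ge0 // ltW.
have hg t : 0 <= t -> is_gradient F x0 a beta (U t) (G t) by move=> /hG[].
have flow t (t0 : 0 <= t) := (hG t t0).2.
have happ e : 0 < e -> exists v g, [/\ inL2 v, is_gradient F x0 a beta v g,
    L2norm (fun s => v s - uinf s) <= e & L2norm g <= e].
  by move=> e0; exact: (approximate_critical hU hg flow Fb0 hinf tjoo cvj e0).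
have [crit gr0] := critical_of_approximate (normr_ge0 L') lipF dF_cont da_cont dFP daP hinf happ.
split=> // m _.
have [lam hlam] := adjoint_exists x0 (normr_ge0 L') lipF da dF_cont hinf.
exact: (critical_inH (normr_ge0 L') lipF F_an dF_an hinf hlam (gr0 lam hlam)).
Qed.
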